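(* For all integers $n\geq 1$ and $k\geq 2n-1$, $$\Sigma_{k,2n}=-\frac{1}{k}\,[t^{k+1-2n}]\left(\frac{k-1}{2n}\,\hat{m}_{2n}\,P_{2n-1}(t)+\sum_{\substack{\lambda\vdash 2n\\ l(\lambda)\geq 2}}\hat{m}_{\lambda}\,\frac{P_{\lambda}(t)}{C(t)}\right),$$ where $\hat m_{2n}$ is $\hat m_\lambda$ for the partition $\lambda$ with the single part $2n$.
   Context: Kerov's character polynomials. For $k\ge1$, $\Sigma_k$ denotes Kerov's character polynomial: the universal polynomial with integer coefficients in indeterminates $R_2,R_3,\ldots,R_{k+1}$ such that $\widehat{\chi}_\omega(k1^{n-k})=\Sigma_k(R_2(\omega),\ldots,R_{k+1}(\omega))$ for all partitions $\omega\vdash n$ and all $n\geq k$. Here $\widehat{\chi}_\omega(k1^{n-k})=n(n-1)\cdots(n-k+1)\,\chi_\omega(k1^{n-k})/\chi_\omega(1^n)$, where $\chi_\omega(\lambda)$ is the character of the irreducible representation of the symmetric group $\mathfrak{S}_n$ indexed by $\omega$ on the class of cycle type $\lambda$. The free cumulants $R_i(\omega)$ are defined by $z^{-1}+\sum_{i\ge1}R_i(\omega)z^{i-1}=H_\omega^{\langle -1\rangle}(z)$ (compositional inverse, $H_\omega$ being expanded in powers of $1/z$ at infinity), where $H_\omega(z)=\prod_{i=1}^{m-1}(z-y_i)/\prod_{i=1}^{m}(z-x_i)$, with $x_1,\ldots,x_m$ the local minima and $y_1,\ldots,y_{m-1}$ the local maxima of the boundary curve of the Young diagram of $\omega$ (French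 convention) rotated counterclockwise by $45^\circ$, scaled so that these are integers (i.e. the $x_i$ are the contents, column minus row, of the addable boxes of $\omega$, and the $y_i$ the contents of the removable boxes). Equivalently, by a known theorem (Okounkov, Biane, Stanley): with $R(x)=1+\sum_{i\ge2}R_ix^i$, $F(x)=x/R(x)$, $G(x)=1/F^{\langle-1\rangle}(x^{-1})$, where $\langle -1\rangle$ is compositional inverse, one has $\Sigma_k=-\frac1k[x^{-1}]_\infty\prod_{j=0}^{k-1}G(x-j)$, where $[x^{-1}]_\infty$ is the coefficient of $x^{-1}$ in the expansion at $x=\infty$ (in descending powers of $x$). Graded pieces: $\Sigma_{k,2n}=[u^{k+1-2n}]\,\Sigma_k(R_2u^2,R_3u^3,\ldots,R_{k+1}u^{k+1})$, i.e. the sum of all terms of weight $k+1-2n$ in $\Sigma_k$, where $R_{j_1}\cdots R_{j_i}$ has weight $j_1+\cdots+j_i$. $[t^r]$ denotes coefficient extraction. Series: $C(t)=\sum_{m\ge0}C_mt^m=\dfrac{1}{1-\sum_{i\geq 2}(i-1)R_it^i}$ (so $C_0=1$, $C_1=0$). With $D=t\frac{d}{dt}$ and $I$ the identity operator, for $m\ge1$ $$P_m(t)=-\frac{1}{m!}C(t)(D+(m-2)I)C(t)\cdots(D+I)C(t)\,D\,C(t),$$ where each operator acts on everything to its right; e.g. $P_1=-C$, $P_2=-\frac12C\,DC$, $P_3=-\frac16 C(D+I)(C\,DC)$. For a partition $\lambda=\lambda_1\cdots\lambda_{l(\lambda)}$ with $l(\lambda)$ parts, $P_\lambda(t)=\prod_{j=1}^{l(\lambda)}P_{\lambda_j}(t)$.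 $\hat m_\lambda$ denotes the monomial symmetric function $m_\lambda(x_1,x_2,\ldots)$ evaluated at $x_i=i$ for $1\le i\le k-1$ and $x_i=0$ for $i\ge k$ (so it depends on $k$). *)

(* Defs.v *)
From HB Require Import structures.
From mathcomp Require Import all_boot all_order all_fingroup all_algebra.
From mathcomp Require Import all_solvable all_field all_character.
From mathcomp Require Export mpoly.
Set Implicit Arguments.
Unset Strict Implicit.
Unset Printing Implicit Defensive.

Import GRing.Theory.
Local Open Scope ring_scope.

(* ---------------------------------------------------------------------- *)
(* Partitions: weakly decreasing sequences of positive integers           *)
(* ---------------------------------------------------------------------- *)

Definition is_partition_of (N : nat) (w : seq nat) : bool :=
  [&& sorted geq w, 0%N \notin w & sumn w == N].

(* A partition of N has at most N parts, all at most N: list them by padding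
   with zeros to N entries.  See mem_partitions and uniq_partitions. *)
Definition partitions (N : nat) : seq (seq nat) :=
  [seq w <- undup [seq [seq x <- map val (t : N.-tuple 'I_N.+1) | x != 0%N]
                  | t <- enum {: N.-tuple 'I_N.+1}]
  | is_partition_of N w].

Definition conj_partition (w : seq nat) : seq nat :=
  [seq count (fun p => j < p)%N w | j <- iota 0 (head 0%N w)].

Lemma uniq_partitions N : uniq (partitions N).
Proof. by rewrite filter_uniq ?undup_uniq. Qed.

Lemma size_partition w : 0%N \notin w -> (size w <= sumn w)%N.
Proof.
elim: w => //= x w IHw; rewrite in_cons negb_or => /andP[x0 /IHw le_w].
by rewrite -add1n leq_add // lt0n eq_sym.
Qed.

Lemma mem_partitions N w : (w \in partitions N) = is_partition_of N w.
Proof.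
rewrite mem_filter andb_idr // => /and3P[_ w0 /eqP Nw].
have szw : (size w <= N)%N by rewrite -Nw size_partition.
pose s : seq 'I_N.+1 := map inord w ++ nseq (N - size w) ord0.
have szs : size s == N by rewrite size_cat size_map size_nseq subnKC.
rewrite mem_undup; apply/mapP; exists (Tuple szs); first by rewrite mem_enum.
have lew x : x \in w -> (x < N.+1)%N.
  rewrite ltnS -Nw; elim: (w) => //= y u IHu; rewrite in_cons.
  by case/predU1P=> [->|/IHu xu]; rewrite ?leq_addr // (leq_trans xu) ?leq_addl.
have -> : map val (Tuple szs) = w ++ nseq (N - size w) 0%N.
  rewrite /= map_cat map_nseq /= -map_comp; congr (_ ++ _).
  rewrite -[RHS]map_id; apply/eq_in_map => x /lew xN.
  by rewrite /= inordK.
rewrite filter_cat filter_nseq /= cats0.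
by apply/esym/all_filterP/allP => x xw; apply: contraNneq w0 => <-.
Qed.

(* Contents (column minus row) of the addable and of the removable boxes; row
   i has nth 0 w i boxes. *)
Definition addable_contents (w : seq nat) : seq int :=
  [seq (nth 0%N w i)%:Z - i%:Z
  | i <- iota 0 (size w).+1 & (i == 0%N) || (nth 0 w i < nth 0 w i.-1)%N].

Definition removable_contents (w : seq nat) : seq int :=
  [seq (nth 0%N w i)%:Z - 1 - i%:Z
  | i <- iota 0 (size w) & (nth 0 w i.+1 < nth 0 w i)%N].

(* ---------------------------------------------------------------------- *)
(* Formal power series, as coefficient sequences                          *)
(* ---------------------------------------------------------------------- *)

Section PowerSeries.
Variable A : comNzRingType.
Implicit Types f g : nat -> A.

Definition fps_one : nat -> A := fun n => (n == 0%N)%:R.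

Definition fps_var : nat -> A := fun n => (n == 1%N)%:R.

Definition fps_mul f g : nat -> A :=
  fun n => \sum_(i < n.+1) f i * g (n - i)%N.

Definition fps_exp f j : nat -> A := iter j (fps_mul f) fps_one.

(* Composition f(g(t)); meaningful when g 0 = 0, since then g ^ j has no
   coefficient of degree < j. *)
Definition fps_comp f g : nat -> A :=
  fun n => \sum_(j < n.+1) f j * fps_exp g j n.

(* Multiplicative inverse of a series with constant term 1, as the geometric
   series 1 / f = \sum_j (1 - f) ^ j. *)
Definition fps_inv f : nat -> A :=
  fun n => \sum_(j < n.+1) fps_exp (fun i => fps_one i - f i) j n.

(* (D + c I) f, where D = t d/dt *)
Definition fps_euler (c : nat) f : nat -> A :=
  fun n => f n *+ n + f n *+ c.

End PowerSeries.

(* ---------------------------------------------------------------------- *)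
(* Free cumulants                                                         *)
(* ---------------------------------------------------------------------- *)

(* H_w(1/z) = z * \prod_i (1 - y_i z) / \prod_i (1 - x_i z), as a series in z:
   this is the expansion of H_w at infinity (there is one more x than y). *)
Definition H_at_infinity (w : seq nat) : nat -> int :=
  fps_mul
    (fun n => ('X * \prod_(y <- removable_contents w) (1 - y *: 'X))`_n)
    (fps_inv (fun n => (\prod_(x <- addable_contents w) (1 - x *: 'X))`_n)).

(* The sequence (r i)_(i >= 1) is the sequence of free cumulants of w, i.e.
   K(z) = z^-1 + \sum_(i >= 1) r_i z^(i-1) satisfies H_w(K(z)) = z.  Here
   1 / K(z) = z / (1 + \sum_(i >= 1) r_i z^i), and H_w(K(z)) is
   H_at_infinity w evaluated at 1 / K(z).  The value r 0 is irrelevant. *)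
Definition is_free_cumulants (w : seq nat) (r : nat -> int) : Prop :=
  forall n : nat,
    fps_comp (H_at_infinity w)
      (fps_mul (fps_var int)
               (fps_inv (fun i => if i == 0%N then 1 else r i))) n
    = fps_var int n.

(* ---------------------------------------------------------------------- *)
(* Irreducible characters of the symmetric group 'S_N                     *)
(* ---------------------------------------------------------------------- *)

(* Young subgroup of 'S_N preserving the consecutive blocks of sizes
   w_0, w_1, ...; reshape_index w i is the number of the block containing i. *)
Definition young_set (N : nat) (w : seq nat) : {set 'S_N} :=
  [set s : 'S_N | [forall i : 'I_N,
     reshape_index w (s i) == reshape_index w i]].

Lemma young_group_set N w : group_set (young_set N w).
Proof.
apply/group_setP; split=> [|s t]; first by rewrite inE; apply/forallP=> i; rewrite perm1.
rewrite !inE => /forallP Hs /forallP Ht; apply/forallP=> i.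
by rewrite permM (eqP (Ht _)).
Qed.

Canonical young_group N w : {group 'S_N} := Group (young_group_set N w).

Lemma sign_is_class_fun N :
  is_class_fun <<[set: 'S_N]>>%g [ffun s : 'S_N => (-1 : algC) ^+ odd_perm s].
Proof.
rewrite genGid; apply: intro_class_fun => [s t _ _|s]; last by rewrite inE.
by rewrite conjgE !odd_permM odd_permV addbC addbK.
Qed.

Definition cfsign N : 'CF([set: 'S_N]) := Cfun 0 (sign_is_class_fun N).

(* The irreducible character indexed by the partition w of N is the unique
   common constituent of the trivial character of the Young subgroup of w and of
   the sign character of the Young subgroup of the conjugate partition, both
   induced to 'S_N.  Thus the one-part partition indexes the trivial character. *)
Definition is_irr_of_partition (N : nat) (w : seq nat)
    (i : Iirr [set: 'S_N]) : bool :=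
  (i \in irr_constt ('Ind[[set: 'S_N]] (1 : 'CF(young_group N w)))) &&
  (i \in irr_constt
     ('Ind[[set: 'S_N]] ('Res[young_group N (conj_partition w)] (cfsign N)))).

(* s has one k-cycle and N - k fixed points *)
Definition has_cycle_type_k1 (N k : nat) (s : 'S_N) : bool :=
  perm_eq [seq #|pred_of_set X| | X <- enum (porbits s)]
          (k :: nseq (N - k) 1%N).

(* ---------------------------------------------------------------------- *)
(* Kerov's character polynomial                                           *)
(* ---------------------------------------------------------------------- *)

(* The indeterminate 'X_j, for j : 'I_k, stands for R_(j+2).  N ^_ k is the
   falling factorial N (N - 1) ... (N - k + 1). *)
Definition is_kerov_polynomial (k : nat) (Sigma : {mpoly int[k]}) : Prop :=
  forall (N : nat) (w : seq nat) (r : nat -> int)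
         (i : Iirr [set: 'S_N]) (s : 'S_N),
    (k <= N)%N -> is_partition_of N w ->
    is_free_cumulants w r -> is_irr_of_partition w i -> has_cycle_type_k1 k s ->
    (N ^_ k)%:R * 'chi_i s / 'chi_i 1%g
    = (Sigma.@[fun j : 'I_k => r j.+2])%:~R.

(* [u^d] Sigma(R_2 u^2, R_3 u^3, ..., R_(k+1) u^(k+1)) *)
Definition weight_part (k : nat) (Sigma : {mpoly int[k]}) (d : nat)
    : {mpoly int[k]} :=
  (mmap (fun c : int => (c%:MP : {mpoly int[k]})%:P)
        (fun j : 'I_k => ('X_j : {mpoly int[k]}) *: 'X^(j.+2)) Sigma)`_d.

(* ---------------------------------------------------------------------- *)
(* The series C and P                                                     *)
(* ---------------------------------------------------------------------- *)

Section GeneratingSeries.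
Variable k : nat.
Local Notation A := {mpoly rat[k]}.

(* R_2, ..., R_(k+1) are the indeterminates.  The others are set to 0; only
   coefficients of degree < k will be extracted, and by homogeneity these
   do not involve R_i for i >= k. *)
Definition Rvar (i : nat) : A :=
  if (2 <= i)%N then
    if insub (i - 2)%N is Some j then 'X_(j : 'I_k) else 0
  else 0.

Definition Cser : nat -> A :=
  fps_inv (fun i => fps_one A i - Rvar i *+ i.-1).

(* Pchain j is C (D + (j-1) I) C ... (D + I) C D C, with j + 1 factors C *)
Fixpoint Pchain (j : nat) : nat -> A :=
  if j is j'.+1 then fps_mul Cser (fps_euler j' (Pchain j')) else Cser.

Definition Pser (m : nat) : nat -> A :=
  fun d => - ((m`!)%:R^-1 : rat) *: Pchain m.-1 d.

Definition Ppart (lambda : seq nat) : nat -> A :=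
  foldr (fun m f => fps_mul (Pser m) f) (fps_one A) lambda.

End GeneratingSeries.

(* ---------------------------------------------------------------------- *)
(* Monomial symmetric functions                                           *)
(* ---------------------------------------------------------------------- *)

(* m_lambda in M variables: the sum of all monomials whose multiset of nonzero
   exponents is lambda. *)
Definition monomial_sym (M : nat) (lambda : seq nat) (x : 'I_M -> rat) : rat :=
  \sum_(a : {ffun 'I_M -> 'I_(sumn lambda).+1}
        | perm_eq [seq e <- map val (codom a) | e != 0%N] lambda)
     \prod_(i < M) x i ^+ a i.

(* m_lambda(1, 2, ..., k-1, 0, 0, ...) *)
Definition mhat (k : nat) (lambda : seq nat) : rat :=
  @monomial_sym k.-1 lambda (fun i => (i.+1)%:R).

(* Main.v *)
Require Import Defs.
From HB Require Import structures.
From mathcomp Require Import all_boot all_order all_fingroup all_algebra.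
From mathcomp Require Import all_solvable all_field all_character.
From mathcomp Require Import ring zify.
From mathcomp.classical Require boolp.
Set Implicit Arguments.
Unset Strict Implicit.
Unset Printing Implicit Defensive.
Import Order.TTheory GRing.Theory Num.Theory.
Local Open Scope ring_scope.

(** Kerov's polynomial is known only through its values at the free cumulants of
    partitions, so the proof computes these values, shows that they determine a
    polynomial, and reads off the graded pieces of the polynomial so found.

    - Values. Let w have m rows, and let l_0 < ... < l_(m-1) be its beads, the
      parts in increasing order plus 0, 1, ..., m - 1.  The alternating sum, over
      the permutations s of m letters, of the permutation characters of the Young
      subgroups with blocks l_i - s(i) takes on a permutation of cycle type mu
      the value [alt], the coefficient in Frobenius' formula.  Seen from the
      holes between the beads ([alt_dual]), it is up to a sign the sign character
      times the analogous sum for the conjugate partition.  Pairing the two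
      descriptions counts injective pairs of colourings with prescribed numbers
      of points of each colour, and these must fill the diagram of w
      ([weight_pairing]): so this virtual character has norm 1 and is the
      irreducible character indexed by w ([frobenius_character]).  At a k-cycle
      and at 1 it is given by Vandermonde determinants, and the normalised value
      at a k-cycle is a sum over the beads ([kerov_value]).

    - Free cumulants. That sum is a sum of residues, equal to
      - 1/k [1/x] \prod_(j < k) 1 / H_w(x - j) by [sum_residues].  The substitution
      x = 1 / F(t), F(t) = t / R(t), which is inverse to H_w, turns it by
      [lagrange_residue] into
      - 1/k [t^(k+1)] (1 / C(t)) \prod_(0 < j < k) t G(1 / F(t) - j), G = 1 / H_w.
      As d/dx = - t C D for this substitution, Taylor's formula gives
      t G(1 / F(t) - j) = \sum_m j^m t^m P_m(t), with P_0 = 1 ([taylor_sumE]).  All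
      this involves w only through R.

    - Density. For multirectangular diagrams with s v_t rows of length k - t, the
      free cumulants are polynomials in s vanishing at 0, whose linear terms are
      moments of the weights v_t, hence arbitrary enough by Vandermonde: no nonzero
      polynomial vanishes at the free cumulants of all large partitions
      ([free_cumulants_dense]).  So Kerov's polynomial is the expression above with
      indeterminate R_i ([kerov_polynomialE]).

    - Graded pieces. In that product the coefficient of t^i in P_m has weight i, so
      the part of weight k + 1 - d collects the terms P_(m_1) ... P_(m_(k-1)) / C with
      m_1 + ... + m_(k-1) = d, with coefficient \prod_j j^(m_j) ([weight_candidate]).
      Grouping them by the partition formed by the nonzero m_j gives the monomial
      symmetric functions at 1, ..., k - 1 ([partition_sum]).  The term of the
      partition with one part is rewritten with [Pser_div_C]. *)

(** * The ring of formal power series *)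

Definition fps (A : comNzRingType) : Type := nat -> A.

Section FpsRing.
Variable A : comNzRingType.
Implicit Types f g h : fps A.

HB.instance Definition _ := boolp.gen_eqMixin (fps A).
HB.instance Definition _ := boolp.gen_choiceMixin (fps A).

Lemma fpsP f g : f =1 g -> f = g.
Proof. exact: boolp.funext. Qed.

Let zero : fps A := fun=> 0.
Let opp f : fps A := fun n => - f n.
Let add f g : fps A := fun n => f n + g n.

Fact fps_addA : associative add.
Proof. by move=> f g h; apply: fpsP => n; rewrite /add addrA. Qed.
Fact fps_addC : commutative add.
Proof. by move=> f g; apply: fpsP => n; rewrite /add addrC. Qed.
Fact fps_add0 : left_id zero add.
Proof. by move=> f; apply: fpsP => n; rewrite /add add0r. Qed.
Fact fps_addN : left_inverse zero opp add.
Proof. by move=> f; apply: fpsP => n; rewrite /add /opp addNr. Qed.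

HB.instance Definition _ :=
  GRing.isZmodule.Build (fps A) fps_addA fps_addC fps_add0 fps_addN.

Definition trunc N f : {poly A} := \poly_(i < N.+1) f i.

Lemma coef_trunc N f i : (i <= N)%N -> (trunc N f)`_i = f i.
Proof. by move=> le_iN; rewrite coef_poly ltnS le_iN. Qed.

Lemma eq_coef_mul (p q p' q' : {poly A}) n :
    (forall i, (i <= n)%N -> p`_i = p'`_i) ->
    (forall i, (i <= n)%N -> q`_i = q'`_i) -> (p * q)`_n = (p' * q')`_n.
Proof.
move=> eq_p eq_q; rewrite !coefM; apply: eq_bigr => i _.
by rewrite eq_p ?eq_q ?leq_subr // -ltnS.
Qed.

Lemma fps_mul_trunc N f g n :
  (n <= N)%N -> fps_mul f g n = (trunc N f * trunc N g)`_n.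
Proof.
move=> le_nN; rewrite coefM; apply: eq_bigr => i _.
have le_in : (i <= n)%N by rewrite -ltnS.
by rewrite !coef_trunc ?(leq_trans (leq_subr _ _)) // (leq_trans le_in).
Qed.

Fact fps_mulA : associative (@fps_mul A : fps A -> fps A -> fps A).
Proof.
move=> f g h; apply: fpsP => n.
rewrite !(fps_mul_trunc _ _ (leqnn n)).
transitivity ((trunc n f * (trunc n g * trunc n h))`_n).
  apply: eq_coef_mul => // i le_in.
  by rewrite coef_trunc // (fps_mul_trunc _ _ le_in).
rewrite mulrA; apply: eq_coef_mul => // i le_in.
by rewrite coef_trunc // (fps_mul_trunc _ _ le_in).
Qed.

Fact fps_mulC : commutative (@fps_mul A : fps A -> fps A -> fps A).
Proof.
by move=> f g; apply: fpsP => n; rewrite !(fps_mul_trunc _ _ (leqnn n)) mulrC.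
Qed.

Fact fps_mul1 : left_id (fps_one A : fps A) (@fps_mul A).
Proof.
move=> f; apply: fpsP => n; rewrite /fps_mul big_ord_recl /= subn0 mul1r.
by rewrite big1 ?addr0 // => i _; rewrite /fps_one /= mul0r.
Qed.

Fact fps_mulDl : left_distributive (@fps_mul A : fps A -> fps A -> fps A) add.
Proof.
move=> f g h; apply: fpsP => n; rewrite /add /fps_mul -big_split /=.
by apply: eq_bigr => i _; rewrite mulrDl.
Qed.

Fact fps_one_neq0 : (fps_one A : fps A) != 0.
Proof.
apply/eqP => /(congr1 (fun f : fps A => f 0%N)) /eqP.
by rewrite /fps_one /= (oner_eq0 A).
Qed.

HB.instance Definition _ :=
  GRing.Zmodule_isComNzRing.Build (fps A) fps_mulA fps_mulC fps_mul1
    fps_mulDl fps_one_neq0.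

Lemma coef_fps0 n : (0 : fps A) n = 0. Proof. by []. Qed.
Lemma coef_fps1 n : (1 : fps A) n = (n == 0%N)%:R. Proof. by []. Qed.
Lemma coef_fpsD f g n : (f + g) n = f n + g n. Proof. by []. Qed.
Lemma coef_fpsN f n : (- f) n = - f n. Proof. by []. Qed.
Lemma coef_fpsB f g n : (f - g) n = f n - g n. Proof. by []. Qed.
Lemma coef_fpsM f g n : (f * g) n = \sum_(i < n.+1) f i * g (n - i)%N.
Proof. by []. Qed.
Lemma coef_fpsMn f m n : (f *+ m) n = f n *+ m.
Proof. by elim: m => // m IHm; rewrite !mulrS coef_fpsD IHm. Qed.
Lemma coef_fps_sum I (r : seq I) (P : pred I) (F : I -> fps A) n :
  (\sum_(i <- r | P i) F i) n = \sum_(i <- r | P i) F i n.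
Proof. by elim/big_rec2: _ => // i x y _ <-. Qed.
Lemma coef0_fpsM f g : (f * g) 0%N = f 0%N * g 0%N.
Proof. by rewrite coef_fpsM big_ord1. Qed.

Lemma fps_expE f j : fps_exp f j = f ^+ j.
Proof. by elim: j => // j IHj; rewrite exprS /fps_exp iterS -/(fps_exp f j) IHj. Qed.

(** ** Constants and the variable *)

Definition fpsC (c : A) : fps A := fun n => if n == 0%N then c else 0.
Local Notation fX := (fps_var A : fps A).

Lemma coef_fpsCM c f n : (fpsC c * f) n = c * f n.
Proof.
rewrite coef_fpsM big_ord_recl /= subn0 big1 ?addr0 // => i _.
by rewrite /fpsC /= mul0r.
Qed.

Fact fpsC_zmod_morphism : zmod_morphism fpsC.
Proof. by move=> a b; apply: fpsP => -[|n]; rewrite /= coef_fpsB //= subr0. Qed.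
Fact fpsC_monoid_morphism : monoid_morphism fpsC.
Proof.
split; first by apply: fpsP => -[|n].
by move=> a b; apply: fpsP => -[|n]; rewrite coef_fpsCM //= mulr0.
Qed.
HB.instance Definition _ := GRing.isZmodMorphism.Build A (fps A) fpsC
  fpsC_zmod_morphism.
HB.instance Definition _ := GRing.isMonoidMorphism.Build A (fps A) fpsC
  fpsC_monoid_morphism.

Lemma coef_fpsXM f n : (fX * f) n = if n is m.+1 then f m else 0.
Proof.
case: n => [|n]; first by rewrite coef0_fpsM mul0r.
rewrite coef_fpsM big_ord_recl big_ord_recl /= mul0r mul1r add0r subn1 /=.
by rewrite big1 ?addr0 // => i _; rewrite mul0r.
Qed.

Lemma coef_fpsXnM m f n : (fX ^+ m * f) n = if (n < m)%N then 0 else f (n - m)%N.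
Proof.
elim: m f n => [|m IHm] f n; first by rewrite mul1r subn0.
by rewrite exprSr -mulrA IHm coef_fpsXM ltnS; case: ltngtP => [||->]; rewrite ?subnn //;
   move=> lt_mn; rewrite -(subnSK lt_mn).
Qed.

(** ** Agreement of coefficients below a given degree *)

Definition eqmod n f g := forall i, (i < n)%N -> f i = g i.

Lemma eqmodD n f f' g g' :
  eqmod n f f' -> eqmod n g g' -> eqmod n (f + g) (f' + g').
Proof. by move=> eq_f eq_g i lt_in; rewrite !coef_fpsD eq_f ?eq_g. Qed.
Lemma eqmodN n f f' : eqmod n f f' -> eqmod n (- f) (- f').
Proof. by move=> eq_f i lt_in; rewrite !coef_fpsN eq_f. Qed.
Lemma eqmodM n f f' g g' :
  eqmod n f f' -> eqmod n g g' -> eqmod n (f * g) (f' * g').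
Proof.
move=> eq_f eq_g i lt_in; rewrite !coef_fpsM; apply: eq_bigr => j _.
by rewrite eq_f ?eq_g // ?(leq_ltn_trans _ lt_in) ?leq_subr // -ltnS.
Qed.
Lemma eqmodX n f f' j : eqmod n f f' -> eqmod n (f ^+ j) (f' ^+ j).
Proof. by move=> eq_f; elim: j => // j IHj; rewrite !exprS; apply: eqmodM. Qed.
Lemma eqmod_prod n I (r : seq I) (F F' : I -> fps A) :
  (forall i, eqmod n (F i) (F' i)) ->
  eqmod n (\prod_(i <- r) F i) (\prod_(i <- r) F' i).
Proof.
move=> eq_F; elim: r => [|i r IHr]; first by rewrite !big_nil.
by rewrite !big_cons; apply: eqmodM.
Qed.
Definition fpsV f : fps A := fps_inv f.

Lemma eqmod_inv n f f' : eqmod n f f' -> eqmod n (fpsV f) (fpsV f').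
Proof.
move=> eq_f i lt_in; apply: eq_bigr => j _; rewrite !fps_expE.
by apply: eqmodX lt_in => l lt_ln; rewrite eq_f.
Qed.

Lemma coef_fps_exp_lt g j n : g 0%N = 0 -> (n < j)%N -> (g ^+ j) n = 0.
Proof.
move=> g0; elim: j n => // j IHj n lt_nj.
rewrite exprS coef_fpsM big_ord_recl g0 mul0r add0r big1 // => i _.
by rewrite IHj ?mulr0 //= /bump /=; case: i => i /=; lia.
Qed.

(** ** Inverses *)

(** The truncated geometric sums that define the inverse satisfy the fixed point
    equation of 1 / f = 1 + (1 - f) / f, coefficient by coefficient. *)
Lemma fps_mulV f : f 0%N = 1 -> f * fpsV f = 1.
Proof.
move=> f0; pose g := 1 - f; have g0 : g 0%N = 0 by rewrite /g coef_fpsB f0 subrr.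
have invE M n : (n < M)%N -> fpsV f n = \sum_(j < M) (g ^+ j) n.
  move=> lt_nM; rewrite /fpsV /fps_inv.
  under eq_bigr do rewrite fps_expE -[fun _ => _]/g.
  rewrite (big_ord_widen _ (fun j => (g ^+ j) n) lt_nM) big_mkcond /=.
  by apply: eq_bigr => j _; case: ltnP => // lt_nj; rewrite coef_fps_exp_lt.
suff inv_fix : fpsV f = 1 + g * fpsV f.
  have f_g : f = 1 - g by rewrite /g opprB addrC subrK.
  by rewrite {1}f_g mulrBl mul1r {1}inv_fix addrK.
apply: fpsP => n; rewrite coef_fpsD (invE n.+1) // big_ord_recl expr0.
congr (_ + _); transitivity (\sum_(j < n.+1) (g ^+ j.+1) n).
  by rewrite big_ord_recr /= coef_fps_exp_lt ?addr0.
rewrite coef_fpsM; under eq_bigr do rewrite exprS coef_fpsM.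
rewrite exchange_big; apply: eq_bigr => i _; rewrite -mulr_sumr; congr (_ * _).
by rewrite (invE n.+1) // ltnS leq_subr.
Qed.

Lemma fps_mulK f g : f 0%N = 1 -> g * f * fpsV f = g.
Proof. by move=> f0; rewrite -mulrA fps_mulV ?mulr1. Qed.

Lemma fps_mulI f g h : f 0%N = 1 -> f * g = f * h -> g = h.
Proof.
by move=> f0 eq_fg; rewrite -[g](fps_mulK g f0) -[h](fps_mulK h f0) ![_ * f]mulrC eq_fg.
Qed.

Lemma coef0_fps_inv f : f 0%N = 1 -> fpsV f 0%N = 1.
Proof.
move=> f0; have /(congr1 (fun h : fps A => h 0%N)) := fps_mulV f0.
by rewrite coef0_fpsM f0 mul1r.
Qed.

Lemma fps_invP f g : f 0%N = 1 -> f * g = 1 -> g = fpsV f.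
Proof. by move=> f0 fg1; apply: (fps_mulI f0); rewrite fg1 fps_mulV. Qed.

(** ** The Euler derivation *)

Definition euler f : fps A := fun n => f n *+ n.

Lemma coef_euler f n : euler f n = f n *+ n. Proof. by []. Qed.
Lemma eulerD f g : euler (f + g) = euler f + euler g.
Proof. by apply: fpsP => n; rewrite coef_fpsD !coef_euler mulrnDl. Qed.
Lemma eulerN f : euler (- f) = - euler f.
Proof. by apply: fpsP => n; rewrite coef_fpsN !coef_euler mulNrn. Qed.
Lemma eulerM f g : euler (f * g) = euler f * g + f * euler g.
Proof.
apply: fpsP => n; rewrite coef_fpsD !coef_fpsM coef_euler -sumrMnl -big_split /=.
apply: eq_bigr => i _; rewrite !coef_euler mulrnAl mulrnAr -mulrnDr subnKC //.
by rewrite -ltnS.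
Qed.
Lemma eulerC c : euler (fpsC c) = 0.
Proof. by apply: fpsP => -[|n]; rewrite coef_euler //= mul0rn. Qed.
Lemma euler1 : euler 1 = 0.
Proof. by rewrite -(rmorph1 fpsC) eulerC. Qed.
Lemma euler_var : euler fX = fX.
Proof.
by apply: fpsP => -[|[|n]]; rewrite coef_euler /fps_var // mulr0n mul0rn.
Qed.
Lemma eulerX f n : euler (f ^+ n.+1) = f ^+ n * euler f *+ n.+1.
Proof.
elim: n => [|n IHn]; first by rewrite mul1r.
by rewrite exprS eulerM IHn mulrnAr mulrA -exprS [euler f * _]mulrC -mulrS.
Qed.
Lemma eqmod_euler n f f' : eqmod n f f' -> eqmod n (euler f) (euler f').
Proof. by move=> eq_f i lt_in; rewrite !coef_euler eq_f. Qed.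

End FpsRing.

Notation fX A := (fps_var A : fps A).

(** ** Change of coefficients *)

Section FpsMap.
Variables (A B : comNzRingType) (phi : {rmorphism A -> B}).
Implicit Types f g : fps A.

Definition map_fps f : fps B := fun n => phi (f n).

Fact map_fps_zmod_morphism : zmod_morphism map_fps.
Proof. by move=> f g; apply: fpsP => n; rewrite /map_fps !coef_fpsB rmorphB. Qed.
Fact map_fps_monoid_morphism : monoid_morphism map_fps.
Proof.
split; first by apply: fpsP => n; rewrite /map_fps !coef_fps1 rmorph_nat.
move=> f g; apply: fpsP => n; rewrite /map_fps !coef_fpsM rmorph_sum.
by apply: eq_bigr => i _; rewrite rmorphM.
Qed.
HB.instance Definition _ := GRing.isZmodMorphism.Build (fps A) (fps B) map_fps
  map_fps_zmod_morphism.
HB.instance Definition _ := GRing.isMonoidMorphism.Build (fps A) (fps B) map_fps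
  map_fps_monoid_morphism.

Lemma map_fpsC c : map_fps (fpsC c) = fpsC (phi c).
Proof. by apply: fpsP => -[|n]; rewrite /map_fps //= rmorph0. Qed.
Lemma map_fpsX : map_fps (fX A) = fX B.
Proof. by apply: fpsP => n; rewrite /map_fps rmorph_nat. Qed.
Lemma map_fps_euler f : map_fps (euler f) = euler (map_fps f).
Proof. by apply: fpsP => n; rewrite /map_fps !coef_euler rmorphMn. Qed.
Lemma map_fpsV f : map_fps (fpsV f) = fpsV (map_fps f).
Proof.
apply: fpsP => n; rewrite /map_fps /fpsV /fps_inv rmorph_sum.
apply: eq_bigr => j _; rewrite !fps_expE -[phi _]/(map_fps _ n).
rewrite -[fun i => _ - f i]/(1 - f) -[fun i => _ - map_fps f i]/(1 - map_fps f).
by rewrite rmorphXn rmorphB rmorph1.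
Qed.

End FpsMap.

(** ** Composition *)

Section FpsComp.
Variable A : comNzRingType.
Variable g : fps A.
Hypothesis g0 : g 0%N = 0.
Implicit Types f h : fps A.

Definition fpsO f h : fps A := fps_comp f h.

(* Up to any given degree, composition with g is evaluation of a polynomial at g,
   from which it inherits its algebraic properties. *)
Let ev (p : {poly A}) : fps A := (map_poly (@fpsC A) p).[g].

Let ev_coef (p : {poly A}) n : (ev p) n = \sum_(j < n.+1) p`_j * (g ^+ j) n.
Proof.
have sz : (size (map_poly (@fpsC A) p) <= maxn (size p) n.+1)%N.
  by rewrite (leq_trans (size_poly _ _)) ?leq_maxl.
rewrite /ev (horner_coef_wide _ sz) coef_fps_sum.
rewrite (big_ord_widen _ (fun j => p`_j * (g ^+ j) n) (leq_maxr (size p) n.+1)).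
rewrite [RHS]big_mkcond; apply: eq_bigr => j _; rewrite coef_map coef_fpsCM.
by case: ltnP => // lt_nj; rewrite coef_fps_exp_lt ?mulr0.
Qed.

Let comp_ev f n N : (n <= N)%N -> fpsO f g n = ev (trunc N f) n.
Proof.
move=> le_nN; rewrite ev_coef; apply: eq_bigr => j _; rewrite fps_expE.
by rewrite coef_trunc // (leq_trans _ le_nN) // -ltnS.
Qed.

Let ev_eq (p q : {poly A}) n : (forall i, (i <= n)%N -> p`_i = q`_i) -> ev p n = ev q n.
Proof.
by move=> eq_pq; rewrite !ev_coef; apply: eq_bigr => j _; rewrite eq_pq // -ltnS.
Qed.

Lemma fps_compM f h : fpsO (f * h) g = fpsO f g * fpsO h g.
Proof.
apply: fpsP => n; rewrite (comp_ev _ (leqnn n)).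
rewrite (@ev_eq _ (trunc n f * trunc n h)); last first.
  by move=> i le_in; rewrite coef_trunc // -(fps_mul_trunc _ _ le_in).
rewrite /ev rmorphM hornerM coef_fpsM; apply: eq_bigr => i _.
by rewrite (@comp_ev f i n) -1?ltnS // (@comp_ev h _ n) ?leq_subr.
Qed.

Lemma fps_compD f h : fpsO (f + h) g = fpsO f g + fpsO h g.
Proof.
apply: fpsP => n; rewrite coef_fpsD -big_split; apply: eq_bigr => i _.
by rewrite coef_fpsD mulrDl.
Qed.

Lemma fps_compC c : fpsO (fpsC c) g = fpsC c.
Proof.
apply: fpsP => n; rewrite /fpsO /fps_comp big_ord_recl /= big1 ?addr0 => [|i _].
  by rewrite /fps_exp /= /fps_one mulr_natr; case: (n).
by rewrite mul0r.
Qed.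

Lemma fps_comp1 : fpsO 1 g = 1.
Proof. by rewrite -(rmorph1 (@fpsC A)) fps_compC. Qed.

Lemma fps_compX : fpsO (fX A) g = g.
Proof.
apply: fpsP => -[|n]; first by rewrite /fpsO /fps_comp big_ord1 mul0r g0.
rewrite /fpsO /fps_comp !big_ord_recl big1 /= => [|i _]; last by rewrite mul0r.
by rewrite mul0r mul1r add0r addr0 -[fps_mul _ _]/(g * 1) mulr1.
Qed.

Lemma coef0_fps_comp f : fpsO f g 0%N = f 0%N.
Proof. by rewrite /fpsO /fps_comp big_ord1 mulr1. Qed.

Lemma fps_compV f : f 0%N = 1 ->
  fpsO (fpsV f) g = fpsV (fpsO f g).
Proof.
move=> f0; apply: fps_invP; first by rewrite coef0_fps_comp.
by rewrite -fps_compM fps_mulV // fps_comp1.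
Qed.

Lemma fps_comp_prod I (r : seq I) (P : pred I) (F : I -> fps A) :
  fpsO (\prod_(i <- r | P i) F i) g = \prod_(i <- r | P i) fpsO (F i) g.
Proof.
elim/big_rec2: _ => [|i x y _ <-]; first exact: fps_comp1.
exact: fps_compM.
Qed.

End FpsComp.

(** * Free cumulants of a series *)

Section FreeCumulants.
Variable A : comNzRingType.
Variable U : fps A.
Hypothesis U0 : U 0%N = 1.
Implicit Types R : fps A.

(** This is 1 / K for K(t) = R(t) / t; the free cumulants of U are the coefficients
    of the R with R(t) U(t / R(t)) = 1, that is, such that t / R(t) is the functional
    inverse of t / U(t). *)
Definition inv_K R : fps A := fX A * fpsV R.

Lemma coef0_inv_K R : inv_K R 0%N = 0.
Proof. by rewrite /inv_K coef0_fpsM mul0r. Qed.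

Lemma inv_KM R : R 0%N = 1 -> R * inv_K R = fX A.
Proof. by move=> R0; rewrite /inv_K mulrCA fps_mulV ?mulr1. Qed.

Let step R := fpsV (fpsO U (inv_K R)).

(* The coefficients of order at most n of t / R only involve R below order n. *)
Let step_contract n R R' : eqmod n R R' -> eqmod n.+1 (step R) (step R').
Proof.
move=> eqR; apply: eqmod_inv => i lt_in; apply: eq_bigr => j _.
congr (_ * _); rewrite !fps_expE; apply: eqmodX lt_in => -[|l] ltl.
  by rewrite !coef0_inv_K.
by rewrite /inv_K !coef_fpsXM; exact: (eqmod_inv eqR).
Qed.

Lemma free_cumulants_unique R R' :
  R 0%N = 1 -> R * fpsO U (inv_K R) = 1 ->
  R' 0%N = 1 -> R' * fpsO U (inv_K R') = 1 -> R = R'.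
Proof.
move=> R0 RU R'0 R'U; have fixed S : S * fpsO U (inv_K S) = 1 -> S = step S.
  by move=> SU; apply: fps_invP; rewrite ?coef0_fps_comp // mulrC.
apply: fpsP => n; suff: eqmod n.+1 R R' by apply.
elim: n.+1 => // l IHl; rewrite (fixed _ RU) (fixed _ R'U).
exact: step_contract.
Qed.

Lemma free_cumulants_exist :
  exists2 R : fps A, R 0%N = 1 & R * fpsO U (inv_K R) = 1.
Proof.
pose It n := iter n step 1; pose R : fps A := fun n => It n.+1 n.
have It_stable n p : eqmod n (It n) (It (n + p)%N).
  by elim: n => // n IHn; rewrite addSn; apply: step_contract.
have RIt n : eqmod n R (It n).
  by move=> i lt_in; rewrite /R (It_stable i.+1 (n - i.+1)%N) // subnKC.
have Rstep : R = step R.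
  apply: fpsP => n; rewrite (RIt n.+1) //.
  by apply: (step_contract _ (ltnSn n)) => i lt_in; exact: esym (RIt n i lt_in).
have R0 : R 0%N = 1 by rewrite Rstep /step coef0_fps_inv // coef0_fps_comp.
exists R => //; rewrite {1}Rstep /step mulrC fps_mulV //.
by rewrite coef0_fps_comp.
Qed.

End FreeCumulants.

(** * Lagrange inversion *)

Section Lagrange.
Variable R : fps rat.
Hypothesis R0 : R 0%N = 1.
Let F := inv_K R.

Let residue_pow p : (0 < p)%N -> ((R - euler R) * R ^+ p.-1) p = 0.
Proof.
case: p => //= p _; rewrite mulrBl -exprS coef_fpsB.
set x := (X in X = 0); suff : x *+ p.+1 == 0 by rewrite mulrn_eq0 => /eqP.
rewrite /x mulrnBl -coef_euler eulerX.
by rewrite coef_fpsMn [_ * euler R]mulrC subrr.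
Qed.

(* The residue of F' F^(i-n-2) vanishes, as that of a derivative, unless i = n + 1. *)
Let residue_FX n i : (i <= n.+1)%N ->
  ((R - euler R) * R ^+ n * F ^+ i) n.+1 = (i == n.+1)%:R.
Proof.
rewrite leq_eqVlt => /predU1P[->|lt_in]; last first.
  have -> : (R - euler R) * R ^+ n * F ^+ i =
            fX rat ^+ i * ((R - euler R) * R ^+ (n - i)).
    rewrite -(inv_KM R0) -/F [(R * F) ^+ i]exprMn -[in LHS](subnK (_ : i <= n)%N) // exprD.
    move: (R ^+ (n - i)) (R ^+ i) (F ^+ i) => a b f; ring.
  rewrite coef_fpsXnM ltnNge ltnW //= subSn // (ltn_eqF lt_in).
  exact: (residue_pow (ltn0Sn (n - i))).
have -> : (R - euler R) * R ^+ n * F ^+ n.+1 =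
          fX rat ^+ n.+1 * ((R - euler R) * fpsV R).
  have -> : (R - euler R) * R ^+ n * F ^+ n.+1 =
      (R * F) ^+ n * ((R - euler R) * F).
    rewrite [(R * F) ^+ n]exprMn exprS.
    by move: (R ^+ n) (F ^+ n) => a b; ring.
  by rewrite inv_KM // /F /inv_K exprSr; move: (fX rat ^+ n) => a; ring.
rewrite eqxx coef_fpsXnM ltnn subnn coef0_fpsM coef0_fps_inv // mulr1.
by rewrite coef_fpsB coef_euler R0 subr0.
Qed.

(** As F = t / R, the factor in front of E(F) is t^(n+2) F'(t) / F(t)^(n+2): this is the
    invariance of the residue of E(z) / z^(n+2) under the substitution z = F(t). *)
Lemma lagrange_residue n (E : fps rat) :
  ((R - euler R) * R ^+ n * fpsO E F) n.+1 = E n.+1.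
Proof.
have F0 : F 0%N = 0 by exact: coef0_inv_K.
have eqE : eqmod n.+2 (fpsO E F) (\sum_(j < n.+2) fpsC (E j) * F ^+ j).
  move=> i lt_in; rewrite coef_fps_sum /fpsO /fps_comp.
  rewrite (big_ord_widen _ (fun j => E j * fps_exp F j i) lt_in) big_mkcond.
  apply: eq_bigr => j _; rewrite coef_fpsCM -fps_expE.
  by case: ltnP => // lt_ij; rewrite fps_expE coef_fps_exp_lt ?mulr0.
rewrite (eqmodM (fun _ _ => erefl) eqE) // mulr_sumr coef_fps_sum.
rewrite (bigD1 ord_max) //= big1 => [|j ne_j].
  by rewrite mulrCA coef_fpsCM residue_FX // eqxx mulr1 addr0.
rewrite mulrCA coef_fpsCM residue_FX -1?ltnS //.
suff /negPf-> : (j : nat) != n.+1 by rewrite mulr0.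
by apply: contraNneq ne_j => eq_j; apply/eqP/val_inj.
Qed.

End Lagrange.

(** * Linear factors *)

Definition lin (A : comNzRingType) (a : A) : fps A := 1 - fpsC a * fX A.

Section Lin.
Variable A : comNzRingType.
Implicit Type a : A.

Lemma lin0 a : lin a 0%N = 1.
Proof. by rewrite /lin coef_fpsB coef_fpsCM mulr0 subr0. Qed.

Lemma coef0_prod_lin (I : Type) (r : seq I) (P : pred I) (c : I -> A) :
  (\prod_(i <- r | P i) lin (c i)) 0%N = 1.
Proof. by elim/big_rec: _ => // i f _ f0; rewrite coef0_fpsM f0 lin0 mulr1. Qed.

Lemma fpsO_lin (F : fps A) a : F 0%N = 0 -> fpsO (lin a) F = 1 - fpsC a * F.
Proof.
move=> F0; have -> : lin a = 1 + fpsC (- a) * fX A by rewrite /lin rmorphN; ring.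
by rewrite fps_compD fps_comp1 fps_compM // fps_compC fps_compX // rmorphN; ring.
Qed.

Lemma coef_lin_inv a n : fpsV (lin a) n = a ^+ n.
Proof.
pose g : fps A := fun n => a ^+ n.
suff <- : g = fpsV (lin a) by [].
apply: fps_invP (lin0 a) _; apply: fpsP => -[|l].
  by rewrite coef0_fpsM lin0 mul1r.
have -> : lin a * g = g - fX A * (fpsC a * g) by rewrite /lin; ring.
by rewrite coef_fpsB coef_fpsXM coef_fpsCM -exprS subrr.
Qed.

End Lin.

Lemma map_fps_lin (A B : comNzRingType) (phi : {rmorphism A -> B}) a :
  map_fps phi (lin a) = lin (phi a).
Proof. by rewrite /lin rmorphB rmorph1 rmorphM /= map_fpsC map_fpsX. Qed.

(** * Partial fractions *)

(** x^N p(1/x), as a power series in x *)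
Definition rev_poly N (p : {poly rat}) : fps rat :=
  fun n => if (n <= N)%N then p`_(N - n) else 0.

Lemma rev_polyD N p q : rev_poly N (p + q) = rev_poly N p + rev_poly N q.
Proof.
apply: fpsP => n; rewrite coef_fpsD /rev_poly.
by case: leqP => _; rewrite ?coefD ?addr0.
Qed.

Lemma rev_polyZ N a p : rev_poly N (a *: p) = fpsC a * rev_poly N p.
Proof.
apply: fpsP => n; rewrite coef_fpsCM /rev_poly.
by case: leqP => _; rewrite ?coefZ ?mulr0.
Qed.

Lemma rev_poly_XsubC N (p : {poly rat}) a : (size p <= N.+1)%N ->
  rev_poly N.+1 (p * ('X - a%:P)) = rev_poly N p * lin a.
Proof.
move=> szp; have -> : rev_poly N p * lin a =
    rev_poly N p - fX rat * (fpsC a * rev_poly N p) by rewrite /lin; ring.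
apply: fpsP => n; rewrite coef_fpsB coef_fpsXM /rev_poly.
rewrite mulrBr coefB coefMX coefMC.
case: n => [|n]; first by rewrite !subn0 subr0 [p`_N.+1]nth_default ?mul0r ?subr0.
rewrite coef_fpsCM ltnS subSS mulrC.
case: (leqP n N) => [le_nN|lt_Nn]; last first.
  by rewrite ltnNge ltnW // mulr0 subr0.
case: (ltnP n N) => [lt_nN|le_Nn].
  have -> : (N - n = (N - n.+1).+1)%N by lia.
  by rewrite /= [a * _]mulrC.
have -> : n = N by lia.
by rewrite subnn eqxx.
Qed.

Lemma rev_poly_prod N (p : {poly rat}) (I : Type) (r : seq I) (a : I -> rat) :
  (size p <= N.+1)%N ->
  rev_poly (size r + N) (p * \prod_(i <- r) ('X - (a i)%:P))
  = rev_poly N p * \prod_(i <- r) lin (a i).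
Proof.
move=> szp; elim: r => [|i r IHr]; first by rewrite !big_nil !mulr1.
rewrite !big_cons [_ * \prod_(_ <- _) _ in LHS]mulrC mulrA addSn.
rewrite rev_poly_XsubC ?IHr; last first.
  have [->|p0] := eqVneq p 0; first by rewrite mul0r size_poly0.
  rewrite size_Mmonic // ?size_prod_XsubC ?monic_prod_XsubC //.
  by rewrite addnS /= -addnS addnC leq_add2l.
by ring.
Qed.

Lemma rev_poly1 : rev_poly 0 1 = 1.
Proof. by apply: fpsP => -[|n]; rewrite /rev_poly // coefC. Qed.

(** In terms of x = 1/z, the left-hand side is the coefficient of 1/x in the expansion
    at infinity of P / \prod_i (x - c_i).  Lagrange interpolation writes this fraction
    as a polynomial, which does not contribute, plus simple fractions. *)
Lemma sum_residues K m (c : 'I_m -> rat) (P : {poly rat}) : injective c ->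
  (size P <= (K + m).+1)%N ->
  (rev_poly (K + m) P * fpsV (\prod_i lin (c i))) K.+1
  = \sum_i P.[c i] / \prod_(j | j != i) (c i - c j).
Proof.
move=> c_inj szP.
pose Pi := \prod_(i < m) ('X - (c i)%:P).
pose L i := \prod_(j | j != i) ('X - (c j)%:P).
pose w i := P.[c i] / \prod_(j | j != i) (c i - c j).
have den0 i : \prod_(j | j != i) (c i - c j) != 0.
  apply/prodf_neq0 => j ne_ji; rewrite subr_eq0; apply: contra ne_ji => /eqP.
  by move/c_inj->.
have LE i : L i = \prod_(a <- [seq c j | j <- rem i (enum 'I_m)]) ('X - a%:P).
  by rewrite /L big_map rem_filter ?enum_uniq // big_filter big_enum_cond.
have PiE i : Pi = L i * ('X - (c i)%:P).
  by rewrite /Pi (bigD1 i) //= mulrC.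
have sz_rem i : size (rem i (enum 'I_m)) = m.-1.
  by rewrite size_rem ?mem_enum // size_enum_ord.
have szL i : size (L i) = m.
  rewrite LE size_prod_XsubC size_map sz_rem prednK //.
  exact: leq_ltn_trans (ltn_ord i).
have horner_prod (r : seq 'I_m) (Q : pred 'I_m) x :
    (\prod_(j <- r | Q j) ('X - (c j)%:P)).[x] = \prod_(j <- r | Q j) (x - c j).
  by elim/big_rec2: _ => [|j y p _ <-]; rewrite !hornerE.
(* The interpolation polynomial of P is its remainder modulo Pi. *)
pose rm := \sum_i w i *: L i.
have rmc i : rm.[c i] = P.[c i].
  rewrite horner_sum (bigD1 i) //= big1 ?addr0 => [|j ne_ji].
    by rewrite hornerZ horner_prod divfK.
  by rewrite hornerZ horner_prod (bigD1 i) 1?eq_sym //= subrr mul0r mulr0.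
have Pi_mon : Pi \is monic by rewrite /Pi -big_enum monic_prod_XsubC.
have szPi : size Pi = m.+1 by rewrite /Pi -big_enum size_prod_XsubC size_enum_ord.
have dvd : Pi %| P - rm.
  rewrite /Pi -(big_map c xpredT (fun a => 'X - a%:P)) uniq_roots_dvdp //.
    by apply/allP => _ /mapP[i _ ->]; rewrite /root !hornerE rmc subrr.
  by rewrite uniq_rootsE map_inj_uniq // /index_enum -enumT enum_uniq.
have [q Pq] := dvdpP _ _ dvd.
have sz_rm : (size rm <= m)%N.
  apply: leq_trans (size_sum _ _ _) _; apply/bigmax_leqP => i _.
  by apply: leq_trans (size_scale_leq _ _) _; rewrite szL.
have szq : (size q <= K.+1)%N.
  have [->|q0] := eqVneq q 0; first by rewrite size_poly0.
  suff : (size (q * Pi)%R <= (K + m).+1)%N.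
    by rewrite size_Mmonic // szPi; lia.
  rewrite -Pq (leq_trans (size_polyD _ _)) // size_polyN geq_max szP.
  by rewrite (leq_trans sz_rm) // leqW // leq_addl.
have defP : P = q * Pi + rm by rewrite -Pq subrK.
set V := fpsV _; have lin_prod0 : (\prod_i lin (c i)) 0%N = 1 by exact: coef0_prod_lin.
rewrite {1}defP rev_polyD mulrDl coef_fpsD.
have -> : rev_poly (K + m) (q * Pi) = rev_poly K q * \prod_i lin (c i).
  by have := rev_poly_prod (enum 'I_m) c szq; rewrite !big_enum size_enum_ord addnC.
rewrite fps_mulK //. rewrite {1}/rev_poly ltnn add0r.
rewrite (big_morph _ (rev_polyD (K + m)) (_ : rev_poly _ 0 = 0)); last first.
  by apply: fpsP => n; rewrite /rev_poly coef0 if_same.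
rewrite mulr_suml coef_fps_sum; apply: eq_bigr => i _.
rewrite rev_polyZ -mulrA coef_fpsCM.
suff -> : (rev_poly (K + m) (L i) * V) K.+1 = 1 by rewrite mulr1.
have -> : rev_poly (K + m) (L i) = fX rat ^+ K.+1 * \prod_(j | j != i) lin (c j).
  have szm : (0 < m)%N by exact: leq_ltn_trans (ltn_ord i).
  have -> : \prod_(j | j != i) lin (c j) = rev_poly m.-1 (L i).
    have sz1 : (size (1%R : {poly rat}) <= 1)%N by rewrite size_poly1.
    have := rev_poly_prod (rem i (enum 'I_m)) c sz1.
    rewrite mul1r rev_poly1 mul1r sz_rem addn0.
    by rewrite rem_filter ?enum_uniq // !big_filter !big_enum_cond.
  apply: fpsP => n; rewrite coef_fpsXnM /rev_poly.
  case: ltnP => [le_nK|lt_Kn].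
    by rewrite nth_default ?if_same // szL; lia.
  have -> : (n - K.+1 <= m.-1)%N = (n <= K + m)%N by lia.
  by case: ifP => // le_n; congr (_`__); lia.
rewrite -mulrA coef_fpsXnM ltnn subnn coef0_fpsM /V coef0_fps_inv // mulr1.
exact: coef0_prod_lin.
Qed.

(** * Taylor coefficients of the inverse Cauchy transform *)

(** This is t^m P_m(t): in this normalisation the operator D + (m - 2) becomes D - 1,
    and the recursion starts from P_0 = 1. *)
Fixpoint taylor (C : fps rat) m : fps rat :=
  if m is m'.+1 then
    fpsC m%:R^-1 * (fX rat * C * (euler (taylor C m') - taylor C m'))
  else 1.

Definition taylor_sum (C : fps rat) (a : rat) : fps rat :=
  fun n => \sum_(m < n.+1) a ^+ m * taylor C m n.

Lemma coef_taylor_lt C m n : (n < m)%N -> taylor C m n = 0.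
Proof.
elim: m n => // m IHm n lt_nm /=; rewrite coef_fpsCM -mulrA coef_fpsXM.
case: n lt_nm => [|n] lt_nm; first by rewrite mulr0.
rewrite coef_fpsM big1 ?mulr0 // => i _.
by rewrite coef_fpsB coef_euler IHm ?mul0rn ?subrr ?mulr0 //; lia.
Qed.

Lemma eqmod_taylor n C C' m : eqmod n C C' -> eqmod n (taylor C m) (taylor C' m).
Proof.
move=> eqC; elim: m => // m IHm /=; do 2!apply: eqmodM => //.
  exact: eqmodM.
by apply: eqmodD; [apply: eqmod_euler | apply: eqmodN].
Qed.

Lemma eqmod_taylor_sum n C C' a :
  eqmod n C C' -> eqmod n (taylor_sum C a) (taylor_sum C' a).
Proof.
move=> eqC i lt_in; apply: eq_bigr => m _; congr (_ * _).
exact: eqmod_taylor eqC _ lt_in.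
Qed.

Definition param_deriv (f : fps {poly rat}) : fps {poly rat} := fun n => (f n)^`().

Lemma param_derivD f g : param_deriv (f + g) = param_deriv f + param_deriv g.
Proof. by apply: fpsP => n; rewrite coef_fpsD /param_deriv derivD. Qed.
Lemma param_derivN f : param_deriv (- f) = - param_deriv f.
Proof. by apply: fpsP => n; rewrite coef_fpsN /param_deriv derivN. Qed.
Lemma param_derivM f g :
  param_deriv (f * g) = param_deriv f * g + f * param_deriv g.
Proof.
apply: fpsP => n; rewrite coef_fpsD !coef_fpsM /param_deriv raddf_sum -big_split.
by apply: eq_bigr => i _; exact: derivM.
Qed.
Lemma param_deriv_const (f : fps rat) : param_deriv (map_fps (@polyC rat) f) = 0.
Proof. by apply: fpsP => n; rewrite /param_deriv /map_fps derivC. Qed.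

(** The parameter a of a Taylor expansion is the variable of the coefficients, which
    are taken in {poly rat}. *)
Section Taylor.
Variables (R C : fps rat).
Hypothesis R0 : R 0%N = 1.
Hypothesis CR : C * (R - euler R) = 1.
Variables (I J : Type) (rx : seq I) (ry : seq J) (x : I -> rat) (y : J -> rat).
Hypothesis size_xy : size rx = (size ry).+1.
Let F := inv_K R.
Hypothesis RF :
  R * \prod_(i <- rx) (1 - fpsC (x i) * F) = \prod_(j <- ry) (1 - fpsC (y j) * F).

Local Notation cst := (map_fps (@polyC rat)).
Let T := fX {poly rat} * cst C.
Let fac (b : rat) : fps {poly rat} := 1 - fpsC (b%:P + 'X) * cst F.
Let q : fps {poly rat} := fun n => \poly_(m < n.+1) taylor C m n.

(* The equation satisfied by a product of E factors 1 - (b + a) F *)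
Let transport (E : nat) (f : fps {poly rat}) :=
  param_deriv f = T * euler f - cst F * f *+ E.

Let T_euler : T * cst (R - euler R) = fX _.
Proof. by rewrite /T -mulrA -rmorphM CR rmorph1 mulr1. Qed.

(* Equivalently t C D F = F ^ 2, that is, t C D = - d/dx for x = 1 / F. *)
Let TDF : T * cst (euler F) = cst F * cst F.
Proof.
have RDF : R * R * euler F = fX rat * (R - euler R).
  have := euler_var rat; rewrite -{1}(inv_KM R0) eulerM -/F => eF.
  have e2 : R * euler F = fX rat - euler R * F by rewrite -eF; ring.
  by rewrite -mulrA e2 mulrBr [R * (_ * _)]mulrCA inv_KM //; ring.
rewrite /T -(map_fpsX (@polyC rat)) -!rmorphM; congr (map_fps _ _).
apply: (fps_mulI R0); apply: (fps_mulI R0).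
transitivity (fX rat * C * (R * R * euler F)); first by ring.
rewrite RDF; transitivity (fX rat * fX rat * (C * (R - euler R))); first by ring.
by rewrite CR -(inv_KM R0) -/F; ring.
Qed.

Let transport_fac b : transport 1 (fac b).
Proof.
have dC : param_deriv (fpsC (b%:P + 'X)) = 1.
  apply: fpsP => -[|n]; rewrite /param_deriv /fpsC /=.
    by rewrite derivD derivC derivX add0r.
  by rewrite deriv0.
rewrite /transport /fac param_derivD param_derivN param_derivM.
rewrite -{1}(rmorph1 cst) !param_deriv_const dC mul1r mulr0 addr0 add0r.
rewrite eulerD eulerN eulerM euler1 eulerC -map_fps_euler.
transitivity (- (fpsC (b%:P + 'X) * (T * cst (euler F))) -
              cst F * (1 - fpsC (b%:P + 'X) * cst F)); last by ring.
by rewrite TDF; ring.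
Qed.

Let transport_prod K (r : seq K) (b : K -> rat) :
  transport (size r) (\prod_(i <- r) fac (b i)).
Proof.
elim: r => [|i r IHr].
  by rewrite big_nil /transport -{1}(rmorph1 cst) param_deriv_const euler1 mulr0 mulr0n subr0.
rewrite big_cons /= /transport param_derivM IHr transport_fac eulerM mulrS.
by ring.
Qed.

Let q_transport : param_deriv q = T * euler q - T * q.
Proof.
rewrite -mulrBr /T -(map_fpsX (@polyC rat)) -rmorphM /=; apply: fpsP => n.
apply/polyP => m; rewrite coef_fpsM coef_sum coef_deriv.
have coefq l j : (q l)`_j = taylor C j l.
  by rewrite coef_poly ltnS; case: leqP => // lt_lj; rewrite coef_taylor_lt.
rewrite coefq /= coef_fpsCM -mulrnAl -[_^-1 *+ _]mulr_natl mulfV ?pnatr_eq0 // mul1r coef_fpsM.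
apply: eq_bigr => i _; rewrite /map_fps coefCM; congr (_ * _).
by rewrite !coef_fpsB !coef_euler coefB coefMn !coefq.
Qed.

Let eval0 : map_fps (horner_eval (0 : rat)) (q * \prod_(j <- ry) fac (y j)
            - cst R * \prod_(i <- rx) fac (x i)) = 0.
Proof.
have ev_cst f : map_fps (horner_eval (0 : rat)) (cst f) = f.
  by apply: fpsP => n; rewrite /map_fps /= /horner_eval hornerC.
have ev_fac b : map_fps (horner_eval (0 : rat)) (fac b) = 1 - fpsC b * F.
  rewrite /fac rmorphB rmorph1 rmorphM /= map_fpsC ev_cst /= /horner_eval.
  by rewrite !hornerE.
rewrite rmorphB !rmorphM !rmorph_prod /= ev_cst.
rewrite (eq_bigr _ (fun j _ => ev_fac (y j))) (eq_bigr _ (fun i _ => ev_fac (x i))).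
rewrite RF; have -> : map_fps (horner_eval (0 : rat)) q = 1.
  apply: fpsP => n; rewrite /map_fps /= /horner_eval horner_coef0 coef_poly /=.
  by rewrite coef_fps1.
by rewrite mul1r subrr.
Qed.

(** The quotient of the right-hand side by the product on the left is t G(1/F - a), for
    G = 1 / H_w.  This function of a and the Taylor sum both solve the transport equation
    d/da Q = t C (D - 1) Q, which determines Q from its value at a = 0. *)
Lemma taylor_sumE a :
  taylor_sum C a * \prod_(j <- ry) (1 - fpsC (y j + a) * F)
  = R * \prod_(i <- rx) (1 - fpsC (x i + a) * F).
Proof.
pose Z := q * \prod_(j <- ry) fac (y j) - cst R * \prod_(i <- rx) fac (x i).
have ZT : param_deriv Z = T * euler Z - (T + cst F *+ size ry) * Z.
  rewrite /Z param_derivD param_derivN !param_derivM q_transport.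
  rewrite !transport_prod param_deriv_const size_xy.
  rewrite eulerD eulerN !eulerM -map_fps_euler mulrS.
  set Y := \prod_(j <- ry) _; set X := \prod_(i <- rx) _.
  have TR : T * cst (euler R) = T * cst R - fX _.
    by rewrite -T_euler rmorphB; ring.
  have XR : fX _ = cst R * cst F by rewrite -(map_fpsX (@polyC rat)) -(inv_KM R0) rmorphM.
  transitivity (T * (euler q * Y + q * euler Y) - T * q * Y -
    q * (cst F * Y *+ size ry) - (T * cst R * euler X + T * cst (euler R) * X
     - T * cst R * X + fX _ * X - cst R * cst F * X
      - cst R * (cst F * X *+ size ry))); last first.
    by rewrite XR; ring.
  by rewrite TR; ring.
have Z0 n : (Z n).[0] = 0.
  by move/(congr1 (fun f : fps rat => f n)): eval0.
have ZE : Z = 0.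
  apply: fpsP => n; elim/ltn_ind: n => n IHn.
  have dZ : (Z n)^`() = 0.
    rewrite -[LHS]/(param_deriv Z n) ZT coef_fpsB !coef_fpsM !big_ord_recl /=.
    have T0 : T 0%N = 0 by rewrite /T coef0_fpsM mul0r.
    have -> : (T + cst F *+ size ry) 0%N = 0.
      rewrite coef_fpsD T0 add0r coef_fpsMn /map_fps [F 0%N]coef0_inv_K.
      by rewrite /= polyC0 mul0rn.
    rewrite T0 !mul0r !add0r !big1 ?subrr // => i _; rewrite /= ?coef_euler IHn.
    - by rewrite mulr0.
    - by rewrite /bump; case: i => i /=; lia.
    - by rewrite mul0rn mulr0.
    - by rewrite /bump; case: i => i /=; lia.
  apply/polyP => -[|m]; rewrite coef0; first by rewrite -horner_coef0 Z0.
  have /(congr1 (fun p : {poly rat} => p`_m))/eqP := dZ.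
  by rewrite coef_deriv coef0 mulrn_eq0 => /eqP.
have ev_cst f : map_fps (horner_eval a) (cst f) = f.
  by apply: fpsP => n; rewrite /map_fps /= /horner_eval hornerC.
have ev_fac b : map_fps (horner_eval a) (fac b) = 1 - fpsC (b + a) * F.
  rewrite /fac rmorphB rmorph1 rmorphM /= map_fpsC ev_cst /= /horner_eval.
  by rewrite !hornerE.
have /(congr1 (map_fps (horner_eval a)))/eqP := ZE.
rewrite rmorph0 /Z rmorphB !rmorphM !rmorph_prod /= ev_cst subr_eq0 => /eqP.
rewrite (eq_bigr _ (fun j _ => ev_fac (y j))) (eq_bigr _ (fun i _ => ev_fac (x i))).
have -> // : map_fps (horner_eval a) q = taylor_sum C a.
apply: fpsP => n; rewrite /map_fps /= /horner_eval horner_poly.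
by apply: eq_bigr => m _; rewrite mulrC.
Qed.

End Taylor.

(** Both sides compute the coefficient of 1/x at infinity of
    \prod_(j < k) 1 / H(x - j), where H(x) = \prod_i (x - c_i) divided by
    (x + m) \prod_i (x - c_i - 1): the left-hand side after the substitution
    x = 1 / F(t), the right-hand side as a sum of residues, most factors of
    numerators and denominators cancelling for consecutive j. *)
Theorem taylor_frobenius (R C : fps rat) m k (c : 'I_m -> rat) :
  injective c -> (0 < k)%N -> R 0%N = 1 -> C * (R - euler R) = 1 ->
  R * ((1 + fpsC m%:R * inv_K R) * \prod_i (1 - fpsC (c i + 1) * inv_K R))
    = \prod_i (1 - fpsC (c i) * inv_K R) ->
  ((R - euler R) * \prod_(i < k.-1) taylor_sum C i.+1%:R) k.+1
  = - k%:R * \sum_i (\prod_(j < k) (c i + m%:R - j%:R)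
                     * \prod_(j | j != i) ((c i - c j - k%:R) / (c i - c j))).
Proof.
move=> c_inj k_gt0 R0 CR RF; set F := inv_K R in RF *.
have F0 : F 0%N = 0 by exact: coef0_inv_K.
pose H j : fps rat := \prod_i lin (c i + j%:R).
have H0 j : H j 0%N = 1.
  exact: coef0_prod_lin.
have step j : taylor_sum C j%:R * fpsO (H j) F
              = R * (fpsO (lin (j%:R - m%:R)) F * fpsO (H j.+1) F).
  have RFo : R * \prod_(o <- None :: map Some (enum 'I_m))
        (1 - fpsC (if o is Some i then c i + 1 else - m%:R) * F)
      = \prod_(i <- enum 'I_m) (1 - fpsC (c i) * F).
    by rewrite big_cons big_map !big_enum /= -RF rmorphN mulNr opprK.
  have := taylor_sumE R0 CR (_ : size _ = (size (enum 'I_m)).+1) RFo j%:R.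
  rewrite /= size_map => /(_ erefl).
  rewrite big_cons big_map !big_enum /= /H !fps_comp_prod //.
  under [in X in X -> _]eq_bigr do rewrite -fpsO_lin //.
  rewrite -!fpsO_lin // [j%:R - _]addrC => ->.
  by congr (_ * (_ * _)); apply: eq_bigr => i _; rewrite -fpsO_lin // -addrA -[1 + _](natrD _ 1).
have T0 : taylor_sum C 0 = 1.
  apply: fpsP => n; rewrite /taylor_sum big_ord_recl expr0 mul1r big1 ?addr0 // => i _.
  by rewrite exprS !mul0r.
have prodT : (\prod_(j < k) taylor_sum C j%:R) * fpsO (H 0%N) F =
    R ^+ k * fpsO ((\prod_(j < k) lin (j%:R - m%:R)) * H k) F.
  rewrite fps_compM //.
  elim: (k) => [|l IHl]; first by rewrite !big_ord0 fps_comp1 !mul1r.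
  rewrite !big_ord_recr /= fps_compM // mulrAC IHl.
  set L := fpsO (\prod_(j < l) _) F.
  transitivity (R ^+ l * L * (taylor_sum C l%:R * fpsO (H l) F)); first by ring.
  by rewrite step exprSr; ring.
have -> : \prod_(i < k.-1) taylor_sum C i.+1%:R = R ^+ k *
    fpsO ((\prod_(j < k) lin (j%:R - m%:R)) * H k * fpsV (H 0%N)) F.
  rewrite fps_compM // fps_compV // mulrA -prodT fps_mulK; last first.
    by rewrite coef0_fps_comp.
  by rewrite -[in RHS](prednK k_gt0) big_ord_recl T0 mul1r.
rewrite mulrA lagrange_residue //.
pose Q : {poly rat} := \prod_(j < k) ('X - (j%:R - m%:R)%:P).
pose P : {poly rat} := Q * \prod_i ('X - (c i + k%:R)%:P).
have szQ : size Q = k.+1.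
  by rewrite /Q -big_enum /= size_prod_XsubC size_enum_ord.
have revP : rev_poly (k + m) P = (\prod_(j < k) lin (j%:R - m%:R)) * H k.
  have sz1 : (size (1%R : {poly rat}) <= 1)%N by rewrite size_poly1.
  have := rev_poly_prod (enum 'I_k) (fun j => j%:R - m%:R) sz1.
  rewrite mul1r rev_poly1 mul1r size_enum_ord addn0 !big_enum /= => <-.
  have := rev_poly_prod (enum 'I_m) (fun i => c i + k%:R) (_ : size Q <= k.+1)%N.
  by rewrite szQ leqnn size_enum_ord addnC !big_enum /= => /(_ isT).
rewrite -revP; have -> : H 0%N = \prod_i lin (c i).
  by apply: eq_bigr => i _; rewrite addr0.
rewrite sum_residues //; last first.
  rewrite (leq_trans (size_polyMleq _ _)) // szQ addSn /= -addnS leq_add2l.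
  by rewrite -big_enum /= size_prod_XsubC size_enum_ord.
rewrite mulr_sumr; apply: eq_bigr => i _.
have -> : P.[c i] = (\prod_(j < k) (c i + m%:R - j%:R)) *
    (- k%:R * \prod_(j | j != i) (c i - c j - k%:R)).
  rewrite /P hornerM /Q !horner_prod (bigD1 i) //=; congr (_ * (_ * _)).
  - by apply: eq_bigr => j _; rewrite !hornerE; ring.
  - by rewrite !hornerE; ring.
  - by apply: eq_bigr => j _; rewrite !hornerE; ring.
by rewrite big_split /= prodfV; ring.
Qed.

(** * Alternating sums over beads *)

Section Beads.
Variable m : nat.
Implicit Types v : {ffun 'I_m -> int}.

(** For t = 0 and e = -1, [alt] is the coefficient of x^v in the product of the
    Vandermonde determinant \det (x_i ^ j) by the power sums p_r, r in mu; Frobenius'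
    formula asserts that this is a character value.  The entries of v are the positions
    of beads, which each r of mu moves down.  For e = 1 beads move up, to the final
    positions t, t + 1, ...: this describes the holes of a configuration of beads. *)
Definition shift v (a : 'I_m) (r : int) : {ffun 'I_m -> int} :=
  [ffun i => v i + r *+ (i == a)].

Definition perm_sign (t : int) v : int :=
  \det (\matrix_(i < m, j < m) (v i == t + j%:Z)%:R : 'M[int]_m).

Fixpoint alt (t e : int) (mu : seq nat) v : int :=
  if mu is r :: mu' then \sum_(a < m) alt t e mu' (shift v a (e * r%:Z))
  else perm_sign t v.

Definition permute v (s : 'S_m) : {ffun 'I_m -> int} := [ffun i => v (s i)].

Lemma alt_permute t e mu v s : alt t e mu (permute v s) = (-1) ^+ s * alt t e mu v.
Proof.
elim: mu v => [|r mu IHmu] v /=.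
  rewrite /perm_sign -det_perm -det_mulmx -row_permE; congr (\det _).
  by apply/matrixP => i j; rewrite !mxE !ffunE.
rewrite (reindex_inj (h := s^-1%g)) ?mulr_sumr; last exact: perm_inj.
apply: eq_bigr => a _; rewrite -IHmu; congr (alt _ _ _ _).
apply/ffunP => i; rewrite !ffunE; congr (_ + _ *+ _).
by rewrite -(inj_eq (@perm_inj _ s)) permKV.
Qed.

Lemma alt_dup t e mu v i j : i != j -> v i = v j -> alt t e mu v = 0.
Proof.
move=> ne_ij eq_v; have eq_alt := alt_permute t e mu v (tperm i j).
have vij : permute v (tperm i j) = v.
  by apply/ffunP => l; rewrite ffunE; case: tpermP => // ->.
rewrite vij odd_tperm ne_ij expr1 mulN1r in eq_alt.
by move/eqP: eq_alt; rewrite -addr_eq0 -mulr2n mulrn_eq0 /= => /eqP.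
Qed.

Lemma perm_sign_out t v i : (forall j : 'I_m, v i != t + j%:Z) -> perm_sign t v = 0.
Proof.
move=> out; rewrite /perm_sign (expand_det_row _ i) big1 // => j _.
by rewrite mxE (negPf (out j)) mul0r.
Qed.

Lemma alt_low t mu v i : v i < t -> alt t (-1) mu v = 0.
Proof.
elim: mu v => [|r mu IHmu] v lt_vt /=.
  apply: (@perm_sign_out t v i) => j; rewrite lt_eqF //.
  by rewrite (lt_le_trans lt_vt) // lerDl.
apply: big1 => a _; apply: IHmu; rewrite ffunE; apply: le_lt_trans lt_vt.
by rewrite mulN1r; case: eqP => _; lia.
Qed.

Lemma alt_high t mu v i : t + m%:Z <= v i -> alt t 1 mu v = 0.
Proof.
elim: mu v => [|r mu IHmu] v le_tv /=.
  apply: (@perm_sign_out t v i) => j; rewrite gt_eqF //.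
  by rewrite (lt_le_trans _ le_tv) // ltrD2l ltz_nat.
apply: big1 => a _; apply: IHmu; rewrite ffunE; apply: le_trans le_tv _.
by rewrite mul1r; case: eqP => _; lia.
Qed.

Lemma altC t e r r' mu v : alt t e [:: r, r' & mu] v = alt t e [:: r', r & mu] v.
Proof.
rewrite /= exchange_big; apply: eq_bigr => a _; apply: eq_bigr => b _.
by congr (alt _ _ _ _); apply/ffunP => i; rewrite !ffunE; ring.
Qed.

Lemma alt_perm_eq t e mu mu' v : perm_eq mu mu' -> alt t e mu v = alt t e mu' v.
Proof.
elim: mu mu' v => [|r mu IHmu] mu' v; first by move/perm_size/esym/size0nil->.
move=> eq_mu; have r_mu' : r \in mu' by rewrite -(perm_mem eq_mu) mem_head.
case/splitPr: mu' / r_mu' eq_mu => p q; rewrite perm_sym perm_catC perm_cons perm_catC => eq_mu.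
transitivity (alt t e (r :: p ++ q) v).
  by apply: eq_bigr => a _; apply: IHmu; rewrite perm_sym.
elim: p v {eq_mu} => // x p IHp v; rewrite cat_cons altC.
by apply: eq_bigr => a _; apply: IHp.
Qed.

Lemma big_ffun_recl (T : finType) n (G : {ffun 'I_n.+1 -> T} -> int) :
  \sum_c G c = \sum_(a : T) \sum_(c : {ffun 'I_n -> T})
                 G [ffun i => if unlift ord0 i is Some j then c j else a].
Proof.
rewrite pair_big /=.
rewrite (reindex (fun p : T * {ffun 'I_n -> T} =>
           [ffun i => if unlift ord0 i is Some j then p.2 j else p.1])) //=.
exists (fun c : {ffun 'I_n.+1 -> T} => (c ord0, [ffun j => c (lift ord0 j)])).
  move=> [a c] _ /=; rewrite ffunE unlift_none; congr (_, _).
  by apply/ffunP => j; rewrite !ffunE liftK.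
move=> c _; apply/ffunP => i; rewrite ffunE.
by case: unliftP => [j ->|->]; rewrite ?ffunE.
Qed.

(** For mu the cycle type of a permutation, c is a colouring of its cycles: this expresses
    the recursive [alt] by the colourings which the permutation fixes. *)
Lemma alt_sum t e mu v :
  alt t e mu v = \sum_(c : {ffun 'I_(size mu) -> 'I_m})
    perm_sign t [ffun i => v i + e * (\sum_(l < size mu | c l == i) nth 0%N mu l)%N%:Z].
Proof.
elim: mu v => [|r mu IHmu] v.
  rewrite (big_pred1 (ffun0 (card_ord 0))).
    by congr (perm_sign t _); apply/ffunP => i; rewrite ffunE big_ord0 mulr0 addr0.
  by move=> c; apply/esym/eqP/ffunP => -[].
rewrite [RHS]big_ffun_recl [LHS]/=; apply: eq_bigr => a _; rewrite IHmu; apply: eq_bigr => c _.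
congr (perm_sign t _); apply/ffunP => i; rewrite !ffunE.
rewrite [in RHS]big_mkcond big_ord_recl /= ffunE unlift_none [in LHS]big_mkcond.
under [in RHS]eq_bigr do rewrite ffunE liftK.
rewrite PoszD mulrDr addrA; congr (_ + _ + _).
by rewrite [i == a]eq_sym; case: eqP => _; rewrite ?mulr1n ?mulr0n ?mulr0.
Qed.

End Beads.

Section Duality.
Variables (m n : nat).
Implicit Type s : 'S_(m + n).

Definition left_beads s : {ffun 'I_m -> int} := [ffun i => (s (lshift n i))%:Z].
Definition right_beads s : {ffun 'I_n -> int} := [ffun j => (s (rshift m j))%:Z].

(** Complementary minors of a permutation matrix agree up to the sign of the
    permutation: either the matrix is block triangular or both minors have a zero row. *)
Lemma perm_sign_dual s :
  perm_sign 0 (left_beads s) = (-1) ^+ s * perm_sign m%:Z (right_beads s).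
Proof.
pose M : 'M[int]_(m + n) := perm_mx s.
have ulE : ulsubmx M = \matrix_(i, j) (left_beads s i == 0 + j%:Z)%:R.
  by apply/matrixP => i j; rewrite !mxE ffunE add0r eqz_nat.
have drE : drsubmx M = \matrix_(i, j) (right_beads s i == m%:Z + j%:Z)%:R.
  by apply/matrixP => i j; rewrite !mxE ffunE -PoszD eqz_nat.
rewrite /perm_sign -ulE -drE.
have prodE : (-1) ^+ s = \det (ulsubmx M) * \det (drsubmx M) ->
    \det (ulsubmx M) = (-1) ^+ s * \det (drsubmx M).
  move=> prodE; have dr2 : \det (drsubmx M) * \det (drsubmx M) = 1.
    have: \det (drsubmx M) \is a GRing.unit.
      have: \det (ulsubmx M) * \det (drsubmx M) \is a GRing.unit.
        by rewrite -prodE unitrX ?unitrN ?unitr1.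
      by rewrite unitrM => /andP[].
    by move=> /orP[] /eqP->.
  by rewrite prodE -mulrA dr2 mulr1.
case: (pickP [pred i | (m <= s (lshift n i))%N]) => [i /= le_mi|left0]; last first.
  apply: prodE; rewrite -det_perm -/M -[M]submxK (_ : ursubmx M = 0).
    by rewrite det_lblock block_mxKul block_mxKdr.
  apply/matrixP => i j; rewrite !mxE; case: eqP => // eq_s.
  by have /negP[] := left0 i; rewrite /= eq_s leq_addr.
case: (pickP [pred j | (s (rshift m j) < m)%N]) => [j /= lt_jm|right0]; last first.
  apply: prodE; rewrite -det_perm -/M -[M]submxK (_ : dlsubmx M = 0).
    by rewrite det_ublock block_mxKul block_mxKdr.
  apply/matrixP => i' j; rewrite !mxE; case: eqP => // eq_s.
  by have /negP[] := right0 i'; rewrite /= eq_s /=.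
rewrite ulE drE -!/(perm_sign _ _).
rewrite (@perm_sign_out _ _ _ i) => [|l]; last first.
  by rewrite ffunE add0r eqz_nat gtn_eqF // (leq_trans (ltn_ord l)).
rewrite (@perm_sign_out _ _ _ j) ?mulr0 // => l.
by rewrite ffunE -PoszD eqz_nat ltn_eqF // (leq_trans lt_jm) ?leq_addr.
Qed.

(** Moving a bead down by r to a free place is moving the hole at that place up by r,
    and composes s with a transposition.  The moves to occupied places cancel
    ([alt_dup]), and those beyond the ends contribute nothing ([alt_low], [alt_high]). *)
Lemma alt_dual s mu : 0%N \notin mu ->
  alt 0 (-1) mu (left_beads s)
  = (-1) ^+ s * (-1) ^+ size mu * alt m%:Z 1 mu (right_beads s).
Proof.
elim: mu s => [|r mu IHmu] s; first by rewrite mulr1 => _; apply: perm_sign_dual.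
rewrite inE negb_or => /andP[r0 mu0] /=.
pose hit (i : 'I_m) (j : 'I_n) := (s (lshift n i) == s (rshift m j) + r :> nat)%N.
have hitE i j : hit i j ->
    alt 0 (-1) mu (shift (left_beads s) i (-1 * r%:Z)) =
    (-1) ^+ s * (-1) ^+ (size mu).+1 *
      alt m%:Z 1 mu (shift (right_beads s) j (1 * r%:Z)).
  move=> /eqP hij; pose s' := (tperm (lshift n i) (rshift m j) * s)%g.
  have -> : shift (left_beads s) i (-1 * r%:Z) = left_beads s'.
    apply/ffunP => l; rewrite !ffunE permM; case: eqP => [->|ne_l].
      by rewrite tpermL hij; lia.
    rewrite tpermD ?addr0 // ?eq_rlshift ?eq_lrshift //.
    by rewrite eq_lshift eq_sym; apply/eqP.
  have -> : shift (right_beads s) j (1 * r%:Z) = right_beads s'.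
    apply/ffunP => l; rewrite !ffunE permM; case: eqP => [->|ne_l].
      by rewrite tpermR hij; lia.
    rewrite tpermD ?addr0 // ?eq_rlshift ?eq_lrshift //.
    by rewrite eq_rshift eq_sym; apply/eqP.
  rewrite IHmu // odd_permM odd_tperm eq_lrshift /= exprS.
  by case: (odd_perm s) => /=; ring.
have leftE i : alt 0 (-1) mu (shift (left_beads s) i (-1 * r%:Z)) =
    \sum_j if hit i j then alt 0 (-1) mu (shift (left_beads s) i (-1 * r%:Z)) else 0.
  have [lt_sr|le_rs] := ltnP (s (lshift n i)) r.
    rewrite (@alt_low _ _ _ _ i) ?big1 // => [j _|]; first by rewrite if_same.
    by rewrite !ffunE eqxx; lia.
  have lt_x : (s (lshift n i) - r < m + n)%N.
    by rewrite (leq_ltn_trans (leq_subr _ _)).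
  pose x := s^-1%g (Ordinal lt_x); have sx : s x = (s (lshift n i) - r)%N :> nat.
    by rewrite permKV.
  case: (splitP x) => [l|j] x_l.
    have xl : x = lshift n l by apply: val_inj.
    have ne_il : i != l.
      apply/negP => /eqP il; move: sx; rewrite xl -il; move: r0 le_rs; lia.
    rewrite (@alt_dup _ _ _ _ _ _ _ ne_il) ?big1 // => [j _|]; first by rewrite if_same.
    by rewrite !ffunE eqxx [l == i]eq_sym (negPf ne_il) -xl sx; lia.
  have xj : x = rshift m j by apply: val_inj.
  rewrite (bigD1 j) //= {1}/hit -xj sx subnK // eqxx big1 ?addr0 // => l ne_lj.
  case: ifP => // /eqP hil; case/eqP: ne_lj; apply: (@rshift_inj m n).
  by rewrite -xj; apply: (@perm_inj _ s); apply: val_inj; rewrite /= sx hil addnK.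
have rightE j : alt m%:Z 1 mu (shift (right_beads s) j (1 * r%:Z)) =
    \sum_i if hit i j then alt m%:Z 1 mu (shift (right_beads s) j (1 * r%:Z)) else 0.
  have [lt_sr|le_rs] := ltnP (s (rshift m j) + r) (m + n); last first.
    rewrite (@alt_high _ _ _ _ j) ?big1 // => [i _|]; first by rewrite if_same.
    by rewrite !ffunE eqxx; lia.
  pose x := s^-1%g (Ordinal lt_sr); have sx : s x = (s (rshift m j) + r)%N :> nat.
    by rewrite permKV.
  case: (splitP x) => [i|l] x_l; last first.
    have xl : x = rshift m l by apply: val_inj.
    have ne_jl : j != l.
      apply/negP => /eqP jl; move: sx; rewrite xl -jl; move: r0; lia.
    rewrite (@alt_dup _ _ _ _ _ _ _ ne_jl) ?big1 // => [i _|]; first by rewrite if_same.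
    by rewrite !ffunE eqxx [l == j]eq_sym (negPf ne_jl) -xl sx; lia.
  have xi : x = lshift n i by apply: val_inj.
  rewrite (bigD1 i) //= {1}/hit -xi sx eqxx big1 ?addr0 // => l ne_li.
  case: ifP => // /eqP hil; case/eqP: ne_li; apply: (@lshift_inj m n).
  by rewrite -xi; apply: (@perm_inj _ s); apply: val_inj; rewrite /= sx hil.
rewrite (eq_bigr _ (fun i _ => leftE i)) exchange_big /= mulr_sumr.
apply: eq_bigr => j _; rewrite rightE mulr_sumr; apply: eq_bigr => i _.
by case: ifP => [/hitE->|]; rewrite ?mulr0.
Qed.

End Duality.

(** * Degrees and Vandermonde determinants *)

(** 1 / z!, with the convention 1 / z! = 0 for z < 0 under which
    1 / (z - 1)! = z / z! holds for all integers z *)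
Definition inv_fact (z : int) : rat := if z is Posz n then (n`!)%:R^-1 else 0.

Lemma inv_fact_lt0 z : z < 0 -> inv_fact z = 0.
Proof. by case: z. Qed.

Lemma inv_fact_pred z : inv_fact (z - 1) = z%:~R * inv_fact z.
Proof.
case: z => [[|n]|n]; rewrite ?mul0r ?mulr0 //.
have -> : n.+1%:Z - 1 = n%:Z by lia.
rewrite /= factS natrM invfM mulrA divff ?mul1r //.
by rewrite pnatr_eq0.
Qed.

Section Degree.
Variable m : nat.

Definition degree_det (v : {ffun 'I_m -> int}) : rat :=
  \det (\matrix_(i < m, j < m) inv_fact (v i - j%:Z)).

(** Both sides satisfy the recursion obtained by removing one unit from an entry of v;
    for the determinant it is Euler's identity for the homogeneous degree M. *)
Lemma alt_ones M (v : {ffun 'I_m -> int}) :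
  \sum_i v i = M%:Z + \sum_(j < m) j%:Z ->
  (alt 0 (-1) (nseq M 1) v)%:~R = M`!%:R * degree_det v.
Proof.
elim: M v => [|M IHM] v sumv.
  rewrite mul1r /= /perm_sign /degree_det /determinant rmorph_sum.
  apply: eq_bigr => s _; rewrite rmorphM rmorph_sign rmorph_prod; congr (_ * _).
  have sum0 : \sum_i (v i - (s i)%:Z) = 0.
    rewrite sumrB sumv add0r.
    by rewrite [X in X - _](reindex_inj (h := s)) ?subrr //; apply: perm_inj.
  have [/forallP eq_v|] := boolP [forall i, v i == (s i)%:Z].
    by apply: eq_bigr => i _; rewrite !mxE (eqP (eq_v i)) add0r eqxx subrr.
  rewrite negb_forall => /existsP[i ne_i].
  rewrite (bigD1 i) //= mxE add0r (negPf ne_i) mul0r; apply/esym/eqP.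
  have [/forallP ge0|] := boolP [forall i, 0 <= v i - (s i)%:Z].
    case/negP: ne_i; rewrite -subr_eq0.
    have : \sum_i (v i - (s i)%:Z) == 0 by rewrite sum0.
    by rewrite psumr_eq0 // => /allP/(_ i); rewrite mem_index_enum => /(_ isT).
  rewrite negb_forall => /existsP[j]; rewrite -ltNge => lt0.
  by rewrite (bigD1 j) //= mxE inv_fact_lt0 // mul0r.
have IH a : (alt 0 (-1) (nseq M 1) (shift v a (-1 * 1)))%:~R
             = M`!%:R * degree_det (shift v a (-1)).
  rewrite mulr1; apply: IHM.
  rewrite (eq_bigr (fun i => v i + (-1) *+ (i == a))) => [|i _]; last by rewrite ffunE.
  rewrite big_split /= sumv [X in _ + X = _](bigD1 a) //= eqxx.
  rewrite [X in _ + (_ + X) = _]big1 => [|i /negPf->//]; lia.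
rewrite /= rmorph_sum (eq_bigr _ (fun a _ => IH a)) -mulr_sumr.
rewrite factS mulnC natrM -mulrA; congr (_ * _).
rewrite {1}/degree_det /determinant exchange_big mulr_sumr.
apply: eq_bigr => s _; rewrite -mulr_sumr [RHS]mulrCA; congr (_ * _).
rewrite (eq_bigr (fun a => (v a - (s a)%:Z)%:~R *
     \prod_i (\matrix_(i, j) inv_fact (v i - (j : 'I_m)%:Z)) i (s i))) => [|a _].
  rewrite -mulr_suml -rmorph_sum /= sumrB sumv.
  rewrite [X in _ - X](_ : _ = \sum_(j < m) j%:Z) ?addrK //.
  by rewrite [RHS](reindex_inj (h := s)) //; apply: perm_inj.
rewrite (bigD1 a) //= [in RHS](bigD1 a) //= !mxE ffunE eqxx mulrA; congr (_ * _).
  by rewrite -inv_fact_pred; congr (inv_fact _); rewrite mulr1n; ring.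
by apply: eq_bigr => i ne_ia; rewrite !mxE ffunE (negPf ne_ia) addr0.
Qed.

Definition vdm (a : 'I_m -> rat) := \prod_(i < m) \prod_(j < m | (i < j)%N) (a j - a i).

Lemma vdm_update (a a' : 'I_m -> rat) i0 : injective a ->
  (forall j, j != i0 -> a' j = a j) ->
  vdm a' = vdm a * \prod_(j | j != i0) ((a' i0 - a j) / (a i0 - a j)).
Proof.
move=> a_inj eq_a; pose g j := (a' i0 - a j) / (a i0 - a j).
pose rho i j := (if i == i0 then g j else 1) * (if j == i0 then g i else 1).
have d0 i j : i != j -> a i - a j != 0.
  by rewrite subr_eq0; apply: contraNneq => /a_inj->.
have fE i j : i != j -> a' j - a' i = (a j - a i) * rho i j.
  move=> ne_ij; rewrite /rho /g.
  case: (i =P i0) => [ii0|/eqP ni]; case: (j =P i0) => [ji0|/eqP nj].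
  - by case/eqP: ne_ij; rewrite ii0 ji0.
  - rewrite mulr1 ii0 (eq_a _ nj) -[a j - a i0]opprB mulNr mulrCA divff ?mulr1 ?opprB //.
    by apply: d0; rewrite eq_sym.
  - by rewrite mul1r ji0 (eq_a _ ni) mulrCA divff ?mulr1 // d0 // eq_sym.
  - by rewrite !mulr1 !eq_a.
have -> : vdm a' = vdm a * \prod_(i < m) \prod_(j < m | (i < j)%N) rho i j.
  rewrite -big_split; apply: eq_bigr => i _; rewrite -big_split.
  by apply: eq_bigr => j lt_ij; rewrite fE // neq_ltn lt_ij.
congr (_ * _); under [LHS]eq_bigr do rewrite /rho big_split /=.
rewrite big_split /= (bigD1 i0) //= eqxx [X in _ * X * _]big1 ?mulr1 => [|i /negPf ni]; last first.
  by apply: big1 => j _; rewrite ni.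
rewrite [RHS](bigID (fun j : 'I_m => i0 < j)%N) /=; congr (_ * _).
  by apply: eq_bigl => j; rewrite andbC; case: ltngtP => //= lt; rewrite ?neq_ltn ?lt ?orbT.
rewrite [RHS]big_mkcond; apply: eq_bigr => i _.
case: ifP => Hi; first case/andP: Hi => ne_i le_i.
  rewrite (bigD1 i0) /=; last by rewrite ltn_neqAle ne_i leqNgt.
  by rewrite eqxx big1 ?mulr1 // => j /andP[_ /negPf->].
apply: big1 => j lt_ij; case: eqP => // jj; case/negP: (negbT Hi).
by rewrite -jj -leqNgt (ltnW lt_ij) andbT neq_ltn lt_ij.
Qed.

(** The falling factorials are monic polynomials of degrees 0, 1, ..., m - 1, so the matrix
    is the product of a Vandermonde matrix by a unitriangular one. *)
Lemma det_falling (a : 'I_m -> rat) :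
  \det (\matrix_(i < m, j < m) \prod_(t < j) (a i - t%:R)) = vdm a.
Proof.
pose ff j : {poly rat} := \prod_(t < j) ('X - (t%:R)%:P).
have ffE j : ff j = \prod_(x <- [seq t%:R | t <- iota 0 j]) ('X - x%:P).
  by rewrite /ff big_map -(big_mkord xpredT (fun t => 'X - (t%:R)%:P)) /index_iota subn0.
have szff j : size (ff j) = j.+1 by rewrite ffE size_prod_XsubC size_map size_iota.
pose Cf : 'M[rat]_m := \matrix_(t, j) (ff j)`_t.
have det1 : \det Cf = 1.
  rewrite -det_tr det_trig; last first.
    apply/is_trig_mxP => i j lt_ij; rewrite !mxE nth_default // szff //.
  rewrite big1 // => i _; rewrite !mxE.
  have /monicP := monic_prod_XsubC [seq t%:R | t <- iota 0 i] xpredT (id : rat -> rat).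
  by rewrite -ffE /lead_coef szff.
pose V := Vandermonde m (\row_j a j).
have -> : \matrix_(i < m, j < m) \prod_(t < j) (a i - t%:R) = V^T *m Cf.
  apply/matrixP => i j; rewrite !mxE.
  transitivity (ff j).[a i].
    by rewrite /ff horner_prod; apply: eq_bigr => t _; rewrite !hornerE.
  rewrite (horner_coef_wide _ (_ : size (ff j) <= m)%N) ?szff //.
  by apply: eq_bigr => t _; rewrite !mxE mulrC.
rewrite det_mulmx det1 mulr1 det_tr det_Vandermonde.
by apply: eq_bigr => i _; apply: eq_bigr => j _; rewrite !mxE.
Qed.

Lemma degree_detE (l : 'I_m -> nat) :
  degree_det [ffun i => (l i)%:Z] = vdm (fun i => (l i)%:R) / \prod_i (l i)`!%:R.
Proof.
rewrite -det_falling; have -> : \matrix_(i < m, j < m) \prod_(t < j) ((l i)%:R - t%:R : rat) =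
    \matrix_(i < m, j < m) ((l i)`!%:R * inv_fact ((l i)%:Z - j%:Z)).
  apply/matrixP => i j; rewrite !mxE.
  have [le_j|lt_l] := leqP j (l i); last first.
    rewrite inv_fact_lt0 ?mulr0; last by lia.
    by rewrite (bigD1 (Ordinal lt_l)) //= subrr mul0r.
  have -> : (l i)%:Z - j%:Z = (l i - j)%N%:Z by lia.
  rewrite /= -(ffact_fact le_j) natrM mulfK ?pnatr_eq0 -?lt0n ?fact_gt0 //.
  rewrite ffact_prod natr_prod; apply: eq_bigr => t _.
  by rewrite natrB // (leq_trans (ltnW (ltn_ord t))).
rewrite /degree_det.
have -> : \matrix_(i < m, j < m) ((l i)`!%:R * inv_fact ((l i)%:Z - j%:Z))
   = diag_mx (\row_i (l i)`!%:R) *m \matrix_(i < m, j < m) inv_fact ((l i)%:Z - j%:Z).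
  by rewrite mul_diag_mx; apply/matrixP => i j; rewrite !mxE.
rewrite det_mulmx det_diag; under eq_bigr do rewrite mxE.
rewrite mulrC mulKf; last by apply/prodf_neq0 => i _; rewrite pnatr_eq0 -lt0n fact_gt0.
by congr (\det _); apply/matrixP => i j; rewrite !mxE ffunE.
Qed.

Lemma degree_det_shift (l : 'I_m -> nat) k a : injective l ->
  degree_det (shift [ffun i => (l i)%:Z] a (- k%:Z)) =
  degree_det [ffun i => (l i)%:Z] *
   (\prod_(j < k) ((l a)%:R - j%:R) *
    \prod_(j | j != a) (((l a)%:R - (l j)%:R - k%:R) / ((l a)%:R - (l j)%:R))).
Proof.
move=> l_inj; have lQ_inj : injective (fun i => (l i)%:R : rat).
  by move=> i j /eqP; rewrite eqr_nat => /eqP/l_inj.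
have [le_k|lt_l] := leqP k (l a); last first.
  rewrite (bigD1 (Ordinal lt_l)) //= subrr !mul0r mulr0.
  rewrite /degree_det (expand_det_row _ a) big1 // => j _; rewrite mxE.
  by rewrite !ffunE eqxx mulr1n inv_fact_lt0 ?mul0r //; lia.
pose l' i := if i == a then (l a - k)%N else l i.
have -> : shift [ffun i => (l i)%:Z] a (- k%:Z) = [ffun i => (l' i)%:Z].
  by apply/ffunP => i; rewrite !ffunE /l'; case: eqP => [->|_]; lia.
rewrite !degree_detE (@vdm_update (fun i => (l i)%:R) _ a) //; last first.
  by move=> j /negPf nj; rewrite /l' nj.
pose Y : rat := \prod_(i | i != a) (l i)`!%:R.
have -> : \prod_i (l' i)`!%:R = (l a - k)`!%:R * Y :> rat.
  rewrite (bigD1 a) //= {1}/l' eqxx; congr (_ * _).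
  by apply: eq_bigr => i /negPf ni; rewrite /l' ni.
have -> : \prod_i (l i)`!%:R = (l a ^_ k)%:R * (l a - k)`!%:R * Y :> rat.
  by rewrite (bigD1 a) //= -natrM ffact_fact.
have -> : \prod_(j < k) ((l a)%:R - j%:R : rat) = (l a ^_ k)%:R.
  rewrite ffact_prod natr_prod; apply: eq_bigr => t _.
  by rewrite natrB // (leq_trans (ltnW (ltn_ord t))).
have -> : \prod_(j | j != a) (((l' a)%:R - (l j)%:R) / ((l a)%:R - (l j)%:R))
   = \prod_(j | j != a) (((l a)%:R - (l j)%:R - k%:R) / ((l a)%:R - (l j)%:R)) :> rat.
  by apply: eq_bigr => j _; rewrite /l' eqxx natrB //; congr (_ / _); ring.
have f0 : (l a ^_ k)%:R != 0 :> rat by rewrite pnatr_eq0 -lt0n ffact_gt0.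
have g0 : (l a - k)`!%:R != 0 :> rat by rewrite pnatr_eq0 -lt0n fact_gt0.
have h0 : Y != 0.
  by apply/prodf_neq0 => i _; rewrite pnatr_eq0 -lt0n fact_gt0.
by field; rewrite f0 g0 h0.
Qed.

(** Frobenius' formula for a k-cycle, as a ratio to the degree *)
Lemma alt_cycle_ratio (l : 'I_m -> nat) N k : injective l -> (k <= N)%N ->
  (\sum_i l i = N + \sum_(j < m) j)%N ->
  (N ^_ k)%:R * (alt 0 (-1) (k :: nseq (N - k) 1) [ffun i => (l i)%:Z])%:~R
  = (alt 0 (-1) (nseq N 1) [ffun i => (l i)%:Z])%:~R *
    \sum_i (\prod_(j < k) ((l i)%:R - j%:R) *
    \prod_(j | j != i) (((l i)%:R - (l j)%:R - k%:R) / ((l i)%:R - (l j)%:R))) :> rat.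
Proof.
move=> l_inj le_kN suml.
have sumZ (F : 'I_m -> nat) : \sum_i (F i)%:Z = (\sum_i F i)%N%:Z.
  by rewrite (big_morph Posz PoszD (erefl 0%:Z)).
rewrite alt_ones; last first.
  by under eq_bigr do rewrite ffunE; rewrite !sumZ suml PoszD.
rewrite -(ffact_fact le_kN) natrM -!mulrA; congr (_ * _).
rewrite /= rmorph_sum !mulr_sumr; apply: eq_bigr => a _.
rewrite /= mulN1r alt_ones ?degree_det_shift //.
rewrite (eq_bigr (fun i => (l i)%:Z + (- k%:Z) *+ (i == a))) => [|i _]; last by rewrite !ffunE.
rewrite big_split /= [X in _ + X](bigD1 a) //= eqxx [X in _ + (_ + X)]big1 ?addr0 => [|i /negPf->//].
by rewrite !sumZ suml mulr1n PoszD -subzn // addrAC.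
Qed.

Lemma alt_ones_gt0 (l : 'I_m -> nat) N : {homo l : i j / (i < j)%N} ->
  (\sum_i l i = N + \sum_(j < m) j)%N ->
  0 < alt 0 (-1) (nseq N 1) [ffun i => (l i)%:Z].
Proof.
move=> l_incr suml.
have sumZ (F : 'I_m -> nat) : \sum_i (F i)%:Z = (\sum_i F i)%N%:Z.
  by rewrite (big_morph Posz PoszD (erefl 0%:Z)).
rewrite -(ltr0z rat) alt_ones; last first.
  by under eq_bigr do rewrite ffunE; rewrite !sumZ suml PoszD.
rewrite degree_detE mulr_gt0 ?ltr0n ?fact_gt0 // divr_gt0 //.
  apply: prodr_gt0 => i _; apply: prodr_gt0 => j lt_ij.
  by rewrite subr_gt0 ltr_nat l_incr.
by apply: prodr_gt0 => i _; rewrite ltr0n fact_gt0.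
Qed.

End Degree.

(** * Permutation characters of colourings *)

Section Colourings.
Variable N : nat.
Local Notation G := [set: 'S_N]%G.

Section Content.
Variable m : nat.
Implicit Types c d : {ffun 'I_N -> 'I_m}.

Definition content c : {ffun 'I_m -> 'I_N.+1} :=
  [ffun j => inord #|[set x | c x == j]|].

Lemma contentE c j : content c j = #|[set x | c x == j]| :> nat.
Proof. by rewrite ffunE inordK // ltnS -[X in (_ <= X)%N](card_ord N) max_card. Qed.

Definition fixes (g : 'S_N) c := [forall x, c (g x) == c x].

Lemma content_conj c d :
  content c = content d -> exists y : 'S_N, d = [ffun x => c (y x)].
Proof.
move=> eq_cd; pose tc := [tuple c x | x < N]; pose td := [tuple d x | x < N].
have count_t (e : {ffun 'I_N -> 'I_m}) (P : pred 'I_m) :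
    count P [tuple e x | x < N] = #|[set x | P (e x)]|.
  by rewrite cardsE -sum1_card -sum1_count big_map big_enum_cond.
have /tuple_permP[y eq_y] : perm_eq td tc.
  apply/allP => j _; rewrite /= !count_t -[X in X == _]contentE -[X in _ == X]contentE.
  by rewrite eq_cd.
exists y; apply/ffunP => x; rewrite ffunE.
have /(congr1 (fun s => nth (c x) s x)) := eq_y.
by rewrite -!tnth_nth !tnth_mktuple.
Qed.

Variables (H : {group 'S_N}) (c0 : {ffun 'I_N -> 'I_m}).
Hypothesis HE : forall g, (g \in H) = fixes g c0.

(** y conjugates g into the stabiliser of c0 exactly when g fixes the translate of c0
    by y; the translates are the colourings with the content of c0, each obtained
    from a coset of H. *)
Lemma count_conjugates g :
  (\sum_(y in G) (g ^ y \in H)%g = #|H| * #|[set c | fixes g c & content c == content c0]|)%N.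
Proof.
pose f (y : 'S_N) : {ffun 'I_N -> 'I_m} := [ffun x => c0 (y x)].
have content_f y : content (f y) = content c0.
  apply/ffunP => j; apply: val_inj; rewrite /= !contentE.
  rewrite -(card_preimset [set x | c0 x == j] (@perm_inj _ y)).
  by apply: eq_card => x; rewrite !inE ffunE.
have fixE y : (g ^ y \in H)%g = fixes g (f y).
  rewrite HE; apply/forallP/forallP => fix_g x.
    by have := fix_g (y x); rewrite conjgE !permM permK !ffunE.
  have := fix_g (y^-1%g x); rewrite !ffunE permKV conjgE !permM.
  by [].
rewrite -[X in (_ * X)%N]sum1_card big_distrr /= (partition_big f predT) //= [LHS]big_mkcond.
rewrite [RHS]big_mkcond; apply: eq_bigr => c _; rewrite inE muln1.
have [/andP[fix_c /eqP eq_c]|not_c] := ifP; last first.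
  apply: big1 => y /andP[_ /eqP fy]; rewrite fixE fy.
  by move: not_c; rewrite -fy content_f eqxx andbT => ->.
have [y0 y0E] := content_conj (esym eq_c).
rewrite -(card_lcoset H y0) -sum1_card.
rewrite (eq_bigr (fun=> 1%N)) => [|y /andP[_ /eqP fy]]; last by rewrite fixE fy fix_c.
apply: eq_bigl => y; rewrite inE /= mem_lcoset HE.
apply/eqP/forallP => [fy x|fix_y].
  have := congr1 (fun e : {ffun _ -> _} => e (y0^-1%g x)) (etrans fy y0E).
  by rewrite !ffunE permKV permM => ->.
rewrite y0E; apply/ffunP => x; rewrite !ffunE.
by have := fix_y (y0 x); rewrite permM permK => /eqP.
Qed.

Lemma cfInd_colouring g :
  'Ind[G] (1 : 'CF(H)) g = #|[set c | fixes g c & content c == content c0]|%:R.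
Proof.
rewrite cfIndE ?subsetT //; under eq_bigr do rewrite cfun1E.
by rewrite -natr_sum count_conjugates natrM mulKf // pnatr_eq0 -lt0n cardG_gt0.
Qed.

Lemma cfInd_sign_colouring g :
  'Ind[G] ('Res[H] (cfsign N)) g =
  (-1) ^+ odd_perm g * #|[set c | fixes g c & content c == content c0]|%:R.
Proof.
rewrite -cfInd_colouring !cfIndE ?subsetT // mulrCA; congr (_ * _).
rewrite mulr_sumr; apply: eq_bigr => y _; rewrite cfun1E.
have [gH|gH] := boolP (g ^ y \in H)%g; last by rewrite cfun0 // mulr0.
by rewrite cfResE ?subsetT // cfunE mulr1 conjgE !odd_permM odd_permV addbC addbK.
Qed.

End Content.

(** ** The virtual character counting fixed colourings with integer weights *)

Section VirtualCharacter.
Variable m : nat.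
Implicit Types c d : {ffun 'I_N -> 'I_m}.

Lemma stab_group_set c : group_set [set g | fixes g c].
Proof.
apply/group_setP; split=> [|g h]; first by rewrite inE; apply/forallP => x; rewrite perm1.
rewrite !inE => /forallP fg /forallP fh; apply/forallP => x.
by rewrite permM (eqP (fh _)).
Qed.
Definition stab c := Group (stab_group_set c).

Definition perm_cfun (al : {ffun 'I_m -> 'I_N.+1}) : 'CF(G) :=
  if [pick c | content c == al] is Some c then 'Ind[G] (1 : 'CF(stab c)) else 0.

Lemma perm_cfunE al g : perm_cfun al g = #|[set c | fixes g c & content c == al]|%:R.
Proof.
rewrite /perm_cfun; case: pickP => [c /eqP <-|no_c].
  by apply: cfInd_colouring => h; rewrite inE.
by rewrite cfunE (eq_card0 (A := [set c | _])) // => c; rewrite !inE no_c andbF.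
Qed.

Definition weight_cfun (Phi : {ffun 'I_m -> 'I_N.+1} -> int) : 'CF(G) :=
  \sum_al perm_cfun al *~ Phi al.

Lemma weight_cfunE Phi g :
  weight_cfun Phi g = (\sum_(c | fixes g c) Phi (content c))%:~R.
Proof.
rewrite (partition_big (@content m) predT) //= rmorph_sum sum_cfunE.
apply: eq_bigr => al _; rewrite -scaler_int cfunE perm_cfunE.
rewrite (eq_bigr (fun=> Phi al)) => [|c /andP[_ /eqP->] //].
rewrite sumr_const rmorphMn /= -[RHS]mulr_natr; congr (_ * _%:R).
by apply: eq_card => c; rewrite !inE.
Qed.

Lemma weight_cfun_vchar Phi : weight_cfun Phi \in 'Z[irr G]%g.
Proof.
apply: rpred_sum => al _; apply: rpredMz; apply: char_vchar.
rewrite /perm_cfun; case: pickP => [c _|_]; last exact: rpred0.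
by apply: cfInd_char; apply: cfun1_char.
Qed.

Lemma weight_cfun_delta c0 g :
  weight_cfun (fun al => (al == content c0)%:R) g
  = #|[set c | fixes g c & content c == content c0]|%:R.
Proof.
rewrite weight_cfunE -natr_sum rmorph_nat -sum1_card; congr (_%:R).
by rewrite [RHS]big_mkcond [LHS]big_mkcond; apply: eq_bigr => c _; rewrite inE; case: fixes.
Qed.

End VirtualCharacter.

(** ** Pairing with a sign-twisted virtual character *)

Section Pairing.
Variables m n : nat.
Variables (Phi : {ffun 'I_m -> 'I_N.+1} -> int) (Psi : {ffun 'I_n -> 'I_N.+1} -> int).
Variable D : {set 'I_m * 'I_n}.
Hypothesis cardD : #|D| = N.
Hypothesis supported : forall (c : {ffun 'I_N -> 'I_m}) (d : {ffun 'I_N -> 'I_n}),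
  injective (fun x => (c x, d x)) -> Phi (content c) != 0 -> Psi (content d) != 0 ->
  forall x, (c x, d x) \in D.
Hypothesis normalized : forall (c : {ffun 'I_N -> 'I_m}) (d : {ffun 'I_N -> 'I_n}),
  injective (fun x => (c x, d x)) -> (forall x, (c x, d x) \in D) ->
  Phi (content c) = 1 /\ Psi (content d) = 1.

(** If x and y have the same two colours, multiplication by the transposition of x and
    y reverses the signs in the sum. *)
Lemma sum_sign_stab (c : {ffun 'I_N -> 'I_m}) (d : {ffun 'I_N -> 'I_n}) :
  \sum_(g | fixes g c && fixes g d) ((-1) ^+ odd_perm g : int)
  = (injectiveb (fun x => (c x, d x)))%:R.
Proof.
case: injectiveP => [inj_cd|not_inj].
  rewrite (big_pred1 1%g) ?odd_perm1 // => g /=.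
  apply/andP/eqP => [[/forallP fc /forallP fd]|->]; last first.
    by split; apply/forallP => x; rewrite perm1.
  apply/permP => x; rewrite perm1; apply: inj_cd.
  by rewrite (eqP (fc x)) (eqP (fd x)).
have [x [y ne_xy [cxy dxy]]] : exists x, exists2 y, x != y & c x = c y /\ d x = d y.
  have /injectivePn[x [y ne_xy [cE dE]]] : ~~ injectiveb (fun x => (c x, d x)).
    by apply/injectiveP.
  by exists x, y.
set S := \sum_(g | _) _; suff : S = - S by move=> S_N; lia.
rewrite {1}/S (reindex_inj (mulgI (tperm x y))) /= -sumrN.
have fixT k (e : {ffun 'I_N -> 'I_k}) g : e x = e y ->
    fixes (tperm x y * g)%g e = fixes g e.
  have eT (u : 'I_N) : e x = e y -> e (tperm x y u) = e u.
    by case: tpermP => // -> ->.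
  move=> exy; apply/forallP/forallP => fe u.
    by have := fe (tperm x y u); rewrite permM tpermK eT.
  by rewrite permM; have := fe (tperm x y u); rewrite eT.
apply: eq_big => [g|g _]; first by rewrite !fixT.
by rewrite odd_permM odd_tperm ne_xy addTb signrN.
Qed.

(** By [sum_sign_stab] only the injective pairs of colourings contribute to the scalar
    product; the hypotheses say that these are the N! bijections onto D. *)
Lemma pairing : '[weight_cfun Phi, cfsign N * weight_cfun Psi] = 1.
Proof.
pose pairs := [set p : {ffun 'I_N -> 'I_m} * {ffun 'I_N -> 'I_n} |
   injectiveb (fun x => (p.1 x, p.2 x)) & [forall x, (p.1 x, p.2 x) \in D]].
have cardG : #|G| = N`! by rewrite cardsT card_Sn.
have card_pairs : #|pairs| = N`!.
  have := card_inj_ffuns_on 'I_N (mem D); rewrite cardD card_ord ffactnn => <-.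
  pose h (p : {ffun 'I_N -> 'I_m} * {ffun 'I_N -> 'I_n}) :
    {ffun 'I_N -> 'I_m * 'I_n} := [ffun x => (p.1 x, p.2 x)].
  have h_bij : bijective h.
    exists (fun f : {ffun 'I_N -> 'I_m * 'I_n} =>
      ([ffun x => (f x).1] : {ffun 'I_N -> 'I_m},
       [ffun x => (f x).2] : {ffun 'I_N -> 'I_n})) => [[c d]|f].
      by congr (_, _); apply/ffunP => x; rewrite !ffunE.
    by apply/ffunP => x; rewrite !ffunE; case: (f x).
  rewrite -(on_card_preimset (f := h)); last exact: onW_bij.
  apply: eq_card => p; rewrite !inE /= andbC; congr (_ && _).
    apply/forallP/ffun_onP => inD x; have := inD x; rewrite ffunE //.
  by apply: eq_injectiveb => x; rewrite ffunE.
have sumE : \sum_g (\sum_(c | fixes g c) Phi (content c)) *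
     ((-1) ^+ odd_perm g * \sum_(d | fixes g d) Psi (content d)) = (N`!)%:Z.
  transitivity (\sum_(p : {ffun 'I_N -> 'I_m} * {ffun 'I_N -> 'I_n})
     Phi (content p.1) * Psi (content p.2) *
     \sum_(g | fixes g p.1 && fixes g p.2) ((-1) ^+ odd_perm g : int)).
    rewrite (eq_bigr (fun g => \sum_(p : {ffun 'I_N -> 'I_m} * {ffun 'I_N -> 'I_n})
       if fixes g p.1 && fixes g p.2 then
         Phi (content p.1) * Psi (content p.2) * (-1) ^+ odd_perm g else 0)).
      rewrite exchange_big; apply: eq_bigr => p _.
      by rewrite mulr_sumr [RHS]big_mkcond.
    move=> g _; rewrite mulrCA mulr_suml mulr_sumr big_mkcond /=.
    rewrite -(pair_bigA _ (fun c d => if fixes g c && fixes g d then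
         Phi (content c) * Psi (content d) * (-1) ^+ odd_perm g else 0)) /=.
    apply: eq_bigr => c _; case: ifP => _ /=; last by rewrite big1.
    rewrite -big_mkcond /= !mulr_sumr; apply: eq_bigr => d _.
    exact: mulrC.
  rewrite -card_pairs -sum1_card -natz natr_sum [RHS]big_mkcond.
  apply: eq_bigr => -[c d] _; rewrite sum_sign_stab inE /=.
  case: injectiveP => [inj_cd|_]; last by rewrite mulr0.
  rewrite mulr1 /=; case: forallP => [inD|not_inD].
    by have [-> ->] := normalized inj_cd inD.
  apply/eqP; rewrite mulf_eq0; apply/norP => -[Phi0 Psi0].
  by apply: not_inD; apply: supported.
rewrite cfdotE cardG.
rewrite (eq_bigr (fun g => ((\sum_(c | fixes g c) Phi (content c)) *
     ((-1) ^+ odd_perm g * \sum_(d | fixes g d) Psi (content d)))%:~R)) => [|g _].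
  rewrite -rmorph_sum (eq_bigl predT) /= => [|g]; last by rewrite inE.
  by rewrite sumE mulVf // pnatr_eq0 -lt0n fact_gt0.
rewrite cfunE !weight_cfunE [cfsign N g]cfunE rmorphM rmorph_sign rmorph_int.
by rewrite !rmorphM rmorph_sign.
Qed.

End Pairing.
End Colourings.

(** * Characters indexed by partitions *)

Definition cycle_type N (g : 'S_N) : seq nat :=
  [seq #|pred_of_set X| | X <- enum (porbits g)].

Lemma cycle_type_sign N (g : 'S_N) :
  ((-1) ^+ size (cycle_type g) = (-1) ^+ N * (-1) ^+ odd_perm g :> int).
Proof.
rewrite size_map -cardE /odd_perm card_ord signr_addb !signr_odd mulrA.
by rewrite -signr_odd -expr2 sqrr_sign mul1r.
Qed.

Lemma cycle_type_pos N (g : 'S_N) : 0%N \notin cycle_type g.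
Proof.
apply/negP => /mapP[X]; rewrite mem_enum => /imsetP[x _ ->] /esym/eqP.
by rewrite cards_eq0 => /eqP/setP/(_ x); rewrite porbit_id inE.
Qed.

(** A colouring fixed by g is a colouring of the cycles of g. *)
Lemma sum_fixed_colourings N m t e (v : {ffun 'I_m -> int}) (g : 'S_N) :
  \sum_(c : {ffun 'I_N -> 'I_m} | fixes g c)
     perm_sign t [ffun i => v i + e * (content c i : nat)%:Z]
  = alt t e (cycle_type g) v.
Proof.
rewrite alt_sum; pose P := enum (porbits g).
have szP : size (cycle_type g) = size P by rewrite size_map.
have idxP x : (index (porbit g x) P < size (cycle_type g))%N.
  by rewrite szP index_mem mem_enum imset_f.
pose idx x := Ordinal (idxP x).
pose blk (l : 'I_(size (cycle_type g))) := nth set0 P l.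
have blkP l : exists x, blk l == porbit g x.
  have : blk l \in P by rewrite mem_nth // -szP.
  by rewrite mem_enum => /imsetP[x _ ->]; exists x.
pose rep l := xchoose (blkP l).
have repE l : porbit g (rep l) = blk l by exact/esym/eqP/(xchooseP (blkP l)).
have idx_rep l : idx (rep l) = l.
  apply: val_inj; rewrite /= repE index_uniq ?enum_uniq // -szP //.
have porbit_rep x : porbit g (rep (idx x)) = porbit g x.
  by rewrite repE /blk /= nth_index // mem_enum imset_f.
have idx_eq x l : (idx x == l) = (x \in blk l).
  apply/eqP/idP => [<-|]; first by rewrite -repE porbit_rep porbit_id.
  rewrite -repE -eq_porbit_mem => /eqP eq_x; rewrite -(idx_rep l).
  by apply: val_inj; rewrite /= eq_x.
pose h (tt : {ffun 'I_(size (cycle_type g)) -> 'I_m}) : {ffun 'I_N -> 'I_m} :=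
  [ffun x => tt (idx x)].
pose h' (c : {ffun 'I_N -> 'I_m}) : {ffun 'I_(size (cycle_type g)) -> 'I_m} :=
  [ffun l => c (rep l)].
rewrite (reindex h); last first.
  exists h' => [tt _|c]; first by apply/ffunP => l; rewrite !ffunE idx_rep.
  rewrite inE => /forallP fix_c; apply/ffunP => x; rewrite !ffunE.
  have : x \in porbit g (rep (idx x)) by rewrite porbit_rep porbit_id.
  case/porbitP => i xE; rewrite [in RHS]xE.
  elim: i {xE} => [|i IHi]; first by rewrite perm1.
  by rewrite expgSr permM (eqP (fix_c _)).
have fix_h tt : fixes g (h tt).
  apply/forallP => x; rewrite !ffunE; apply/eqP; congr (tt _).
  apply: val_inj; rewrite /=; congr (index _ _).
  by apply/eqP; rewrite eq_porbit_mem (mem_porbit g 1).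
apply: eq_big => [tt|tt _]; first by rewrite fix_h.
congr (perm_sign t _); apply/ffunP => i; rewrite [LHS]ffunE [RHS]ffunE; congr (_ + _ * _%:Z).
rewrite contentE -sum1_card.
rewrite (partition_big idx (fun l => tt l == i)) => [|x]; last by rewrite inE ffunE.
apply: eq_bigr => l /eqP tt_l; rewrite (nth_map set0) -?szP // -sum1_card.
apply: eq_bigl => x; rewrite inE ffunE idx_eq -[RHS]/(x \in blk l).
by apply: andb_idl; rewrite -idx_eq => /eqP->; rewrite tt_l.
Qed.

Lemma perm_signP m t (v : {ffun 'I_m -> int}) :
  perm_sign t v != 0 -> exists s : 'S_m, forall i, v i = t + (s i : nat)%:Z.
Proof.
move=> D0; case: (pickP [pred s : 'S_m | [forall i, v i == t + (s i : nat)%:Z]]) => [s|no_s].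
  by move=> /forallP vs; exists s => i; apply/eqP.
case/eqP: D0; apply: big1 => s _; have /forallPn[i ne_i] := negbT (no_s s).
by rewrite (bigD1 i) //= mxE (negPf ne_i) mul0r mulr0.
Qed.

Lemma perm_sign_id m t (v : {ffun 'I_m -> int}) :
  (forall i, v i = t + i%:Z) -> perm_sign t v = 1.
Proof.
move=> vE; rewrite /perm_sign -[RHS](det1 int m); congr (\det _).
apply/matrixP => i j; rewrite !mxE vE (inj_eq (addrI t)).
by rewrite eqz_nat.
Qed.

(** As i - s(i) counts the j < i minus the j with s(j) < s(i), the pair {i, j} with i < j
    contributes 0 or u_j - u_i. *)
Lemma rearrangement m (u : 'I_m -> int) (s : 'S_m) :
  {homo u : i j / (i <= j)%N >-> i <= j} ->
  0 <= \sum_i u i * ((i : nat)%:Z - (s i : nat)%:Z).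
Proof.
move=> u_incr.
have rankE (i : 'I_m) : (i : nat)%:Z = \sum_(j < m) ((j < i)%N)%:R.
  rewrite -natr_sum natz; congr Posz; rewrite -[LHS](card_ord i) -sum1_card.
  rewrite (big_ord_widen m (fun=> 1%N) (ltnW (ltn_ord i))) big_mkcond /=.
  by apply: eq_bigr => j _; case: ltnP.
pose a (i j : 'I_m) : int := u i * (((j < i)%N)%:R - ((s j < s i)%N)%:R).
have -> : \sum_i u i * ((i : nat)%:Z - (s i : nat)%:Z) = \sum_i \sum_j a i j.
  apply: eq_bigr => i _; rewrite -mulr_sumr sumrB -rankE; congr (_ * (_ - _)).
  by rewrite rankE (reindex_inj (h := s)) //; apply: perm_inj.
rewrite -(pmulrn_lge0 _ (ltn0Sn 1)) mulr2n [X in 0 <= X + _]exchange_big -big_split.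
apply: sumr_ge0 => i _; rewrite -big_split; apply: sumr_ge0 => j _ /=; rewrite /a.
have [lt_ij|lt_ji|/val_inj->] := ltngtP i j; last by rewrite ltnn; lia.
- have ne : s i != s j by rewrite (inj_eq perm_inj) -(inj_eq val_inj) ltn_eqF.
  have := u_incr i j (ltnW lt_ij).
  by case: ltngtP ne => [| |/val_inj->]; rewrite ?eqxx //= => _ _; lia.
- have ne : s i != s j by rewrite (inj_eq perm_inj) -(inj_eq val_inj) gtn_eqF.
  have := u_incr j i (ltnW lt_ji).
  by case: ltngtP ne => [| |/val_inj->]; rewrite ?eqxx //= => _ _; lia.
Qed.

(** The boxes (a, j) of the diagram, described by rows and by columns *)
Lemma nth_conj (w : seq nat) a j : sorted geq w ->
  (j < nth 0 w a)%N = (a < count (fun p => j < p) w)%N.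
Proof.
elim: w a => [|x w IHw] a; first by rewrite nth_nil.
move=> /= w_sorted; have {}IHw := IHw _ (path_sorted w_sorted).
have [lt_jx|le_xj] := ltnP j x; first by case: a => [|a]; rewrite ?lt_jx //= IHw.
have geq_tr : transitive geq by move=> y z t zy yt; apply: leq_trans yt zy.
have c0 : count (fun p => j < p)%N w = 0%N.
  apply/eqP; rewrite -leqn0 leqNgt -has_count -all_predC.
  apply/allP => y yw /=; rewrite -leqNgt (leq_trans _ le_xj) //.
  by have /allP/(_ y yw) := order_path_min geq_tr w_sorted.
case: a => [|a] /=; first by rewrite c0 ltnNge le_xj.
by rewrite IHw c0 !ltn0.
Qed.

Lemma card_reshape_index (sh : seq nat) N a : sumn sh = N ->
  #|[set x : 'I_N | reshape_index sh x == a]| = nth 0 sh a.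
Proof.
move=> shN; have ltN (c : 'I_(nth 0 sh a)) : (flatten_index sh a c < N)%N.
  by rewrite -shN flatten_indexP.
pose f c := Ordinal (ltN c); rewrite -[RHS]card_ord -(card_imset (f := f)).
  apply: eq_card => x; rewrite inE; apply/eqP/imsetP => [ra|[c _ ->]]; last first.
    exact: flatten_indexKl.
  have lt_c : (reshape_offset sh x < nth 0 sh a)%N by rewrite -ra reshape_offsetP // shN.
  exists (Ordinal lt_c) => //; apply: val_inj => /=.
  by rewrite -ra reshape_indexK.
move=> c c' /(congr1 (fun x : 'I_N => reshape_offset sh x)) /=.
by rewrite !flatten_indexKr // => /val_inj.
Qed.

Lemma cycle_type1 N : cycle_type (1%g : 'S_N) = nseq N 1%N.
Proof.
have orbit1 (x : 'I_N) : porbit 1%g x = [set x].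
  apply/setP => y; rewrite inE; apply/porbitP/eqP => [[i ->]|->].
    by rewrite expg1n perm1.
  by exists 0%N; rewrite perm1.
have sz : size (cycle_type (1%g : 'S_N)) = N.
  rewrite size_map -cardE /porbits card_imset ?card_ord // => x y.
  by rewrite !orbit1 => /set1_inj.
rewrite -[in RHS]sz; apply/all_pred1P/allP => y /mapP[X].
by rewrite mem_enum => /imsetP[x _ ->] ->; rewrite orbit1 /= cards1.
Qed.

Section Partition.
Variables (N : nat) (w : seq nat).
Hypothesis w_part : is_partition_of N w.
Let m := size w.
Let n := head 0%N w.
Local Notation G := [set: 'S_N]%G.

Let w_sorted : sorted geq w. Proof. by case/and3P: w_part. Qed.
Let w_sum : sumn w = N. Proof. by case/and3P: w_part => _ _ /eqP. Qed.

Definition part_row (i : nat) := nth 0%N w (m - i.+1).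
Definition part_col (j : nat) := count (fun p => j < p)%N w.
Definition bead (i : nat) := (part_row i + i)%N.

Let diagE (i : 'I_m) j : (j < part_row i)%N = (m - i.+1 < part_col j)%N.
Proof. exact: nth_conj. Qed.

Let row_le i : (part_row i <= n)%N.
Proof.
rewrite leqNgt /part_row nth_conj // /n; apply/negP => lt_w.
have : (0 < count (fun p => n < p)%N w)%N by exact: leq_ltn_trans lt_w.
by rewrite -nth_conj // nth0 ltnn.
Qed.

Let col_le j : (part_col j <= m)%N. Proof. exact: count_size. Qed.

Let row_incr (i i' : 'I_m) : (i <= i')%N -> (part_row i <= part_row i')%N.
Proof.
move=> le_i; rewrite leqNgt diagE; apply/negP => lt_i.
have : (part_row i' < part_row i')%N.
  by rewrite diagE (leq_ltn_trans _ lt_i) // leq_sub2l.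
by rewrite ltnn.
Qed.

Let col_decr j j' : (j <= j')%N -> (part_col j' <= part_col j)%N.
Proof. by move=> le_j; apply: sub_count => p; apply: leq_ltn_trans. Qed.

Lemma bead_incr : {homo (fun i : 'I_m => bead i) : i j / (i < j)%N}.
Proof.
move=> i j lt_ij; rewrite /bead -addnS leq_add //.
by rewrite row_incr // ltnW.
Qed.

Lemma sum_rows : (\sum_(i < m) part_row i = N)%N.
Proof.
by rewrite -w_sum sumnE (big_nth 0%N) big_mkord [RHS](reindex_inj rev_ord_inj).
Qed.

Lemma sum_beads : (\sum_(i < m) bead i = N + \sum_(i < m) i)%N.
Proof. by rewrite big_split /= sum_rows. Qed.

Let D := [set p : 'I_m * 'I_n | (p.2 < part_row p.1)%N].

Let card_row i : #|[set p in D | p.1 == i]| = part_row i.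
Proof.
rewrite -[RHS]card_ord -(card_imset (f := fun j => (i, widen_ord (row_le i) j))).
  apply: eq_card => -[i' j]; rewrite !inE /=; apply/andP/imsetP => [[lt_j /eqP ii]|].
    rewrite ii in lt_j *; exists (Ordinal lt_j) => //.
    by congr (_, _); apply: val_inj.
  by case=> l _ [-> ->] /=; rewrite eqxx ltn_ord.
by move=> j j' [] eq_j; apply: val_inj.
Qed.

Let card_col j : #|[set p in D | p.2 == j]| = part_col j.
Proof.
rewrite -[RHS]card_ord.
rewrite -(card_imset (f := fun i => (rev_ord (widen_ord (col_le j) i), j))).
  apply: eq_card => -[i j']; rewrite !inE /=; apply/andP/imsetP => [[lt_j /eqP jj]|].
    have lt_i : (m - i.+1 < part_col j)%N by rewrite -diagE -jj.
    exists (Ordinal lt_i); rewrite ?jj //.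
    by congr (_, _); apply: val_inj; rewrite /= subnSK ?subKn // ltnW.
  case=> l _ [-> ->]; split; last exact: eqxx.
  rewrite (diagE (rev_ord (widen_ord (col_le j) l))) /=.
  by have := ltn_ord l; have := col_le j; lia.
by move=> i i' /(congr1 (fun p => rev_ord p.1)); rewrite /= !rev_ordK => /(congr1 val) /= /val_inj.
Qed.

Let cardD : #|D| = N.
Proof.
rewrite -sum_rows -sum1_card (partition_big (fun p => p.1) predT) //=.
by apply: eq_bigr => i _; rewrite -card_row -sum1_card; apply: eq_bigl => p; rewrite inE.
Qed.

Lemma sum_cols : (\sum_(j < n) part_col j = N)%N.
Proof.
rewrite -[RHS]cardD -sum1_card (partition_big (fun p => p.2) predT) //=.
by apply: eq_bigr => j _; rewrite -card_col -sum1_card; apply: eq_bigl => p; rewrite inE.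
Qed.

(* The weight of a cell of the diagram is minus its hook length.  As the weight is
   negative inside the diagram and positive outside, the diagram has the smallest
   total weight among the sets of N cells. *)
Let cell_weight (p : 'I_m * 'I_n) : int :=
  (m%:Z - (bead p.1)%:Z) + ((p.2 : nat)%:Z - (part_col p.2)%:Z).

Let cell_weight_in p : p \in D -> cell_weight p <= -1.
Proof.
case: p => i j; rewrite inE /= /cell_weight /bead => lt_j; move: (lt_j); rewrite diagE.
by have := ltn_ord i; rewrite /=; lia.
Qed.

Let cell_weight_out p : p \notin D -> 1 <= cell_weight p.
Proof.
case: p => i j; rewrite inE /= /cell_weight /bead => lt_j; move: (lt_j); rewrite diagE.
by have := ltn_ord i; rewrite /=; lia.
Qed.

Let diagram_minimal (A : {set 'I_m * 'I_n}) : #|A| = N ->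
  \sum_(p in A) cell_weight p <= \sum_(p in D) cell_weight p -> A \subset D.
Proof.
move=> cardA le_AD; apply/subsetP => p pA; apply: contraLR le_AD => pD.
rewrite -ltNge (big_setID A) /= [X in _ < X](big_setID D) /= [D :&: A]setIC ltrD2l.
apply: (@lt_le_trans _ _ 0).
  have : (0 < #|D :\: A|)%N.
    rewrite cardsD cardD setIC -cardA -cardsD card_gt0; apply/set0Pn.
    by exists p; rewrite inE pD.
  case/card_gt0P => q qDA; rewrite (bigD1 q) //=.
  have wq : cell_weight q < 0.
    by apply: (@le_lt_trans _ _ (-1)) => //; apply: cell_weight_in; move: qDA; rewrite inE => /andP[].
  rewrite -[X in _ < X]addr0 ltr_leD //; apply: sumr_le0 => i /andP[].
  by rewrite inE => /andP[_ /cell_weight_in wi] _; apply: le_trans wi _.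
apply: sumr_ge0 => q; rewrite inE => /andP[/cell_weight_out wq _].
by apply: le_trans wq.
Qed.

Let sum_cell_weight (c : {ffun 'I_N -> 'I_m}) (d : {ffun 'I_N -> 'I_n}) :
  \sum_x cell_weight (c x, d x) = \sum_(i < m) (m%:Z - (bead i)%:Z) * (content c i : nat)%:Z
     + \sum_(j < n) ((j : nat)%:Z - (part_col j)%:Z) * (content d j : nat)%:Z.
Proof.
have sum_c k (f : {ffun 'I_N -> 'I_k}) (u : 'I_k -> int) :
    \sum_x u (f x) = \sum_i u i * (content f i : nat)%:Z.
  rewrite (partition_big f predT) //=; apply: eq_bigr => i _.
  rewrite (eq_bigr (fun=> u i)) => [|x /eqP-> //].
  rewrite contentE sumr_const -mulr_natr natz; congr (_ * _%:Z).
  by apply: eq_card => x; rewrite inE.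
by rewrite -(sum_c m c (fun i : 'I_m => m%:Z - (bead i)%:Z))
  -(sum_c n d (fun j : 'I_n => (j : nat)%:Z - (part_col j)%:Z)) -big_split.
Qed.

Let image_content (c : {ffun 'I_N -> 'I_m}) (d : {ffun 'I_N -> 'I_n}) :
  injective (fun x => (c x, d x)) -> (forall x, (c x, d x) \in D) ->
  (forall i, content c i = part_row i :> nat) /\ (forall j, content d j = part_col j :> nat).
Proof.
move=> inj_cd inD; pose h x := (c x, d x).
have imD : [set h x | x in 'I_N] = D.
  apply/eqP; rewrite eqEcard cardD card_imset // card_ord leqnn andbT.
  by apply/subsetP => p /imsetP[x _ ->]; apply: inD.
split=> [i|j]; rewrite contentE.
  rewrite -card_row -(card_imset _ inj_cd); apply: eq_card => p.
  rewrite -imD inE; apply/imsetP/andP => [[x xi ->]|[/imsetP[x _ ->] xi]].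
    by split; [apply: imset_f | move: xi; rewrite inE].
  by exists x; rewrite // inE.
rewrite -card_col -(card_imset _ inj_cd); apply: eq_card => p.
rewrite -imD inE; apply/imsetP/andP => [[x xi ->]|[/imsetP[x _ ->] xi]].
  by split; [apply: imset_f | move: xi; rewrite inE].
by exists x; rewrite // inE.
Qed.

(* These two conditions hold for the alternating sums of Frobenius' formula and for
   the permutation characters of the Young subgroups alike. *)
Let row_weight (Phi : {ffun 'I_m -> 'I_N.+1} -> int) :=
  (forall al : {ffun 'I_m -> 'I_N.+1}, Phi al != 0 ->
     exists s : 'S_m, forall i, (al i + s i = bead i)%N) /\
  (forall al : {ffun 'I_m -> 'I_N.+1}, (forall i, al i = part_row i :> nat) -> Phi al = 1).
Let col_weight (Psi : {ffun 'I_n -> 'I_N.+1} -> int) :=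
  (forall al : {ffun 'I_n -> 'I_N.+1}, Psi al != 0 ->
     exists s : 'S_n, forall j, (al j + j = part_col j + s j)%N) /\
  (forall al : {ffun 'I_n -> 'I_N.+1}, (forall j, al j = part_col j :> nat) -> Psi al = 1).

(* By rearrangement, the contents allowed by row_weight and col_weight make the total
   weight of the cells at most that of the diagram, so the cells fill the diagram. *)
Let weight_pairing Phi Psi : row_weight Phi -> col_weight Psi ->
  '[weight_cfun Phi, cfsign N * weight_cfun Psi] = 1.
Proof.
move=> [Phi_supp Phi1] [Psi_supp Psi1]; apply: (pairing cardD); last first.
  by move=> c d inj_cd inD; have [rc cd] := image_content inj_cd inD; rewrite Phi1 ?Psi1.
move=> c d inj_cd /Phi_supp[s cs] /Psi_supp[t dt] x.
pose A := [set (c y, d y) | y in 'I_N].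
suff /subsetP sAD : A \subset D by apply: sAD; apply: imset_f.
apply: diagram_minimal; first by rewrite card_imset ?card_ord.
rewrite big_imset /=; last by move=> y z _ _; apply: inj_cd.
rewrite sum_cell_weight.
have -> : \sum_(p in D) cell_weight p = \sum_(i < m) (m%:Z - (bead i)%:Z) * (part_row i)%:Z
     + \sum_(j < n) ((j : nat)%:Z - (part_col j)%:Z) * (part_col j)%:Z.
  rewrite /cell_weight big_split /=; congr (_ + _).
    rewrite (partition_big (fun p => p.1) predT) //=; apply: eq_bigr => i _.
    rewrite (eq_bigr (fun=> m%:Z - (bead i)%:Z)) => [|p /andP[_ /eqP-> //]].
    rewrite -card_row sumr_const -mulr_natr natz; congr (_ * _%:Z).
    by apply: eq_card => p; rewrite inE.
  rewrite (partition_big (fun p => p.2) predT) //=; apply: eq_bigr => j _.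
  rewrite (eq_bigr (fun=> (j : nat)%:Z - (part_col j)%:Z)) => [|p /andP[_ /eqP-> //]].
  rewrite -card_col sumr_const -mulr_natr natz; congr (_ * _%:Z).
  by apply: eq_card => p; rewrite inE.
apply: lerD; rewrite -subr_ge0 -sumrB.
  have sum0 : \sum_(i < m) ((i : nat)%:Z - (s i : nat)%:Z) = 0.
    rewrite sumrB [X in X - _](reindex_inj (h := s)) ?subrr //; exact: perm_inj.
  have incr : {homo (fun i : 'I_m => (bead i)%:Z) : i j / (i <= j)%N >-> i <= j}.
    by move=> i j; rewrite leq_eqVlt => /predU1P[/val_inj-> //|/bead_incr]; lia.
  rewrite (_ : \sum_(i < m) _ = \sum_(i < m) (bead i)%:Z * ((i : nat)%:Z - (s i : nat)%:Z)
     + - m%:Z * \sum_(i < m) ((i : nat)%:Z - (s i : nat)%:Z)).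
    by rewrite sum0 mulr0 addr0 rearrangement.
  rewrite mulr_sumr -big_split; apply: eq_bigr => i _ /=.
  have -> : (part_row i)%:Z = (bead i)%:Z - (i : nat)%:Z by rewrite /bead; lia.
  by rewrite -(cs i) PoszD; ring.
have /(rearrangement t) :
    {homo (fun j : 'I_n => (j : nat)%:Z - (part_col j)%:Z) : i j / (i <= j)%N >-> i <= j}.
  by move=> i j le_ij; have := col_decr le_ij; lia.
congr (0 <= _); apply: eq_bigr => j _; rewrite -mulrBr; congr (_ * _).
by have := dt j; lia.
Qed.

(** The alternating sum of permutation characters is a virtual character, and equals
    eps times the sign character times the corresponding sum for the columns, where
    eps = 1 or -1.  By [weight_pairing] its norm is eps, so it is 1, and the sum is an
    irreducible character, of positive degree.  Two more instances of [weight_pairing]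
    show that it is a constituent of the two induced characters. *)
Lemma frobenius_character : exists i : Iirr G, is_irr_of_partition w i /\
  forall g, 'chi_i g = (alt 0 (-1) (cycle_type g) [ffun i : 'I_m => (bead i)%:Z])%:~R.
Proof.
pose L : {ffun 'I_m -> int} := [ffun i : 'I_m => (bead i)%:Z].
pose L' : {ffun 'I_n -> int} := [ffun j : 'I_n => (m + j - part_col j)%N%:Z].
have L'E (j : 'I_n) : (m + j - part_col j)%N%:Z = m%:Z + (j : nat)%:Z - (part_col j)%:Z.
  by have := col_le j; lia.
pose Phi al := perm_sign 0 [ffun i => L i + (-1) * (al i : 'I_N.+1)%:Z].
pose Psi al := perm_sign m%:Z [ffun j => L' j + 1 * (al j : 'I_N.+1)%:Z].
have PhiP : row_weight Phi.
  split=> [al /perm_signP[s sE]|al alE].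
    by exists s => i; have := sE i; rewrite !ffunE; lia.
  by apply: perm_sign_id => i; rewrite !ffunE alE /bead; lia.
have PsiP : col_weight Psi.
  split=> [al /perm_signP[s sE]|al alE].
    by exists s => j; have := sE j; rewrite !ffunE L'E; lia.
  by apply: perm_sign_id => j; rewrite !ffunE alE L'E; lia.
have PhiE g : weight_cfun Phi g = (alt 0 (-1) (cycle_type g) L)%:~R.
  by rewrite weight_cfunE -sum_fixed_colourings.
have PsiE g : weight_cfun Psi g = (alt m%:Z 1 (cycle_type g) L')%:~R.
  by rewrite weight_cfunE -sum_fixed_colourings.
have bead_lt (i : 'I_m) : (bead i < m + n)%N.
  by rewrite /bead; have := row_le i; have := ltn_ord i; lia.
have hole_lt (j : 'I_n) : (m + j - part_col j < m + n)%N.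
  by have := ltn_ord j; lia.
(* The beads together with the holes below m + n form a permutation. *)
pose f (x : 'I_(m + n)) : 'I_(m + n) :=
  match split x with inl i => Ordinal (bead_lt i) | inr j => Ordinal (hole_lt j) end.
have bead_hole (i : 'I_m) (j : 'I_n) : bead i <> (m + j - part_col j)%N.
  rewrite /bead; have := ltn_ord i; have := col_le j; have := diagE i j.
  by case: ltnP => ? /esym; [move=> ? | move/negbT]; lia.
have f_inj : injective f.
  move=> x y; rewrite /f; case: (splitP x) => [i|j] xE; case: (splitP y) => [i'|j'] yE [] eq_f.
  - apply: val_inj; rewrite /= xE yE; have [/bead_incr|/bead_incr|//] := ltngtP i i'; lia.
  - by have := @bead_hole i j'; rewrite eq_f.
  - by have := @bead_hole i' j; rewrite eq_f.
  - apply: val_inj; rewrite /= xE yE.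
    have := col_le j; have := col_le j'.
    have [/[dup]/ltnW/col_decr|/[dup]/ltnW/col_decr|//] := ltngtP j j'; lia.
pose s := perm f_inj.
have leftE : left_beads s = L.
  apply/ffunP => i; rewrite !ffunE permE /f.
  by case: splitP => [i' /= /val_inj-> //|j /= iE]; have := ltn_ord i; lia.
have rightE : right_beads s = L'.
  apply/ffunP => j; rewrite !ffunE permE /f.
  case: splitP => [i /= jE|j' /= /eqP]; first by have := ltn_ord i; lia.
  by rewrite eqn_add2l => /eqP/val_inj->.
pose eps : int := (-1) ^+ s * (-1) ^+ N.
have dual : weight_cfun Phi = eps%:~R *: (cfsign N * weight_cfun Psi).
  apply/cfunP => g; rewrite cfunE cfunE PhiE PsiE [cfsign N g]cfunE.
  rewrite -leftE -rightE alt_dual ?cycle_type_pos // cycle_type_sign.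
  by rewrite /eps !rmorphM /= [((-1) ^+ odd_perm g)%:~R]rmorph_sign !mulrA.
have normE : '[weight_cfun Phi] = eps%:~R.
  by rewrite {2}dual cfdotZr weight_pairing // mulr1 rmorph_int.
have eps1 : eps = 1.
  have : 0 <= '[weight_cfun Phi] by apply: cfnorm_ge0.
  by rewrite normE ler0z /eps; case: (odd_perm s) => /=; rewrite -[_ ^+ N]signr_odd; case: (odd N).
have norm1 : '[weight_cfun Phi] = 1 by rewrite normE eps1.
have [b [i PhiI]] := vchar_norm1P (weight_cfun_vchar Phi) norm1.
have chiE : 'chi_i = weight_cfun Phi.
  case: b PhiI => PhiI; last by rewrite PhiI scale1r.
  have : 0 < weight_cfun Phi 1%g.
    rewrite PhiE ltr0z cycle_type1; apply: alt_ones_gt0 sum_beads.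
    exact: bead_incr.
  by rewrite PhiI cfunE expr1 mulN1r oppr_gt0 lt_gtF // irr1_gt0.
exists i; split; last by move=> g; rewrite chiE PhiE.
have conj_sum : sumn (conj_partition w) = N.
  have -> : conj_partition w = map part_col (index_iota 0 n).
    by rewrite /index_iota subn0.
  by rewrite sumnE big_map big_mkord sum_cols.
have nth_conj_part j : (j < n)%N -> nth 0%N (conj_partition w) j = part_col j.
  by move=> lt_jn; rewrite (nth_map 0%N) ?size_iota // nth_iota.
have row_lt (x : 'I_N) : (m - (reshape_index w x).+1 < m)%N.
  have : (reshape_index w x < m)%N by rewrite reshape_indexP // w_sum.
  lia.
pose c0 : {ffun 'I_N -> 'I_m} := [ffun x => Ordinal (row_lt x)].
have c0E x (a : 'I_m) : (c0 x == a) = (reshape_index w x == m - a.+1)%N.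
  have lt_r : (reshape_index w x < m)%N by rewrite reshape_indexP // w_sum.
  by rewrite ffunE -val_eqE /=; have := ltn_ord a; lia.
have c0_content (a : 'I_m) : content c0 a = part_row a :> nat.
  rewrite contentE /part_row -(card_reshape_index _ w_sum).
  by apply: eq_card => x; rewrite !inE c0E //.
have col_lt (x : 'I_N) : (reshape_index (conj_partition w) x < n)%N.
  have := @reshape_indexP (conj_partition w) x.
  by rewrite conj_sum size_map size_iota => ->.
pose d0 : {ffun 'I_N -> 'I_n} := [ffun x => Ordinal (col_lt x)].
have d0_content (a : 'I_n) : content d0 a = part_col a :> nat.
  rewrite contentE -nth_conj_part // -(card_reshape_index _ conj_sum).
  by apply: eq_card => x; rewrite !inE ffunE.
have c0_stab g : (g \in young_group N w) = fixes g c0.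
  rewrite inE; apply: eq_forallb => x; rewrite c0E ffunE /=.
  have lt_r : (reshape_index w x < m)%N by rewrite reshape_indexP // w_sum.
  by congr (_ == _); lia.
have d0_stab g : (g \in young_group N (conj_partition w)) = fixes g d0.
  by rewrite inE; apply: eq_forallb => x; rewrite !ffunE.
pose Phi2 al : int := (al == content c0)%:R.
pose Psi2 al : int := (al == content d0)%:R.
have Phi2P : row_weight Phi2.
  split=> [al al0|al alE].
    have /eqP-> : al == content c0 by apply: contraNT al0 => /negPf; rewrite /Phi2 => ->.
    by exists 1%g => a; rewrite c0_content perm1.
  rewrite /Phi2; suff -> : al = content c0 by rewrite eqxx.
  by apply/ffunP => a; apply: val_inj; rewrite /= alE c0_content.
have Psi2P : col_weight Psi2.
  split=> [al al0|al alE].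
    have /eqP-> : al == content d0 by apply: contraNT al0 => /negPf; rewrite /Psi2 => ->.
    by exists 1%g => a; rewrite d0_content perm1.
  rewrite /Psi2; suff -> : al = content d0 by rewrite eqxx.
  by apply/ffunP => a; apply: val_inj; rewrite /= alE d0_content.
have IndH : 'Ind[G] (1 : 'CF(young_group N w)) = weight_cfun Phi2.
  by apply/cfunP => g; rewrite (cfInd_colouring c0_stab) weight_cfun_delta.
have IndK : 'Ind[G] ('Res[young_group N (conj_partition w)] (cfsign N))
          = cfsign N * weight_cfun Psi2.
  apply/cfunP => g; rewrite (cfInd_sign_colouring d0_stab) [RHS]cfunE.
  by rewrite weight_cfun_delta [cfsign N g]cfunE.
rewrite /is_irr_of_partition IndH IndK !irr_consttE; apply/andP; split.
  by rewrite chiE dual eps1 scale1r weight_pairing // oner_neq0.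
by rewrite cfdotC chiE weight_pairing // rmorph1 oner_neq0.
Qed.



End Partition.

Lemma exists_cycle N k : (0 < k <= N)%N -> exists s : 'S_N, has_cycle_type_k1 k s.
Proof.
case/andP=> k_gt0 le_kN.
pose f (x : nat) := if (x < k)%N then (if x.+1 == k then 0%N else x.+1) else x.
have f_lt (x : 'I_N) : (f x < N)%N by rewrite /f; have := ltn_ord x; do ![case: ifP => ?]; lia.
pose F (x : 'I_N) := Ordinal (f_lt x).
have F_inj : injective F.
  move=> x y [] eq_f; apply: val_inj; move: eq_f; rewrite /f /=.
  by do ![case: ifP => ?]; lia.
pose s := perm F_inj.
have sE x : s x = f x :> nat by rewrite permE.
pose A := [set x : 'I_N | (x < k)%N].
pose x0 := Ordinal (leq_trans k_gt0 le_kN).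
have s_iter i (lt_ik : (i < k)%N) : (s ^+ i)%g x0 = i :> nat.
  elim: i lt_ik => [|i IHi] lt_ik; first by rewrite perm1.
  rewrite expgSr permM sE IHi; last exact: ltnW.
  by rewrite /f (ltnW lt_ik) (ltn_eqF lt_ik).
have orbA (x : 'I_N) : (x < k)%N -> porbit s x = A.
  move=> lt_xk; have s_closed i (y : 'I_N) : ((s ^+ i)%g y < k)%N = (y < k)%N.
    elim: i => [|i IHi]; first by rewrite perm1.
    by rewrite expgSr permM sE -IHi /f; do ![case: ifP => ?]; lia.
  have -> : porbit s x = porbit s x0.
    apply/eqP; rewrite eq_porbit_mem; apply/porbitP; exists x.
    by apply: val_inj; rewrite /= s_iter.
  apply/setP => y; rewrite inE; apply/porbitP/idP => [[i ->]|lt_yk].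
    by rewrite s_closed.
  by exists y; apply: val_inj; rewrite /= s_iter.
have orb1 (x : 'I_N) : (k <= x)%N -> porbit s x = [set x].
  move=> le_kx; have sx : s x = x.
    by apply: val_inj; rewrite /= sE /f ltnNge le_kx.
  have sxi i : (s ^+ i)%g x = x.
    by elim: i => [|i IHi]; rewrite ?perm1 // expgSr permM IHi.
  apply/setP => y; rewrite inE; apply/porbitP/eqP => [[i ->]|->] //.
  by exists 0%N; rewrite perm1.
pose L := [seq x <- enum 'I_N | (k <= nat_of_ord x)%N].
exists s; rewrite /has_cycle_type_k1.
have perm_orb : perm_eq (enum (porbits s)) (A :: [seq [set x] | x <- L]).
  apply: uniq_perm; rewrite ?enum_uniq //.
    have uL : uniq L by apply: filter_uniq; apply: enum_uniq.
    rewrite cons_uniq map_inj_uniq; last exact: set1_inj.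
    rewrite uL andbT.
    apply/mapP => -[x]; rewrite mem_filter => /andP[le_kx _] /setP/(_ x).
    by rewrite !inE eqxx ltnNge le_kx.
  move=> X; rewrite mem_enum inE; apply/imsetP/orP => [[x _ ->]|[/eqP->|/mapP[x]]].
  - have [/orbA->|le_kx] := ltnP x k; [by left | right].
    by rewrite orb1 //; apply: map_f; rewrite mem_filter le_kx mem_enum.
  - by exists x0; rewrite ?orbA.
  - by rewrite mem_filter => /andP[le_kx _] ->; exists x; rewrite ?orb1.
apply: perm_trans (perm_map _ perm_orb) _; rewrite /=.
have cardA : #|A| = k.
  rewrite -[RHS]card_ord -(card_imset (f := widen_ord le_kN)).
    apply: eq_card => x; rewrite inE; apply/idP/imsetP => [lt_xk|[y _ ->]]; last first.
      exact: (ltn_ord y).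
    by exists (Ordinal lt_xk) => //; apply: val_inj.
  by move=> x y [] eq_xy; apply: val_inj.
rewrite cardA perm_cons -map_comp (eq_map (g := fun=> 1%N)) => [|x]; last by rewrite /= cards1.
have szL : size L = (N - k)%N.
  have countA : count (mem A) (enum 'I_N) = k.
    by rewrite -cardA -sum1_card -sum1_count big_enum_cond.
  have := count_predC (mem A) (enum 'I_N); rewrite countA size_enum_ord.
  move/(canRL (addKn k)) => <-; rewrite size_filter; apply: eq_count => x.
  by rewrite /= inE -leqNgt.
rewrite -szL; elim: (L) => //= x L' IHL.
by rewrite perm_cons.
Qed.

(** The character indexed by w exists, and so does a k-cycle, so the property that
    characterises Sigma applies to them; the values are those of [alt_cycle_ratio]. *)
Lemma kerov_value k (Sigma : {mpoly int[k]}) N w (r : nat -> int) :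
  (0 < k <= N)%N -> is_kerov_polynomial Sigma -> is_partition_of N w ->
  is_free_cumulants w r ->
  (Sigma.@[fun j : 'I_k => r j.+2])%:~R =
  \sum_(i < size w) (\prod_(j < k) ((bead w i)%:R - j%:R) *
    \prod_(j < size w | j != i)
      (((bead w i)%:R - (bead w j)%:R - k%:R) / ((bead w i)%:R - (bead w j)%:R))) :> rat.
Proof.
move=> /andP[k_gt0 le_kN] Sigma_kerov w_part r_free.
have [i [i_w chiE]] := frobenius_character w_part.
have [s s_cycle] : exists s : 'S_N, has_cycle_type_k1 k s by apply: exists_cycle; rewrite k_gt0.
have := Sigma_kerov N w r i s le_kN w_part r_free i_w s_cycle.
rewrite !chiE cycle_type1 (alt_perm_eq _ _ _ s_cycle).
set X := alt _ _ (k :: _) _; set Y := alt _ _ (nseq N 1%N) _ => eqC.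
have incr := bead_incr w_part; have inj : injective (fun i : 'I_(size w) => bead w i).
  move=> a b eq_ab; apply/val_inj; have [/incr|/incr|//] := ltngtP a b; rewrite eq_ab; lia.
have Y_gt0 : 0 < Y by apply: alt_ones_gt0 incr (sum_beads w_part).
have eqZ : (N ^_ k)%:Z * X = Sigma.@[fun j : 'I_k => r j.+2] * Y.
  apply: (@intr_inj algC); rewrite !rmorphM /= -eqC.
  by rewrite divfK ?intr_eq0 ?gt_eqF // -pmulrn.
have /(congr1 (intr : int -> rat)) := eqZ; rewrite !rmorphM /= -pmulrn.
rewrite (alt_cycle_ratio inj le_kN (sum_beads w_part)) mulrC => /mulIf eqQ.
by apply/esym/eqQ; rewrite intr_eq0 gt_eqF.
Qed.

(** * The Cauchy transform of a partition *)

(** The content of the first box to the right of row a *)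
Definition row_end (w : seq nat) (a : nat) : int := (nth 0%N w a)%:Z - a%:Z.

(** Extending the products to all rows adds the same factors on both sides, because
    row a has no removable box exactly when row a + 1 has no addable one, and then the
    two boxes at the ends of these rows have the same content. *)
Lemma prod_contents (A : comNzRingType) (g : int -> A) (w : seq nat) : sorted geq w ->
  (\prod_(x <- addable_contents w) g x) * \prod_(a < size w) g (row_end w a - 1)
  = (\prod_(y <- removable_contents w) g y) *
    (g (- (size w)%:Z) * \prod_(a < size w) g (row_end w a)).
Proof.
move=> w_sorted; set m := size w.
have geq_tr : transitive geq by move=> y z t zy yt; apply: leq_trans yt zy.
have w_decr i : (nth 0 w i.+1 <= nth 0 w i)%N.
  have [lt_i|le_i] := ltnP i.+1 m; last by rewrite nth_default.
  by apply: (sorted_ltn_nth geq_tr 0%N w_sorted); rewrite ?inE // ltnW.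
pose P (i : nat) := (nth 0 w i.+1 < nth 0 w i)%N.
have addE : \prod_(x <- addable_contents w) g x =
    g (nth 0%N w 0)%:Z * \prod_(i < m | P i) g (row_end w i.+1).
  rewrite /addable_contents big_map big_filter -[iota _ _]/(index_iota 0 m.+1).
  by rewrite big_mkord big_mkcond big_ord_recl /= subr0 -big_mkcond.
have remE : \prod_(y <- removable_contents w) g y =
    \prod_(i < m | P i) g (row_end w i - 1).
  rewrite /removable_contents big_map big_filter.
  have -> : iota 0 (size w) = index_iota 0 m by rewrite /index_iota subn0.
  by rewrite big_mkord; apply: eq_bigr => i _; congr g; rewrite /row_end; ring.
have -> : g (- m%:Z) * \prod_(i < m) g (row_end w i) =
    g (nth 0%N w 0)%:Z * \prod_(i < m) g (row_end w i.+1).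
  transitivity (\prod_(i < m.+1) g (row_end w i)); last first.
    by rewrite big_ord_recl /row_end subr0.
  have end_m : row_end w m = - m%:Z by rewrite /row_end nth_default // sub0r.
  by rewrite big_ord_recr /= mulrC end_m.
rewrite addE remE [\prod_(i < m) g (row_end w i - 1)](bigID (fun i : 'I_m => P i)) /=.
rewrite [\prod_(i < m) g (row_end w i.+1)](bigID (fun i : 'I_m => P i)) /=.
have -> : \prod_(i < m | ~~ P i) g (row_end w i.+1) =
    \prod_(i < m | ~~ P i) g (row_end w i - 1).
  apply: eq_bigr => i; rewrite /P -leqNgt => le_i; congr g; rewrite /row_end.
  have -> : nth 0%N w i.+1 = nth 0%N w i by apply/eqP; rewrite eqn_leq w_decr.
  by lia.
by ring.
Qed.

(** This is z / H_w(1/z), written by means of the rows of w instead of its corners. *)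
Definition row_transform (A : comNzRingType) (w : seq nat) : fps A :=
  lin (- (size w)%:R) * \prod_(a < size w)
     (lin (row_end w a)%:~R * fpsV (lin (row_end w a - 1)%:~R)).

Lemma map_row_transform (A B : comNzRingType) (phi : {rmorphism A -> B}) w :
  map_fps phi (row_transform A w) = row_transform B w.
Proof.
rewrite /row_transform rmorphM rmorph_prod /= map_fps_lin rmorphN rmorph_nat.
congr (_ * _); apply: eq_bigr => a _.
by rewrite rmorphM /= map_fpsV !map_fps_lin !rmorph_int.
Qed.

Lemma coef0_row_transform (A : comNzRingType) w : row_transform A w 0%N = 1.
Proof.
rewrite /row_transform coef0_fpsM lin0 mul1r; elim/big_rec: _ => // a f _ f0.
by rewrite !coef0_fpsM lin0 coef0_fps_inv ?lin0 // f0 !mulr1.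
Qed.

Section RowTransform.
Variables (A : comNzRingType) (w : seq nat) (R : fps A).
Hypothesis RU : R * fpsO (row_transform A w) (inv_K R) = 1.
Let F := inv_K R.

Lemma row_transform_free_cumulants :
  R * (fpsO (lin (- (size w)%:R)) F * \prod_(a < size w) fpsO (lin (row_end w a)%:~R) F)
  = \prod_(a < size w) fpsO (lin (row_end w a - 1)%:~R) F.
Proof.
have F0 : F 0%N = 0 by exact: coef0_inv_K.
set V := (X in _ = X).
transitivity (R * (fpsO (row_transform A w) F * V)); last by rewrite mulrA [R * _]RU mul1r.
congr (_ * _); rewrite /row_transform fps_compM // -mulrA; congr (_ * _).
rewrite /V !fps_comp_prod // -big_split; apply: eq_bigr => a _ /=.
by rewrite fps_compM // fps_compV ?lin0 // mulrAC fps_mulK // coef0_fps_comp lin0.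
Qed.

End RowTransform.

Definition fps_of_poly (A : comNzRingType) (p : {poly A}) : fps A := fun n => p`_n.

Section FpsOfPoly.
Variable A : comNzRingType.

Fact fps_of_poly_zmod_morphism : zmod_morphism (@fps_of_poly A).
Proof. by move=> p q; apply: fpsP => n; rewrite coef_fpsB /fps_of_poly coefB. Qed.
Fact fps_of_poly_monoid_morphism : monoid_morphism (@fps_of_poly A).
Proof.
split; first by apply: fpsP => n; rewrite /fps_of_poly coef1.
by move=> p q; apply: fpsP => n; rewrite /fps_of_poly coefM.
Qed.
HB.instance Definition _ := GRing.isZmodMorphism.Build {poly A} (fps A)
  (@fps_of_poly A) fps_of_poly_zmod_morphism.
HB.instance Definition _ := GRing.isMonoidMorphism.Build {poly A} (fps A)
  (@fps_of_poly A) fps_of_poly_monoid_morphism.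

Lemma fps_of_polyX : fps_of_poly 'X = fX A.
Proof. by apply: fpsP => n; rewrite /fps_of_poly coefX. Qed.

Lemma fps_of_poly_lin (a : A) : fps_of_poly (1 - a *: 'X) = lin a.
Proof.
rewrite rmorphB rmorph1 /lin; congr (_ - _); apply: fpsP => n.
by rewrite coef_fpsCM -[LHS]/((a *: 'X)`_n) coefZ coefX.
Qed.

End FpsOfPoly.

(** If U(z) = z / H_w(1/z) and F(t) = t / R(t), then R(t) U(F(t)) = 1 says that
    H_w(1 / F(t)) = t. *)
Lemma is_free_cumulants_rows w (R : fps int) : sorted geq w ->
  R 0%N = 1 -> R * fpsO (row_transform int w) (inv_K R) = 1 ->
  is_free_cumulants w R.
Proof.
move=> w_sorted R0 RU n; set F := inv_K R in RU.
have F0 : F 0%N = 0 by exact: coef0_inv_K.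
pose add : fps int := \prod_(x <- addable_contents w) lin x%:~R.
pose rem : fps int := \prod_(y <- removable_contents w) lin y%:~R.
have HE : H_at_infinity w = (fX int * rem * fpsV add : fps int).
  rewrite /H_at_infinity -[fun n => _`_n]/(fps_of_poly _) -[X in fps_inv X]/(fps_of_poly _).
  rewrite -[fps_mul _ _]/(_ * fpsV _) rmorphM !rmorph_prod /= fps_of_polyX.
  by congr (_ * _ * fpsV _); apply: eq_bigr => a _; rewrite fps_of_poly_lin intz.
have -> : fps_mul (fps_var int) (fps_inv (fun i : nat => if i == 0%N then 1 else R i)) = F.
  rewrite /F /inv_K; congr (_ * fpsV _); apply: fpsP => -[|i] //=.
have addR : fpsO add F * R = fpsO rem F.
  have := row_transform_free_cumulants RU; rewrite -/F => RE.
  have := prod_contents (fun a => fpsO (lin a%:~R) F) w_sorted.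
  have cast : (- (size w)%:Z)%:~R = - (size w)%:R :> int by rewrite rmorphN.
  rewrite cast -RE -(fps_comp_prod F0) -(fps_comp_prod F0 (removable_contents w)) => PC.
  apply: (@fps_mulI _ (fpsO (lin (- (size w)%:R)) F *
     \prod_(a < size w) fpsO (lin (row_end w a)%:~R) F)).
    rewrite coef0_fpsM coef0_fps_comp lin0 mul1r.
    by elim/big_rec: _ => // a f _ f0; rewrite coef0_fpsM f0 coef0_fps_comp lin0 mulr1.
  by rewrite [LHS]mulrC -[LHS]mulrA [RHS]mulrC; exact: PC.
have add0 : add 0%N = 1 by rewrite /add (big_nth 0) big_mkord coef0_prod_lin.
rewrite -[LHS]/(fpsO (H_at_infinity w) F n) HE.
rewrite !fps_compM // fps_compX // fps_compV // -addR -/F.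
suff -> : F * (fpsO add F * R) * fpsV (fpsO add F) = fX int by [].
have a0 : fpsO add F 0%N = 1 by rewrite coef0_fps_comp.
transitivity (R * F * (fpsO add F * fpsV (fpsO add F))); first by ring.
by rewrite fps_mulV // mulr1 inv_KM.
Qed.

(** * The polynomial given by the shifted inverse Cauchy transforms *)

Section Candidate.
Variable k : nat.
Local Notation A := {mpoly rat[k]}.
Local Notation C := (Cser k : fps A).

(** With the convention P_0 = 1 *)
Definition Pzero (m : nat) : fps A := if m is 0 then 1 else Pser k m.

(** The coefficients of \sum_m i^m t^m P_m(t) *)
Definition shifted_sum (i : nat) : fps A :=
  fun n => \sum_(m < n.+1) (i%:R ^+ m : rat) *: Pzero m (n - m)%N.

Definition kerov_candidate : A :=
  - (k%:R^-1 : rat) *: (fpsV C * \prod_(i < k.-1) shifted_sum i.+1) k.+1.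

Lemma Cser0 : C 0%N = 1.
Proof. by apply: coef0_fps_inv; rewrite /fps_one /Rvar /= mul0rn subr0. Qed.

Section Evaluation.
Variable R : fps rat.
Hypothesis R0 : R 0%N = 1.
Local Notation phi := (meval (fun j : 'I_k => R j.+2)).

Lemma map_Cser : eqmod k.+2 (map_fps phi C) (fpsV (R - euler R)).
Proof.
rewrite [map_fps _ _]map_fpsV; apply: eqmod_inv => i lt_ik.
rewrite coef_fpsB coef_euler /map_fps rmorphB rmorphMn.
case: i lt_ik => [|[|i]] lt_ik.
- by rewrite R0 /Rvar /= mul0rn rmorph0 rmorph1 mulr1n mulr0n.
- by rewrite /Rvar /= mul0rn rmorph0 rmorph1 mulr0n mulr1n !subrr.
rewrite /Rvar /= mulr0n insubT /= ?subn2 // => lt_i.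
by rewrite mevalMn mevalXU /= ?subn2 /= sub0r [in RHS]mulrS opprD addrA subrr sub0r.
Qed.

Lemma map_Pzero m : fX rat ^+ m * map_fps phi (Pzero m) = taylor (map_fps phi C) m.
Proof.
case: m => [|m]; first by rewrite mul1r /= rmorph1.
have PE j : map_fps phi (Pser k j.+1) = fpsC (- (j.+1)`!%:R^-1) * map_fps phi (Pchain k j).
  apply: fpsP => n; rewrite coef_fpsCM /map_fps /Pser /=.
  by rewrite mevalZ.
rewrite /= PE; elim: m => [|m IHm].
  by rewrite euler1 /= invr1 rmorphN rmorph1; ring.
have chainE : map_fps phi (Pchain k m.+1) = map_fps phi C *
     (euler (map_fps phi (Pchain k m)) + map_fps phi (Pchain k m) *+ m).
  rewrite -[Pchain k m.+1]/(C * (fps_euler m (Pchain k m) : fps A)) rmorphM; congr (_ * _).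
  by apply: fpsP => n; rewrite coef_fpsD coef_fpsMn coef_euler /map_fps /fps_euler /= mevalD !mevalMn.
rewrite [taylor _ m.+1]/= -IHm chainE.
have eX : euler (fX rat ^+ m.+1) = fX rat ^+ m.+1 *+ m.+1.
  by rewrite eulerX euler_var exprS mulrC.
rewrite !eulerM eulerC eX.
have facE : fpsC (- (m.+2)`!%:R^-1) = fpsC m.+2%:R^-1 * fpsC (- (m.+1)`!%:R^-1) :> fps rat.
  by rewrite -rmorphM mulrN -invfM -natrM.
rewrite facE -[_ *+ m.+1]mulr_natl.
have -> : map_fps phi (Pchain k m) *+ m = m%:R * map_fps phi (Pchain k m).
  by rewrite mulr_natl.
rewrite [fX rat ^+ m.+2]exprS -[m.+1]addn1 natrD.
set g := map_fps phi (Pchain k m); set a := fpsC _; set b := fpsC _.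
by set c := map_fps phi C; ring.
Qed.

Lemma map_shifted_sum i :
  map_fps phi (shifted_sum i) = taylor_sum (map_fps phi C) i%:R.
Proof.
apply: fpsP => n; rewrite /map_fps rmorph_sum; apply: eq_bigr => m _ /=.
rewrite mevalZ -map_Pzero coef_fpsXnM ltnNge -ltnS ltn_ord /=.
by [].
Qed.

(** The candidate only involves R_2, ..., R_(k+1), which determine 1/C = R - D R up to
    order k + 1; the coefficient of t in R - D R is 0 for any R. *)
Lemma meval_candidate : kerov_candidate.@[fun j : 'I_k => R j.+2] = - k%:R^-1 *
  ((R - euler R) * \prod_(i < k.-1) taylor_sum (fpsV (R - euler R)) i.+1%:R) k.+1.
Proof.
rewrite mevalZ; congr (_ * _).
rewrite -[LHS]/(map_fps phi (fpsV C * \prod_(i < k.-1) shifted_sum i.+1) k.+1).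
rewrite rmorphM rmorph_prod /= map_fpsV.
have D0 : (R - euler R) 0%N = 1 by rewrite coef_fpsB coef_euler R0 subr0.
have DV : R - euler R = fpsV (fpsV (R - euler R)).
  by apply: fps_invP; rewrite ?coef0_fps_inv // mulrC fps_mulV.
rewrite {1}DV; apply: (@eqmodM _ k.+2); last exact: ltnSn.
  by apply: eqmod_inv; apply: map_Cser.
apply: eqmod_prod => i; rewrite map_shifted_sum.
by apply: eqmod_taylor_sum; apply: map_Cser.
Qed.


End Evaluation.
End Candidate.

(** * Weights *)

Section Weights.
Variable k : nat.
Local Notation A := {mpoly rat[k]}.
Local Notation C := (Cser k : fps A).
Implicit Types f g : fps A.

(** The substitution of R_j u^j for R_j *)
Definition scale_weight : A -> {poly A} :=
  mmap (polyC \o @mpolyC k rat) (fun j : 'I_k => ('X_j : A) *: 'X^(j.+2)).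

HB.instance Definition _ := GRing.RMorphism.on scale_weight.

Lemma scale_weightZ (c : rat) (p : A) : scale_weight (c *: p) = c%:MP%:P * scale_weight p.
Proof. exact: mmapZ. Qed.

Lemma map_weight_part (Sigma : {mpoly int[k]}) d :
  map_mpoly (intr : int -> rat) (weight_part Sigma d)
  = (scale_weight (map_mpoly (intr : int -> rat) Sigma))`_d.
Proof.
rewrite /weight_part /scale_weight; set i := maxn (msize Sigma) (msize (map_mpoly intr Sigma : A)).
have h1 : (msize Sigma <= i)%N by apply: leq_maxl.
have h2 : (msize (map_mpoly intr Sigma : A) <= i)%N by apply: leq_maxr.
rewrite -[fun c : int => _]/(polyC \o @mpolyC k int) (mmapE _ h1) (mmapE _ h2).
rewrite !coef_sum rmorph_sum; apply: eq_bigr => m _ /=.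
rewrite !coefCM rmorphM /= map_mpolyC mcoeff_map_mpoly; congr (_ * _).
have E (B : comNzRingType) : mmap1 (fun j : 'I_k => ('X_j : {mpoly B[k]}) *: 'X^(j.+2)) m
   = 'X_[m] *: 'X^(\sum_(j < k) j.+2 * m j)%N.
  rewrite /mmap1 (eq_bigr (fun j : 'I_k => (('X_j : {mpoly B[k]}) ^+ m j) *: 'X^(j.+2 * m j)%N)).
    rewrite scaler_prod -mpolyXE_id; congr (_ *: _).
    by rewrite -(big_morph _ (fun a b => exprD 'X a b) (expr0 'X)).
  by move=> j _; rewrite exprZn exprM.
by rewrite !E !coefZ !coefXn rmorphM rmorph_nat /= map_mpolyX.
Qed.

Definition isobaric f := forall n, scale_weight (f n) = (f n)%:P * 'X^n.

Lemma isobaric1 : isobaric 1.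
Proof.
case=> [|n]; first by rewrite [X in scale_weight X]mulr1n rmorph1 mulr1.
by rewrite [X in scale_weight X]mulr0n rmorph0 mul0r.
Qed.

Lemma isobaricD f g : isobaric f -> isobaric g -> isobaric (f + g).
Proof. by move=> hf hg n; rewrite coef_fpsD !rmorphD /= hf hg mulrDl. Qed.

Lemma isobaricN f : isobaric f -> isobaric (- f).
Proof. by move=> hf n; rewrite coef_fpsN !rmorphN /= hf mulNr. Qed.

Lemma isobaricM f g : isobaric f -> isobaric g -> isobaric (f * g).
Proof.
move=> hf hg n; rewrite coef_fpsM !rmorph_sum mulr_suml; apply: eq_bigr => i _ /=.
rewrite !rmorphM /= hf hg mulrACA -exprD subnKC //.
by rewrite -ltnS.
Qed.

Lemma isobaricX f j : isobaric f -> isobaric (f ^+ j).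
Proof.
move=> hf; elim: j => [|j IHj]; first exact: isobaric1.
by rewrite exprS; apply: isobaricM.
Qed.

Lemma isobaricV f : isobaric f -> isobaric (fpsV f).
Proof.
move=> hf n; rewrite /fpsV /fps_inv !rmorph_sum mulr_suml; apply: eq_bigr => j _ /=.
rewrite fps_expE; apply: isobaricX; apply: isobaricD isobaric1 (isobaricN hf).
Qed.

Lemma isobaricMn f (c : nat -> nat) : isobaric f -> isobaric (fun n => f n *+ c n).
Proof. by move=> hf n; rewrite !rmorphMn /= hf mulrnAl. Qed.

Lemma isobaric_prod (I : Type) (r : seq I) (F : I -> fps A) :
  (forall i, isobaric (F i)) -> isobaric (\prod_(i <- r) F i).
Proof. by move=> hF; elim/big_rec: _ => [|i f _]; [exact: isobaric1 | exact: isobaricM]. Qed.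

Lemma isobaric_Cser : isobaric C.
Proof.
apply: isobaricV; apply: isobaricD isobaric1 (isobaricN _); apply: (@isobaricMn _ predn).
move=> n; rewrite /Rvar; case: ifP => [n2|_]; last by rewrite rmorph0 mul0r.
case: insubP => [j _ jE|_]; last by rewrite rmorph0 mul0r.
rewrite /scale_weight mmapX mmap1U -mul_polyC; congr (_ * 'X^_).
by rewrite -[val j]/(nat_of_ord j) in jE; rewrite jE; lia.
Qed.

Lemma isobaric_Pzero m : isobaric (Pzero k m).
Proof.
case: m => [|m]; first exact: isobaric1.
suff chain : isobaric (Pchain k m).
  by move=> n; rewrite /= /Pser scale_weightZ chain -mul_mpolyC rmorphM mulrA.
elim: m => [|m IHm]; first exact: isobaric_Cser.
apply: isobaricM isobaric_Cser _; apply: isobaricD; apply: isobaricMn IHm.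
Qed.

(** Distributing the product chooses one term P_(a_i) of each sum; this is where the
    monomials \prod_j j^(a_j) come from. *)
Lemma shifted_sum_prod (g : fps A) M K :
  (g * \prod_(i < M) shifted_sum k i.+1) K =
  \sum_(a : {ffun 'I_M -> 'I_K.+1})
    (\prod_(i < M) (i.+1)%:R ^+ a i : rat) *:
      (if (\sum_i a i <= K)%N
       then (g * \prod_(i < M) Pzero k (a i)) (K - \sum_i a i)%N else 0).
Proof.
have eqS (i : nat) : eqmod K.+1 (shifted_sum k i)
   (\sum_(m < K.+1) fpsC (i%:R ^+ m)%:MP * (fX A ^+ m * Pzero k m)).
  move=> n lt_nK; rewrite coef_fps_sum /shifted_sum.
  rewrite (big_ord_widen _ (fun m => (i%:R ^+ m : rat) *: Pzero k m (n - m)%N) lt_nK).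
  rewrite big_mkcond; apply: eq_bigr => m _; rewrite coef_fpsCM coef_fpsXnM ltnS mul_mpolyC.
  by case: leqP => // _; rewrite scaler0.
rewrite (eqmodM (fun _ _ => erefl) (eqmod_prod _ (fun i : 'I_M => eqS i.+1)) (ltnSn K)).
rewrite bigA_distr_bigA mulr_sumr coef_fps_sum; apply: eq_bigr => a _.
rewrite !big_split /= -rmorph_prod -(big_morph _ (fun x y => exprD (fX A) x y) (expr0 _)).
rewrite /= [g * (fpsC _ * _)]mulrCA coef_fpsCM [g * (_ * _)]mulrCA coef_fpsXnM -rmorph_prod /= mul_mpolyC.
by congr (_ *: _); case: leqP.
Qed.

(** The terms with \sum_i a_i = d are coefficients of order k + 1 - d of isobaric series,
    so they are exactly those of weight k + 1 - d. *)
Lemma weight_candidate d : (d <= k.+1)%N ->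
  (scale_weight (kerov_candidate k))`_(k.+1 - d) = - (k%:R^-1 : rat) *:
  \sum_(a : {ffun 'I_k.-1 -> 'I_k.+2} | (\sum_i a i == d)%N)
     (\prod_(i < k.-1) (i.+1)%:R ^+ a i : rat) *:
       (fpsV C * \prod_(i < k.-1) Pzero k (a i)) (k.+1 - d)%N.
Proof.
move=> le_d; rewrite /kerov_candidate scale_weightZ coefCM mul_mpolyC; congr (_ *: _).
rewrite shifted_sum_prod rmorph_sum coef_sum [RHS]big_mkcond; apply: eq_bigr => a _ /=.
rewrite scale_weightZ coefCM mul_mpolyC; case: leqP => [le_a|lt_a]; last first.
  by rewrite rmorph0 coef0 scaler0 gtn_eqF // (leq_ltn_trans le_d).
rewrite (isobaricM (isobaricV isobaric_Cser)) ?coefCM ?coefXn; last first.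
  by apply: isobaric_prod => i; apply: isobaric_Pzero.
have -> : (k.+1 - d == k.+1 - \sum_i a i)%N = (\sum_i a i == d)%N.
  by apply/eqP/eqP; move: (\sum_i a i)%N le_a => S; lia.
by case: eqP => [->|_]; rewrite ?mulr1 ?mulr0 ?scaler0.
Qed.

End Weights.

(** * Partitions and monomial symmetric functions *)

Definition nonzero_parts M B (a : {ffun 'I_M -> 'I_B}) : seq nat :=
  [seq e <- map val (codom a) | e != 0%N].

Lemma big_nonzero_parts (T : Type) (idx : T) (op : Monoid.com_law idx)
    M B (a : {ffun 'I_M -> 'I_B}) (F : nat -> T) : F 0%N = idx ->
  \big[op/idx]_(e <- nonzero_parts a) F e = \big[op/idx]_i F (a i).
Proof.
move=> F0; rewrite big_filter big_map codomE big_map -[RHS]big_enum /= big_mkcond.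
by apply: eq_bigr => i _; case: eqP => // ->.
Qed.

Lemma sumn_nonzero_parts M B (a : {ffun 'I_M -> 'I_B}) :
  sumn (nonzero_parts a) = (\sum_i a i)%N.
Proof. by rewrite sumnE (@big_nonzero_parts _ _ _ _ _ a id). Qed.

(** The bound on the exponents in a monomial symmetric function is made independent of
    the partition, so that all partitions can be treated together. *)
Lemma monomial_sym_widen M (lambda : seq nat) (x : 'I_M -> rat) B :
  (sumn lambda <= B)%N ->
  monomial_sym lambda x = \sum_(a : {ffun 'I_M -> 'I_B.+1}
     | perm_eq (nonzero_parts a) lambda) \prod_(i < M) x i ^+ a i.
Proof.
move=> le_B; have le_B1 : ((sumn lambda).+1 <= B.+1)%N by [].
pose h (a : {ffun 'I_M -> 'I_(sumn lambda).+1}) : {ffun 'I_M -> 'I_B.+1} :=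
  [ffun i => widen_ord le_B1 (a i)].
pose h' (a : {ffun 'I_M -> 'I_B.+1}) : {ffun 'I_M -> 'I_(sumn lambda).+1} :=
  [ffun i => inord (a i)].
have hE a : map val (codom (h a)) = map val (codom a).
  by rewrite !codomE -!map_comp; apply: eq_map => i; rewrite /= ffunE.
rewrite (reindex h) /=; last first.
  exists h' => a; first by move=> _; apply/ffunP => i; rewrite !ffunE inord_val.
  rewrite inE => a_lambda; apply/ffunP => i; rewrite !ffunE; apply: val_inj.
  rewrite /= inordK // ltnS -(perm_sumn a_lambda) sumn_nonzero_parts.
  by rewrite (bigD1 i) //= leq_addr.
apply: eq_big => [a|a _]; first by rewrite /nonzero_parts hE.
by apply: eq_bigr => i _; rewrite ffunE.
Qed.

Section PartitionSum.
Variable k : nat.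
Local Notation A := {mpoly rat[k]}.
Local Notation C := (Cser k : fps A).

Lemma Ppart_nonzero M B (a : {ffun 'I_M -> 'I_B}) lambda :
  perm_eq (nonzero_parts a) lambda ->
  (Ppart k lambda : fps A) = \prod_i Pzero k (a i).
Proof.
move=> a_lambda.
have all0 : all (fun m => m != 0%N) lambda.
  by rewrite -(perm_all _ a_lambda) filter_all.
transitivity (\prod_(m <- lambda) Pzero k m : fps A).
  elim: lambda all0 {a_lambda} => [|m l IHl]; first by rewrite big_nil.
  rewrite big_cons /= => /andP[m0 /IHl <-].
  by case: m m0.
by rewrite -(perm_big _ a_lambda) big_nonzero_parts.
Qed.

(** Each exponent function a of sum d is counted for the partition obtained by sorting
    its nonzero values. *)
Lemma partition_sum (x : 'I_k.-1 -> rat) d B K : (d <= B)%N ->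
  \sum_(lambda <- partitions d)
     monomial_sym lambda x *: ((Ppart k lambda : fps A) * fpsV C) K
  = \sum_(a : {ffun 'I_k.-1 -> 'I_B.+1} | (\sum_i a i == d)%N)
     (\prod_i x i ^+ a i) *: (fpsV C * \prod_i Pzero k (a i)) K.
Proof.
move=> le_dB.
pose shape (a : {ffun 'I_k.-1 -> 'I_B.+1}) := sort geq (nonzero_parts a).
have geq_total : total geq by move=> i j; apply: leq_total.
have geq_tr : transitive geq by move=> y z t zy yt; apply: leq_trans yt zy.
have geq_anti : antisymmetric geq by move=> i j; rewrite andbC; apply: anti_leq.
have shapeP a lambda : lambda \in partitions d ->
    perm_eq (nonzero_parts a) lambda = (shape a == lambda).
  rewrite mem_partitions => /and3P[l_sorted _ _]; apply/idP/eqP => [a_l|<-].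
    apply: (sorted_eq geq_tr geq_anti _ l_sorted); first exact: sort_sorted.
    by rewrite perm_sort.
  by rewrite perm_sym perm_sort.
rewrite big_seq (eq_bigr (fun lambda => \sum_(a : {ffun 'I_k.-1 -> 'I_B.+1} | shape a == lambda)
     (\prod_i x i ^+ a i) *: (fpsV C * \prod_i Pzero k (a i)) K)); last first.
  move=> lambda l_in; have : sumn lambda = d.
    by move: l_in; rewrite mem_partitions => /and3P[_ _ /eqP].
  move=> l_sum; rewrite (@monomial_sym_widen _ _ _ B) ?l_sum // scaler_suml.
  apply: eq_big => [a|a a_l]; first exact: shapeP.
  by rewrite (Ppart_nonzero a_l) mulrC.
rewrite (exchange_big_dep (fun a : {ffun 'I_k.-1 -> 'I_B.+1} => (\sum_i a i == d)%N)) /=.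
  apply: eq_bigr => a /eqP sum_a.
  have shape_in : shape a \in partitions d.
    rewrite mem_partitions /is_partition_of sort_sorted // mem_sort mem_filter /=.
    by rewrite (perm_sumn (permEl (perm_sort _ _))) sumn_nonzero_parts sum_a eqxx.
  rewrite -big_seq_cond -big_filter (eq_filter (a2 := pred1 (shape a))) => [|l]; last first.
    by rewrite /= eq_sym.
  by rewrite filter_pred1_uniq ?uniq_partitions // big_seq1.
move=> lambda a; rewrite mem_partitions => /and3P[_ _ /eqP <-] /eqP <-.
by rewrite (perm_sumn (permEl (perm_sort _ _))) sumn_nonzero_parts.
Qed.

(** The definition of P gives (d + 2) P_(d+2) / C = (D + d) P_(d+1), and D multiplies the
    coefficient of order K by K. *)
Lemma Pser_div_C d K :
  ((Pser k d.+2 : fps A) * fpsV C) K = ((K + d)%:R / d.+2%:R : rat) *: Pser k d.+1 K.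
Proof.
have -> : (Pser k d.+2 : fps A) =
    fpsC (- (d.+2)`!%:R^-1)%:MP * (C * (fps_euler d (Pchain k d) : fps A)).
  by apply: fpsP => n; rewrite coef_fpsCM mul_mpolyC.
set g : fps A := fps_euler _ _; set b := fpsC _.
have -> : b * (C * g) * fpsV C = b * (g * (C * fpsV C)) by ring.
rewrite fps_mulV ?Cser0 // mulr1 coef_fpsCM mul_mpolyC /g /fps_euler -mulrnDr /Pser /=.
rewrite -scaler_nat !scalerA; congr (_ *: _).
rewrite (factS d.+1) natrM invfM.
by move: (_ + _)%:R (d.+2)%:R^-1 (d.+1)`!%:R^-1 => u v t; ring.
Qed.

End PartitionSum.

(** * Free cumulants of partitions are Zariski dense *)

Lemma poly_nat_roots (P : {poly rat}) K :
  (forall s : nat, (K <= s)%N -> P.[s%:R] = 0) -> P = 0.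
Proof.
move=> P0; apply/eqP; apply/negP => /negP nzP.
pose rs : seq rat := [seq s%:R | s <- iota K (size P)].
have : (size rs < size P)%N.
  apply: max_poly_roots nzP _ _.
    apply/allP => y /mapP[s]; rewrite mem_iota => /andP[le_Ks _] ->.
    by apply/eqP/P0.
  rewrite map_inj_uniq ?iota_uniq // => a b /eqP.
  by rewrite eqr_nat => /eqP.
by rewrite size_map size_iota ltnn.
Qed.

Lemma digits_inj n B (a b : nat -> nat) :
  (forall i, (i < n)%N -> (a i < B)%N) -> (forall i, (i < n)%N -> (b i < B)%N) ->
  (\sum_(i < n) a i * B ^ i = \sum_(i < n) b i * B ^ i)%N ->
  forall i, (i < n)%N -> a i = b i.
Proof.
elim: n a b => // n IHn a b ltaB ltbB.
have B_gt0 : (0 < B)%N by apply: leq_ltn_trans (ltaB 0%N isT).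
have shiftE (c : nat -> nat) :
    (\sum_(i < n.+1) c i * B ^ i = (\sum_(i < n) c i.+1 * B ^ i) * B + c 0)%N.
  rewrite big_ord_recl expn0 muln1 addnC big_distrl; congr (_ + _)%N.
  by apply: eq_bigr => i _; rewrite expnSr mulnA.
rewrite !shiftE => eqS; have eq0 : a 0%N = b 0%N.
  by have := congr1 (modn^~ B) eqS; rewrite !modnMDl !modn_small ?ltaB ?ltbB.
have eqS' : (\sum_(i < n) a i.+1 * B ^ i = \sum_(i < n) b i.+1 * B ^ i)%N.
  by move: eqS; rewrite eq0 => /addIn/eqP; rewrite eqn_mul2r gtn_eqF // => /eqP.
case=> [|i] lt_i //.
exact: (IHn (fun i => a i.+1) (fun i => b i.+1) (fun i => ltaB i.+1) (fun i => ltbB i.+1)).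
Qed.

(** Kronecker's substitution of x^(B^i) for the i-th variable sends distinct monomials
    with exponents less than B to distinct powers of x. *)
Lemma mpoly_nat_roots n (p : {mpoly rat[n]}) :
  (forall v : 'I_n -> nat, (forall i, (0 < v i)%N) -> p.@[fun i => (v i)%:R] = 0) -> p = 0.
Proof.
move=> p0; pose B := msize p; pose e (m : 'X_{1..n}) := (\sum_(i < n) m i * B ^ i)%N.
pose G : {poly rat} := \sum_(m <- msupp p) p@_m *: 'X^(e m).
have G0 : G = 0.
  apply: (@poly_nat_roots _ 1) => s s_gt0.
  rewrite -[RHS](p0 (fun i => s ^ (B ^ i))%N) => [|i]; last by rewrite expn_gt0 s_gt0.
  rewrite horner_sum mevalE; apply: eq_bigr => m _.
  rewrite hornerZ hornerXn /e (big_morph _ (fun a b => exprD (s%:R : rat) a b) (expr0 _)).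
  congr (_ * _); apply: eq_bigr => i _.
  by rewrite natrX -exprM mulnC.
have m_lt m i : m \in msupp p -> (m i < B)%N.
  move=> m_in; apply: leq_ltn_trans (msize_mdeg_lt m_in).
  by rewrite mdegE (bigD1 i) //= leq_addr.
apply/mpolyP => m; rewrite mcoeff0.
have [m_in|] := boolP (m \in msupp p); last exact: memN_msupp_eq0.
have := congr1 (fun P : {poly rat} => P`_(e m)) G0.
rewrite coef0 /G coef_sum (bigD1_seq m) ?msupp_uniq //= coefZ coefXn eqxx mulr1.
rewrite big_seq_cond big1 ?addr0 // => m' /andP[m'_in ne_m].
rewrite coefZ coefXn; case: eqP => [eq_e|_]; last by rewrite mulr0.
case/eqP: ne_m; apply/mnmP => i.
pose ext (u : 'X_{1..n}) (j : nat) := if insub j is Some i then u (i : 'I_n) else 0%N.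
have extE u (j : 'I_n) : ext u j = u j by rewrite /ext valK.
rewrite -!extE; apply: (@digits_inj n B (ext m') (ext m)) => //.
- by move=> j lt_j; rewrite (extE _ (Ordinal lt_j)) m_lt.
- by move=> j lt_j; rewrite (extE _ (Ordinal lt_j)) m_lt.
- transitivity (e m'); first by apply: eq_bigr => j _; rewrite extE.
  by rewrite -eq_e; apply: eq_bigr => j _; rewrite extE.
Qed.

(** The moments depend linearly on the weights v, through a matrix which is invertible
    because the nodes k - t are distinct and nonzero. *)
Lemma mpoly_moment_roots k (Q : {mpoly rat[k]}) :
  (forall v : 'I_k -> nat, (forall t, (0 < v t)%N) ->
     Q.@[fun j => \sum_(t < k) (v t)%:R * (k - t)%:R ^+ j.+1] = 0) -> Q = 0.
Proof.
move=> Q0; pose nodes : 'rV[rat]_k := \row_t (k - t)%:R.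
pose W : 'M[rat]_k := \matrix_(j, t) (k - t)%:R ^+ j.+1.
have W_unit : W \in unitmx.
  have -> : W = Vandermonde k nodes *m diag_mx nodes.
    by rewrite mul_mx_diag; apply/matrixP => j t; rewrite !mxE exprSr.
  rewrite unitmxE det_mulmx unitfE mulf_neq0 //.
    rewrite det_Vandermonde; apply/prodf_neq0 => i _; apply/prodf_neq0 => j lt_ij.
    rewrite !mxE subr_eq0 eqr_nat; have := ltn_ord i; have := ltn_ord j; lia.
  rewrite det_diag; apply/prodf_neq0 => t _; rewrite mxE pnatr_eq0 subn_eq0 -ltnNge.
  exact: ltn_ord.
pose sub (M : 'M[rat]_k) : k.-tuple {mpoly rat[k]} := [tuple \sum_t M j t *: 'X_t | j < k].
have subE M (u : 'I_k -> rat) j : (tnth (sub M) j).@[u] = \sum_t M j t * u t.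
  by rewrite tnth_mktuple raddf_sum; apply: eq_bigr => t _ /=; rewrite mevalZ mevalXU.
have QW : Q \mPo sub W = 0.
  apply: mpoly_nat_roots => v v_gt0; rewrite comp_mpoly_meval -[RHS](Q0 v v_gt0).
  by apply: meval_eq => j; rewrite subE; apply: eq_bigr => t _; rewrite mxE mulrC.
apply: mpoly_nat_roots => v _.
pose u : 'cV[rat]_k := invmx W *m \col_i (v i)%:R.
rewrite -[RHS](meval0 (fun t => u t 0)) -QW comp_mpoly_meval.
apply: meval_eq => j; rewrite subE.
have := congr1 (fun M : 'cV[rat]_k => M j 0) (mulKVmx W_unit (\col_i (v i)%:R : 'cV_k)).
by rewrite -/u !mxE => <-.
Qed.

(** ** Multirectangular diagrams *)

(** A block (q, x) stands for s * q rows of length x. *)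
Definition block_partition (s : nat) (bs : seq (nat * nat)) : seq nat :=
  flatten [seq nseq (s * b.1) b.2 | b <- bs].

Section BlockTransform.
Variable A : comNzRingType.

(** For sigma = s this is the contribution of the rows of [block_partition s bs], with o
    rows above them: within a block consecutive factors cancel.  As it makes sense for
    any sigma, the number of rows can be made an indeterminate. *)
Fixpoint block_prod (sigma o : A) (bs : seq (nat * nat)) : fps A :=
  if bs is b :: bs' then
    lin (b.2%:R - o) * fpsV (lin (b.2%:R - o - sigma * b.1%:R))
      * block_prod sigma (o + sigma * b.1%:R) bs'
  else 1.

Definition block_transform (sigma : A) bs : fps A :=
  lin (- (sigma * (\sum_(b <- bs) b.1)%N%:R)) * block_prod sigma 0 bs.

Let row_prod (o : nat) w : fps A := \prod_(a < size w)
  (lin (row_end w a - o%:Z)%:~R * fpsV (lin (row_end w a - o%:Z - 1)%:~R)).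

Let row_prod_cons o x w :
  row_prod o (x :: w) =
  lin (x%:Z - o%:Z)%:~R * fpsV (lin (x%:Z - o%:Z - 1)%:~R) * row_prod o.+1 w.
Proof.
rewrite /row_prod big_ord_recl; congr (lin _%:~R * fpsV (lin _%:~R) * _).
- by rewrite /row_end /= subr0.
- by rewrite /row_end /= subr0.
apply: eq_bigr => a _.
have endE : row_end (x :: w) (lift ord0 a) - o%:Z = row_end w a - o.+1%:Z.
  by rewrite /row_end lift0 /= -!addrA -!opprD -!PoszD addSnnS.
by rewrite endE.
Qed.

Let row_prod_nseq o q x w :
  row_prod o (nseq q x ++ w) =
  lin (x%:Z - o%:Z)%:~R * fpsV (lin (x%:Z - o%:Z - q%:Z)%:~R) * row_prod (o + q) w.
Proof.
elim: q o => [|q IHq] o; first by rewrite subr0 addn0 fps_mulV ?lin0 // mul1r.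
rewrite [_ ++ _]/= row_prod_cons IHq addSnnS.
have -> : x%:Z - o.+1%:Z = x%:Z - o%:Z - 1 by lia.
have -> : x%:Z - o%:Z - 1 - q%:Z = x%:Z - o%:Z - q.+1%:Z by lia.
set a := lin _; set b := lin (_ - 1)%:~R; set c := fpsV (lin _).
have bV : b * fpsV b = 1 by apply: fps_mulV; apply: lin0.
transitivity (a * (b * fpsV b) * (c * row_prod (o + q.+1) w)); first by ring.
by rewrite bV; ring.
Qed.

Lemma block_transformE s bs :
  block_transform s%:R bs = row_transform A (block_partition s bs).
Proof.
rewrite /row_transform; congr (lin (- _) * _).
  rewrite -natrM; congr (_%:R); elim: bs => [|b bs IHbs]; first by rewrite big_nil muln0.
  by rewrite big_cons /block_partition /= size_cat size_nseq mulnDr IHbs.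
transitivity (row_prod 0 (block_partition s bs)); last first.
  by apply: eq_bigr => a _; rewrite subr0.
rewrite -[0]/(0%:R); elim: bs 0%N => [|b bs IHbs] o; first by rewrite /row_prod big_ord0.
rewrite [block_partition _ _]/= row_prod_nseq /= -natrM -natrD IHbs.
by rewrite PoszM !rmorphB /= -!pmulrn natrM.
Qed.

End BlockTransform.

Lemma block_partition_sorted s (bs : seq (nat * nat)) :
  sorted geq [seq b.2 | b <- bs] -> sorted geq (block_partition s bs).
Proof.
have geq_tr : transitive geq by move=> y z t zy yt; apply: leq_trans yt zy.
rewrite !(sorted_pairwise geq_tr).
elim: bs => // b bs IHbs /= /andP[/allP le_b /IHbs bs_sorted].
rewrite /block_partition /= pairwise_cat bs_sorted andbT; apply/andP; split.
  apply/allrelP => x y; rewrite mem_nseq => /andP[_ /eqP->] /flattenP[ys].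
  case/mapP=> c c_in -> ; rewrite mem_nseq => /andP[_ /eqP->].
  by apply: le_b; apply: map_f.
elim: (s * b.1)%N => // q IHq; rewrite /= IHq andbT.
by apply/allP => y; rewrite mem_nseq => /andP[_ /eqP->] /=.
Qed.

Lemma block_partition_of s (bs : seq (nat * nat)) :
  sorted geq [seq b.2 | b <- bs] -> (forall b, b \in bs -> 0 < b.2)%N ->
  is_partition_of (sumn (block_partition s bs)) (block_partition s bs).
Proof.
move=> bs_sorted bs_pos; rewrite /is_partition_of block_partition_sorted // eqxx andbT.
apply/negP => /flattenP[ys /mapP[b b_in ->]]; rewrite mem_nseq => /andP[_ /eqP b0].
by have := bs_pos b b_in; rewrite -b0.
Qed.

Lemma map_block_transform (A B : comNzRingType) (phi : {rmorphism A -> B}) sigma bs :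
  map_fps phi (block_transform sigma bs) = block_transform (phi sigma) bs.
Proof.
rewrite /block_transform rmorphM /= map_fps_lin rmorphN rmorphM rmorph_nat.
congr (_ * _); rewrite -[in RHS](rmorph0 phi); elim: bs 0 => [|b bs IHbs] o /=.
  by rewrite rmorph1.
rewrite !rmorphM /= map_fpsV !map_fps_lin IHbs.
by rewrite !(rmorphB, rmorphD, rmorphM, rmorph_nat).
Qed.

Lemma coef0_block_transform (A : comNzRingType) (sigma : A) bs :
  block_transform sigma bs 0%N = 1.
Proof.
rewrite /block_transform coef0_fpsM lin0 mul1r; elim: bs 0 => //= b bs IHbs o.
by rewrite !coef0_fpsM lin0 coef0_fps_inv ?lin0 // IHbs !mulr1.
Qed.

Lemma map_fpsO (A B : comNzRingType) (phi : {rmorphism A -> B}) (U F : fps A) :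
  map_fps phi (fpsO U F) = fpsO (map_fps phi U) (map_fps phi F).
Proof.
apply: fpsP => n; rewrite /map_fps /fpsO /fps_comp rmorph_sum; apply: eq_bigr => j _.
rewrite rmorphM !fps_expE; congr (_ * _).
by rewrite -[LHS]/(map_fps phi (F ^+ j) n) rmorphXn.
Qed.

Lemma map_inv_K (A B : comNzRingType) (phi : {rmorphism A -> B}) (R : fps A) :
  map_fps phi (inv_K R) = inv_K (map_fps phi R).
Proof. by rewrite /inv_K rmorphM /= map_fpsX map_fpsV. Qed.

(** ** First order in the size of the blocks *)

Section FirstOrder.
Local Notation A := {poly rat}.
Local Notation ev0 := (map_fps (horner_eval (0 : rat))).
(* The derivative at 'X = 0 *)
Let del (f : fps A) : fps rat := fun n => (f n)`_1.

Let ev0E (f : fps A) n : ev0 f n = (f n)`_0.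
Proof. by rewrite /map_fps /= /horner_eval horner_coef0. Qed.

Let delM f g : del (f * g) = del f * ev0 g + ev0 f * del g.
Proof.
apply: fpsP => n; rewrite coef_fpsD !coef_fpsM /del coef_sum -big_split.
apply: eq_bigr => i _.
transitivity ((f i)`_1 * (g (n - i)%N)`_0 + (f i)`_0 * (g (n - i)%N)`_1).
  by rewrite coefM big_ord_recl big_ord1 subn0 addrC.
by rewrite -!ev0E.
Qed.

Let delD f g : del (f + g) = del f + del g.
Proof. by apply: fpsP => n; rewrite coef_fpsD /del coefD. Qed.

Let del1 : del 1 = 0.
Proof.
apply: fpsP => n; rewrite /del coef_fps1.
by case: eqP => _; rewrite ?coef0 // mulr1n coef1.
Qed.

Let ev0_1X (f : fps A) : ev0 (1 + fpsC 'X * f) = 1.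
Proof.
rewrite rmorphD rmorph1 rmorphM /= map_fpsC /= /horner_eval hornerX.
by rewrite rmorph0 mul0r addr0.
Qed.

Let del_1X (f : fps A) : del (1 + fpsC 'X * f) = ev0 f.
Proof.
rewrite delD del1 add0r; apply: fpsP => n.
by rewrite ev0E /del coef_fpsCM coefXM.
Qed.

Variables (bs : seq (nat * nat)) (R : fps A).
Hypothesis R0 : R 0%N = 1.
Let F := inv_K R.
Hypothesis RU : R * fpsO (block_transform 'X bs) F = 1.

Let F0 : F 0%N = 0. Proof. exact: coef0_inv_K. Qed.

(* Each block contributes a factor 1 + O('X). *)
Let lin_step (b v : A) (o : A) :
  fpsO (lin (b - o) * fpsV (lin (b - o - 'X * v))) F =
  1 + fpsC 'X * (- (fpsC v * F * fpsV (1 - fpsC (b - o - 'X * v) * F))).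
Proof.
rewrite fps_compM // fps_compV ?lin0 // !fpsO_lin //.
set c := b - o - 'X * v; have -> : b - o = c + 'X * v by rewrite /c; ring.
have cV : (1 - fpsC c * F) * fpsV (1 - fpsC c * F) = 1.
  by apply: fps_mulV; rewrite coef_fpsB coef_fpsCM F0 mulr0 subr0.
rewrite rmorphD rmorphM /=.
transitivity ((1 - fpsC c * F) * fpsV (1 - fpsC c * F)
   - fpsC 'X * fpsC v * F * fpsV (1 - fpsC c * F)); first by ring.
by rewrite cV; ring.
Qed.

Let ev0_block l o : ev0 (fpsO (block_prod 'X o l) F) = 1.
Proof.
elim: l o => [|b l IHl] o /=; first by rewrite fps_comp1 rmorph1.
by rewrite fps_compM // rmorphM /= lin_step ev0_1X IHl mulr1.
Qed.

Let lin_front : fpsO (lin (- ('X * (\sum_(b <- bs) b.1)%N%:R))) F =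
  1 + fpsC 'X * (fpsC (\sum_(b <- bs) b.1)%N%:R * F).
Proof. by rewrite fpsO_lin // rmorphN rmorphM /=; ring. Qed.

Lemma ev0_R : ev0 R = 1.
Proof.
have := congr1 (fun f => ev0 f) RU; rewrite rmorphM rmorph1 /=.
by rewrite /block_transform fps_compM // rmorphM /= lin_front ev0_1X ev0_block !mulr1.
Qed.

Let ev0_F : ev0 F = fX rat.
Proof.
have V1 : fpsV 1 = 1 :> fps rat by apply/esym/fps_invP; rewrite ?mulr1.
by rewrite /F map_inv_K ev0_R /inv_K V1 mulr1.
Qed.

Let del_block l o : o.[0] = 0 -> del (fpsO (block_prod 'X o l) F) =
  - \sum_(b <- l) fpsC b.1%:R * (fX rat * fpsV (lin b.2%:R)).
Proof.
elim: l o => [|b l IHl] o o0 /=; first by rewrite fps_comp1 del1 big_nil oppr0.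
rewrite fps_compM // delM lin_step ev0_1X del_1X mul1r big_cons opprD.
rewrite IHl ?hornerD ?hornerM ?o0 ?hornerX ?mul0r ?addr0 //; congr (_ + _).
rewrite ev0_block mulr1 rmorphN 2!rmorphM /= map_fpsC ev0_F map_fpsV.
rewrite rmorphB rmorph1 rmorphM /= map_fpsC ev0_F /= /horner_eval.
by rewrite !hornerE o0 !subr0 -!polyC_natr !hornerC -/(lin _).
Qed.

(** When the number of rows of the blocks tends to 0, the free cumulants tend to 0 with
    these rates. *)
Lemma first_order j : (R j.+2)`_1 = \sum_(b <- bs) b.1%:R * b.2%:R ^+ j.+1.
Proof.
have := congr1 del RU; rewrite delM del1 ev0_R mul1r.
rewrite /block_transform fps_compM // rmorphM /= lin_front delM ev0_1X del_1X.
rewrite ev0_block !mulr1 mul1r del_block ?horner0 // rmorphM /= map_fpsC ev0_F.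
move/(congr1 (fun f : fps rat => f j.+2)).
rewrite !coef_fpsD coef_fpsCM coef_fpsN coef_fps_sum coef_fps0 /= mulr0 add0r.
move/eqP; rewrite subr_eq0 -[LHS]/(del R j.+2) => /eqP ->; apply: eq_bigr => b _.
by rewrite coef_fpsCM coef_fpsXM coef_lin_inv.
Qed.

End FirstOrder.

(** Along the multirectangular diagrams with s v_t rows of length k - t, p is a polynomial
    in s with infinitely many roots, hence zero.  If the coefficients of p of degree
    less than d vanish, its coefficient of s^d is the part of degree d of p at the
    moments of v, by [first_order]; so this part vanishes too. *)
Theorem free_cumulants_dense k (p : {mpoly rat[k]}) : (0 < k)%N ->
  (forall N w (R : fps rat), (k <= N)%N -> is_partition_of N w -> R 0%N = 1 ->
     R * fpsO (row_transform rat w) (inv_K R) = 1 -> p.@[fun j : 'I_k => R j.+2] = 0) ->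
  p = 0.
Proof.
move=> k_gt0 p0; suff p_d d m : mdeg m = d -> p@_m = 0.
  by apply/mpolyP => m; rewrite mcoeff0 (p_d _ m erefl).
elim/ltn_ind: d m => d IHd m m_d.
suff Q0 : pihomog mdeg d p = 0.
  have := congr1 (mcoeff m) Q0; rewrite mcoeff0 /pihomog raddf_sum /=.
  have [m_in <-|/memN_msupp_eq0 -> //] := boolP (m \in msupp p).
  rewrite big_mkcond (bigD1_seq m) ?msupp_uniq //= m_d eqxx mcoeffZ mcoeffX eqxx mulr1.
  rewrite big1 ?addr0 // => m' /negPf ne_m; case: ifP => // _.
  by rewrite mcoeffZ mcoeffX ne_m mulr0.
apply: mpoly_moment_roots => v v_gt0.
pose bs := [seq (v t, (k - t)%N) | t <- enum 'I_k].
have [R R0 RU] := free_cumulants_exist (coef0_block_transform ('X : {poly rat}) bs).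
pose G := mmap (@polyC rat) (fun j : 'I_k => R j.+2) p.
have Gs (s : rat) : G.[s] = p.@[fun j : 'I_k => (R j.+2).[s]].
  rewrite /G /mmap mevalE horner_sum; apply: eq_bigr => m' _.
  rewrite hornerM hornerC /mmap1 horner_prod; congr (_ * _).
  by apply: eq_bigr => j _; rewrite horner_exp.
have bs_sorted : sorted geq [seq b.2 | b <- bs].
  rewrite -map_comp (eq_map (g := (fun t => k - t)%N \o val)) // map_comp val_enum_ord.
  rewrite sorted_map; apply: sub_sorted (iota_ltn_sorted 0 k) => a b /=.
  by move=> lt_ab; rewrite leq_sub2l // ltnW.
have bs_pos b : b \in bs -> (0 < b.2)%N.
  by case/mapP=> t _ ->; rewrite subn_gt0.
have G0 : G = 0.
  apply: (@poly_nat_roots _ k) => s le_ks; rewrite Gs.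
  pose Rs := map_fps (horner_eval (s%:R : rat)) R.
  apply: (p0 _ _ Rs _ (block_partition_of s bs_sorted bs_pos)).
  - rewrite /block_partition sumn_flatten sumnE 3!big_map big_enum /=.
    rewrite (bigD1 (Ordinal k_gt0)) //= sumn_nseq subn0 (leq_trans le_ks) //.
    apply: leq_trans (leq_addr _ _).
    have pos : (1 <= v (Ordinal k_gt0) * k)%N by rewrite muln_gt0 v_gt0.
    by have := leq_mul (leqnn s) pos; lia.
  - by rewrite /Rs /map_fps R0 rmorph1.
  have evX : map_fps (horner_eval (s%:R : rat)) (block_transform 'X bs)
             = block_transform s%:R bs.
    by rewrite map_block_transform /= /horner_eval hornerX.
  by rewrite /Rs -map_inv_K -block_transformE -evX -map_fpsO -rmorphM RU rmorph1.
have Rcoef0 (j : 'I_k) : (R j.+2)`_0 = 0.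
  have := congr1 (fun f : fps rat => f j.+2) (ev0_R RU).
  by rewrite /map_fps /= /horner_eval horner_coef0.
pose E (j : 'I_k) : {poly rat} := \poly_(i < size (R j.+2)) (R j.+2)`_i.+1.
have RE (j : 'I_k) : R j.+2 = 'X * E j.
  apply/polyP => -[|i]; rewrite coefXM //= coef_poly.
  by case: ltnP => // le_i; rewrite nth_default // ltnW.
transitivity (G`_d); last by rewrite G0 coef0.
rewrite /pihomog raddf_sum /G /mmap coef_sum big_mkcond /=; apply: eq_bigr => m' _.
rewrite coefCM; have -> : mmap1 (fun j : 'I_k => R j.+2) m' = 'X^(mdeg m') * \prod_j E j ^+ m' j.
  rewrite /mmap1 (eq_bigr _ (fun j _ => congr1 (fun P => P ^+ m' j) (RE j))).
  rewrite (eq_bigr (fun j => 'X^(m' j) * E j ^+ m' j)) => [|j _]; last by rewrite exprMn.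
  by rewrite big_split /= -(big_morph _ (fun a b => exprD 'X a b) (expr0 'X)) mdegE.
rewrite coefXnM.
case: ltngtP => [lt_d|gt_d|eq_d].
- by rewrite mulr0.
- by rewrite (IHd _ gt_d _ erefl) mul0r.
rewrite eq_d subnn mevalZ mevalX; congr (_ * _).
rewrite -horner_coef0 horner_prod; apply: eq_bigr => j _; rewrite horner_exp.
congr (_ ^+ _); rewrite horner_coef0.
have -> : (E j)`_0 = (R j.+2)`_1 by rewrite RE coefXM.
by rewrite (first_order RU) big_map big_enum.
Qed.

(** * Kerov's polynomial *)

Lemma meval_map_intr k (p : {mpoly int[k]}) (v : 'I_k -> int) :
  (map_mpoly (intr : int -> rat) p).@[fun j => (v j)%:~R] = (p.@[v])%:~R.
Proof.
elim/mpolyind: p => [|c m p _ _ IHp]; first by rewrite raddf0 !meval0.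
rewrite rmorphD /= !mevalD IHp rmorphD /=; congr (_ + _).
rewrite -mul_mpolyC rmorphM /= map_mpolyC map_mpolyX !mevalM !mevalC !mevalX.
rewrite rmorphM rmorph_prod; congr (_ * _); apply: eq_bigr => j _.
by rewrite rmorphXn.
Qed.

Lemma row_end_inj w : sorted geq w ->
  injective (fun a : 'I_(size w) => (row_end w a - 1)%:~R : rat).
Proof.
move=> w_sorted.
have geq_tr : transitive geq by move=> y z t zy yt; apply: leq_trans yt zy.
have decr (a b : 'I_(size w)) : (a < b)%N -> (nth 0 w b <= nth 0 w a)%N.
  by move=> lt_ab; apply: (sorted_ltn_nth geq_tr 0%N w_sorted); rewrite ?inE.
move=> a b /intr_inj; rewrite /row_end => eq_ab; apply: val_inj.
by have [/[dup]/decr|/[dup]/decr|//] := ltngtP a b; lia.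
Qed.

(** By [kerov_value] and [taylor_frobenius] both sides have the same values at the free
    cumulants of all partitions of integers N >= k, which are dense. *)
Theorem kerov_polynomialE k (Sigma : {mpoly int[k]}) : (0 < k)%N ->
  is_kerov_polynomial Sigma -> map_mpoly (intr : int -> rat) Sigma = kerov_candidate k.
Proof.
move=> k_gt0 SigmaP; apply/eqP; rewrite -subr_eq0; apply/eqP.
apply: (free_cumulants_dense k_gt0) => N w R le_kN w_part R0 RU.
have w_sorted : sorted geq w by case/and3P: w_part.
have [R' R'0 R'U] := free_cumulants_exist (coef0_row_transform int w).
have RE : R = map_fps intr R'.
  apply: (free_cumulants_unique (coef0_row_transform rat w)) => //.
    by rewrite /map_fps R'0.
  by rewrite -map_inv_K -(map_row_transform intr) -map_fpsO -rmorphM R'U rmorph1.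
have SigmaE := kerov_value (introT andP (conj k_gt0 le_kN)) SigmaP w_part
  (is_free_cumulants_rows w_sorted R'0 R'U).
rewrite mevalB meval_candidate // [X in X.@[_] - _](_ : _ = map_mpoly intr Sigma) //.
have -> : (map_mpoly (intr : int -> rat) Sigma).@[fun j : 'I_k => R j.+2] =
    (Sigma.@[fun j : 'I_k => R' j.+2])%:~R.
  by rewrite -meval_map_intr; apply: meval_eq => j; rewrite RE.
rewrite SigmaE; apply/eqP; rewrite subr_eq0; apply/eqP.
have D0 : (R - euler R) 0%N = 1 by rewrite coef_fpsB coef_euler R0 subr0.
rewrite (@taylor_frobenius R _ (size w) k (fun a => (row_end w a - 1)%:~R)) //; last first.
- have F0 : inv_K R 0%N = 0 by apply: coef0_inv_K.
  have front : fpsO (lin (- (size w)%:R)) (inv_K R) = 1 + fpsC (size w)%:R * inv_K R.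
    by rewrite fpsO_lin // rmorphN /=; ring.
  have := row_transform_free_cumulants RU; rewrite front => RF.
  under [RHS]eq_bigr do rewrite -fpsO_lin //.
  rewrite -RF; congr (_ * (_ * _)); apply: eq_bigr => a _.
  by rewrite fpsO_lin // rmorphB /= subrK.
- by rewrite mulrC fps_mulV.
- exact: row_end_inj.
rewrite mulrA mulrNN mulVf ?mul1r ?pnatr_eq0 -?lt0n //.
have beadE (a : 'I_(size w)) :
    (bead w (rev_ord a))%:R = (row_end w a - 1)%:~R + (size w)%:R :> rat.
  have -> : (bead w (rev_ord a))%:R = (bead w (rev_ord a))%:Z%:~R :> rat by rewrite -pmulrn.
  rewrite -[(size w)%:R]/((size w)%:Z%:~R) -rmorphD; congr (_%:~R).
  rewrite /bead /part_row /row_end /= subnSK // subKn; last exact: ltnW.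
  by have := ltn_ord a; lia.
rewrite (reindex_inj rev_ord_inj) /=; apply: eq_bigr => a _; congr (_ * _).
  by apply: eq_bigr => j _; rewrite beadE.
rewrite (reindex_inj rev_ord_inj) /=; apply: eq_big => [b|b _].
  by rewrite (inj_eq rev_ord_inj).
by rewrite !beadE; congr ((_ - _) / _); ring.
Qed.

Theorem theorem2p2 (n k : nat) (Sigma : {mpoly int[k]}) :
  (1 <= n)%N -> (2 * n - 1 <= k)%N ->
  is_kerov_polynomial Sigma ->
  map_mpoly (intr : int -> rat) (weight_part Sigma (k + 1 - 2 * n))
  = - (k%:R^-1 : rat) *:
      (((k%:R - 1) / (2 * n)%:R * mhat k [:: (2 * n)%N])
         *: Pser k (2 * n - 1) (k + 1 - 2 * n)
       + \sum_(lambda <- partitions (2 * n) | (2 <= size lambda)%N)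
           mhat k lambda *:
             fps_mul (Ppart k lambda) (fps_inv (Cser k)) (k + 1 - 2 * n)).
Proof.
move=> n_gt0 le_nk SigmaP; have k_gt0 : (0 < k)%N by lia.
have le_2n : (2 * n <= k.+1)%N by lia.
rewrite map_weight_part (kerov_polynomialE k_gt0 SigmaP) addn1 weight_candidate //.
congr (_ *: _).
rewrite -(partition_sum (fun i : 'I_k.-1 => (i.+1)%:R) (k.+1 - 2 * n) le_2n).
rewrite (bigID (fun lambda => 2 <= size lambda)%N) /= addrC; congr (_ + _).
have [d nd] : exists d, (2 * n = d.+2)%N by exists (2 * n - 2)%N; lia.
(* The partition with one part is the only one excluded from the sum. *)
have part1 : [:: (2 * n)%N] \in partitions (2 * n).
  by rewrite mem_partitions /is_partition_of /= inE addn0 eqxx andbT nd.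
rewrite big_mkcond (bigD1_seq _ part1) ?uniq_partitions //=.
rewrite [X in _ + X]big_seq_cond big1 ?addr0 => [|lambda /andP[]]; last first.
  rewrite mem_partitions => /and3P[_ l0 /eqP l_sum] ne_l; case: ifP => //.
  case: lambda l0 l_sum ne_l => [|x [|y l]] //=; first by rewrite nd.
  by rewrite addn0 => _ ->; rewrite eqxx.
have -> : (fps_mul (Pser k (2 * n)) (fps_one _) : fps {mpoly rat[k]}) = Pser k (2 * n).
  exact: (mulr1 (Pser k (2 * n) : fps {mpoly rat[k]})).
rewrite nd in le_2n *; rewrite Pser_div_C scalerA subn1 mulrC; congr (_ * _ *: _).
by congr (_ / _); rewrite -(natrB _ k_gt0); congr (_%:R); lia.
Qed.
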